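(* Let $(\bar u,\bar\alpha,\bar m,\bar\mu,\bar b)$ be a fixed solution of the risk-averse mean field game system described in the context. Let $\xi\in(0,1/2)$ and set $$\tau(d)=\begin{cases}1/2-\xi&\text{if }d\in\{1,2\},\\ 1/d&\text{if }d\ge3.\end{cases}$$ There exists a constant $C>0$, independent of $N$, such that for every number of players $N\ge1$ the $N$-tuple $\bar{\boldsymbol A}=(\bar A^1,\dots,\bar A^N)$ of controls $\bar A^i_t=\bar\alpha_t(\bar X^i_t)$, where $\bar X^i$ solves $\bar X^i_0=X^i_0$, $\bar X^i_{t+1}=\bar X^i_t+\bar\alpha_t(\bar X^i_t)+Y^i_t$, is an $\varepsilon$-Nash equilibrium of the $N$-player game with $\varepsilon=CN^{-\tau(d)/2}$, that is, for every $i\in\{1,\dots,N\}$, $$\mathcal J^{i,N}(\bar A^i,\bar{\boldsymbol A}^{-i})\le\inf_{A^i\in\boldsymbol{\mathcal A}}\mathcal J^{i,N}(A^i,\bar{\boldsymbol A}^{-i})+CN^{-\tau(d)/2}.$$ In addition, for every $i\in\{1,\dots,N\}$, $$|\mathcal J^{i,N}(\bar{\boldsymbol A})-\mathcal J^i(\bar A^i,\bar b)|\le CN^{-\tau(d)/2}.$$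
   Context: Notation. $d,T\ge 1$ are integers, $\mathcal T=\{0,\dots,T-1\}$, $\bar{\mathcal T}=\{0,\dots,T\}$. $\mathrm{id}$ is the identity of $\mathbb R^d$ and $1\text{-Lip}$ denotes the $1$-Lipschitz maps on $\mathbb R^d$. For $p\ge1$, $C>0$, $\mathcal G_p^C$ is the set of maps $f$ from $\mathbb R^d$ to $\mathbb R^{d'}$ ($d'$ given by the context) with $|f(x)|\le C(1+|x|^p)$; $\mathcal G_p=\bigcup_{C>0}\mathcal G_p^C$; $\|f\|_{\mathcal G,p}=\sup_x |f(x)|/(1+|x|^p)$. $\mathcal Q_p^C$ is the set of convex $f:\mathbb R^d\to\mathbb R$ with $-C\le f(x)\le C(1+|x|^p)$ for all $x$. $\mathcal P_p(\mathbb R^k)$ is the set of Borel probability measures with finite $p$-th moment, and $\mathcal P_p^C(\mathbb R^k)$ those with $\int|x|^p\,\mathrm dm\le C$. $d_1(\mu,\nu)=\sup_{\phi\ 1\text{-Lipschitz}}\int\phi\,\mathrm d(\mu-\nu)$. $\mathcal B_2=(\mathcal P_2(\mathbb R^{2d}))^T\times\mathcal P_2(\mathbb R^d)$, with product distance (sum of the componentwise $d_1$ distances), also denoted $d_1$. $\ast$ is convolution of measures and $g\sharp m$ is the push-forward of $m$ by $g$. Data. $F:\bar{\mathcal T}\times\mathbb R^d\times\mathcal B_2\to\mathbb R$, $P:\mathcal T\times\mathcal B_2\to\mathbb R^d$, an initial law $\bar m_0\in\mathcal P_2(\mathbb R^d)$, $\nu(t)\in\mathcal P_2(\mathbb R^d)$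 for $t\in\mathcal T$, and $\ell(t,x,a,b)=\frac12|a|^2+\langle a,P(t,b)\rangle+F(t,x,b)$. For each $t\in\mathcal T$, $\mathcal Z_t$ is a nonempty convex set of functions $Z\in L^\infty(\mathbb R^d,\nu(t))$ with $Z\ge0$ and $\int Z\,\mathrm d\nu(t)=1$, and $\mathcal M_t=\{\xi\in\mathcal P(\mathbb R^d):\mathrm d\xi=Z\,\mathrm d\nu(t),\ Z\in\mathcal Z_t\}$. Standing assumptions. There is $C>0$ such that: (1) $\bar m_0\in\mathcal P_2^C(\mathbb R^d)$ and $\nu(t)\in\mathcal P_2^C(\mathbb R^d)$ for all $t\in\mathcal T$; (2) for all $t\in\mathcal T$, $\|Z\|_\infty\le C$ for every $Z\in\mathcal Z_t$, and some $Z'\in\mathcal Z_t$ satisfies $Z'\ge1/C$ a.e.; (3) for all $b_1,b_2\in\mathcal B_2$: for all $t\in\bar{\mathcal T}$, $F(t,\cdot,b_1)\in\mathcal Q_2^C$ and $\|F(t,\cdot,b_1)-F(t,\cdot,b_2)\|_{\mathcal G,2}\le C d_1(b_1,b_2)$; for all $t\in\mathcal T$, $|P(t,b_1)-P(t,b_2)|\le C d_1(b_1,b_2)$ and $|P(t,b_1)|\le C$; (4) for all $t\in\bar{\mathcal T}$ and $b_1,b_2\in\mathcal B_2$, $F(t,\cdot,b_1)\in\mathcal Q_1^C$ and $\|F(t,\cdot,b_1)-F(t,\cdot,b_2)\|_{\mathcal G,1}\le C d_1(b_1,b_2)$. Mean field game system. A solution is $(u,\alpha,m,\mu,b)\in(\mathcal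 G_2)^{T+1}\times(\mathcal G_1\cap1\text{-Lip})^T\times(\mathcal P_2(\mathbb R^d))^{T+1}\times(\mathcal P_2(\mathbb R^{2d}))^T\times\mathcal B_2$ such that for all $(t,x)\in\mathcal T\times\mathbb R^d$: $u(t,x)=\inf_{a\in\mathbb R^d}\big(\ell(t,x,a,b)+\sup_{\xi\in\mathcal M_t}\int u(t+1,x+a+y)\,\mathrm d\xi(y)\big)$, $u(T,x)=F(T,x,b)$; $\alpha_t(x)$ is the unique minimizer of this infimum; $m(t+1)=\nu(t)\ast[(\mathrm{id}+\alpha_t)\sharp m(t)]$, $m(0)=\bar m_0$; $\mu(t)=(\mathrm{id},\alpha_t)\sharp m(t)$; $b=(\mu(0),\dots,\mu(T-1),m(T))$. $N$-player game. Let $\mathcal N=\{1,\dots,N\}$. On a probability space, $(X^i_0)_{i\in\mathcal N}$ are i.i.d. with law $\bar m_0$, and $(Y^i_t)_{i\in\mathcal N,t\in\mathcal T}$ are independent, independent of $(X^i_0)_i$, with $Y_t^i$ of law $\nu(t)$. $\boldsymbol{\mathcal F}_0=\sigma(X_0^1,\dots,X_0^N)$, $\boldsymbol{\mathcal F}_{t+1}=\sigma\big((X^j_0)_{j\in\mathcal N},(Y^j_s)_{j\in\mathcal N,s\le t}\big)$. $\boldsymbol{\mathcal A}$ is the set of processes $A=(A_0,\dots,A_{T-1})$ with $A_t\in L^2(\boldsymbol{\mathcal F}_t;\mathbb R^d)$. The state of player $i$ with control $A^i\in\boldsymbol{\mathcal A}$ is $X^i_0[A^i]=X_0^i$, $X^i_{t+1}[A^i]=X^i_t[A^i]+A^i_t+Y^i_t$.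 For $\boldsymbol A=(A^1,\dots,A^N)\in\boldsymbol{\mathcal A}^N$, $\boldsymbol A^{-i}$ is $\boldsymbol A$ with its $i$-th entry removed, $m^N_{\boldsymbol A}(t)=\frac1N\sum_j\delta_{X^j_t[A^j]}$, $\mu^N_{\boldsymbol A}(t)=\frac1N\sum_j\delta_{(X^j_t[A^j],A^j_t)}$, and $b^N_{\boldsymbol A}=(\mu^N_{\boldsymbol A}(0),\dots,\mu^N_{\boldsymbol A}(T-1),m^N_{\boldsymbol A}(T))$ (a random element of $\mathcal B_2$). For $t\in\mathcal T$, $\rho^i_t:L^1(\boldsymbol{\mathcal F}_{t+1})\to L^1(\boldsymbol{\mathcal F}_t)$ is $\rho^i_t(U)=\sup_{Z\in\mathcal Z_t}\mathbb E[U\,Z(Y^i_t)\mid\boldsymbol{\mathcal F}_t]$ (essential supremum), and $\rho^i(U)=\mathbb E[\rho^i_0\circ\cdots\circ\rho^i_{T-1}(U)]$ for $U\in L^1(\boldsymbol{\mathcal F}_T)$. The costs are $\mathcal J^{i,N}(A^i,\boldsymbol A^{-i})=\mathcal J^{i,N}(\boldsymbol A)=\rho^i\big(\sum_{t=0}^{T-1}\ell(t,X^i_t[A^i],A^i_t,b^N_{\boldsymbol A})+F(T,X^i_T[A^i],b^N_{\boldsymbol A})\big)$ and, for $b\in\mathcal B_2$, $\mathcal J^i(A^i,b)=\rho^i\big(\sum_{t=0}^{T-1}\ell(t,X^i_t[A^i],A^i_t,b)+F(T,X^i_T[A^i],b)\big)$. *)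

(* Defs.v *)
From HB Require Import structures.
From mathcomp Require Import all_boot all_order all_algebra.
From mathcomp Require Import all_classical all_reals all_analysis.

Set Implicit Arguments.
Unset Strict Implicit.
Unset Printing Implicit Defensive.

Import Order.TTheory GRing.Theory Num.Theory.
Import numFieldNormedType.Exports.

Local Open Scope classical_set_scope.
Local Open Scope ring_scope.

(* R^k is ['rV[R]_k].  The library topology on matrices is the product one, so the sigma-algebra
   generated by its open sets is the usual Borel sigma-algebra. *)
Definition borel_mx_display : measure_display.
Proof. exact: default_measure_display. Qed.

HB.instance Definition _ (R : realType) (p q : nat) :=
  @isMeasurable.Build borel_mx_display 'M[R]_(p, q)
    <<s @open 'M[R]_(p, q) >>
    (@sigma_algebra0 _ setT (@open 'M[R]_(p, q)))
    (@sigma_algebraC _ (@open 'M[R]_(p, q)))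
    (@sigma_algebra_bigcup _ setT (@open 'M[R]_(p, q))).

Section euclidean.
Context {R : realType}.

Definition dotp {k} (x y : 'rV[R]_k) : R := \sum_(i < k) x 0 i * y 0 i.

(* The library norm on ['rV[R]_k] is the sup norm, hence this definition. *)
Definition enorm {k} (x : 'rV[R]_k) : R := Num.sqrt (dotp x x).

(* In the next three definitions [nrm] is the norm of the codomain: [enorm]
   for R^{d'}-valued maps, [Num.norm] for real-valued ones. *)
Definition growth {k} {W : Type} (nrm : W -> R) (p : nat) : set ('rV[R]_k -> W) :=
  [set f | exists2 C : R, 0 < C &
           forall x, nrm (f x) <= C * (1 + enorm x ^+ p)].

Definition growth_norm {k} {W : Type} (nrm : W -> R) (p : nat)
    (f : 'rV[R]_k -> W) : \bar R :=
  ereal_sup [set (nrm (f x) / (1 + enorm x ^+ p))%:E | x in [set: 'rV[R]_k]].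

Definition lip1 {k} {W : zmodType} (nrm : W -> R) : set ('rV[R]_k -> W) :=
  [set f | forall x y, nrm (f x - f y) <= enorm (x - y)].

Definition convex_growth {k} (p : nat) (C : R) : set ('rV[R]_k -> R) :=
  [set f | @convex_function R 'rV[R]_k setT f /\
           forall x, - C <= f x <= C * (1 + enorm x ^+ p)].

End euclidean.

(* Values of a measure outside the sigma-algebra are unconstrained, so equality
   of laws is tested on measurable sets only. *)
Definition eq_law {dT} {E : measurableType dT} {R : realType}
    (mu nu : set E -> \bar R) : Prop :=
  forall A : set E, measurable A -> mu A = nu A.

Section wasserstein_spaces.
Context {R : realType}.

Definition moment {k} (p : nat) (mu : probability 'rV[R]_k R) : \bar R :=
  (\int[mu]_x (enorm x ^+ p)%:E)%E.

Definition finite_moment {k} (p : nat) : set (probability 'rV[R]_k R) :=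
  [set mu | (moment p mu < +oo)%E].

Definition moment_le {k} (p : nat) (C : R) : set (probability 'rV[R]_k R) :=
  [set mu | (moment p mu <= C%:E)%E].

Definition d1 {k} (mu nu : probability 'rV[R]_k R) : \bar R :=
  ereal_sup [set (\int[mu]_x (phi x)%:E - \int[nu]_x (phi x)%:E)%E
            | phi in @lip1 R k R Num.norm].

Definition convolution {k} (mu nu : set 'rV[R]_k -> \bar R) :
    set 'rV[R]_k -> \bar R :=
  pushforward (mu \x nu)%E (fun z : 'rV[R]_k * 'rV[R]_k => z.1 + z.2).

Definition flow (R : realType) (d T : nat) : Type :=
  (('I_T -> probability 'rV[R]_(d + d) R) * probability 'rV[R]_d R)%type.

Definition B2 {d T} : set (flow R d T) :=
  [set b | (forall t, finite_moment 2 (b.1 t)) /\ finite_moment 2 b.2].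

Definition d1_flow {d T} (b c : flow R d T) : \bar R :=
  (\sum_(t < T) d1 (b.1 t) (c.1 t) + d1 b.2 c.2)%E.

End wasserstein_spaces.

Section empirical_measure.
Context {R : realType} {dT : measure_display} {E : measurableType dT} {n : nat}.
Variable x : 'I_n.+1 -> E.

Definition empirical (A : set E) : \bar R :=
  ((n.+1%:R^-1)%:E * \sum_(j < n.+1) \d_(x j) A)%E.

Let empiricalE : empirical =
  mscale (n.+1%:R^-1)%:nng (msum (fun k => \d_(x (inord k))) n.+1).
Proof.
apply/funext => A; rewrite /empirical /mscale /msum/=; congr (_ * _)%E.
by apply: eq_bigr => i _; rewrite inord_val.
Qed.

Let empirical0 : empirical set0 = 0%E.
Proof. by rewrite empiricalE measure0. Qed.

Let empirical_ge0 A : (0 <= empirical A)%E.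
Proof. by rewrite empiricalE measure_ge0. Qed.

Let empirical_sigma_additive : semi_sigma_additive empirical.
Proof. by rewrite empiricalE; exact: measure_semi_sigma_additive. Qed.

HB.instance Definition _ := isMeasure.Build _ _ _ empirical
  empirical0 empirical_ge0 empirical_sigma_additive.

Let empirical_setT : empirical setT = 1%E.
Proof.
rewrite /empirical (eq_bigr (fun=> (1%:R)%:E)); last by move=> j _; rewrite diracT.
by rewrite sumEFin -EFinM sumr_const card_ord mulVf// pnatr_eq0.
Qed.

HB.instance Definition _ :=
  Measure_isProbability.Build _ _ _ empirical empirical_setT.

End empirical_measure.

(* Maps on [flow] and sequences in [t] are total; only their values on [B2],
   resp. for [t < T] ([t <= T] for [cpl]), are ever used.
   [dens t] is a set of representatives of the classes in Z_t. *)
Record mfg_data (R : realType) (d T : nat) := MFGData {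
  cpl : nat -> 'rV[R]_d -> flow R d T -> R ;              (* F *)
  price : nat -> flow R d T -> 'rV[R]_d ;                 (* P *)
  init : probability 'rV[R]_d R ;                         (* m_0 *)
  noise : nat -> probability 'rV[R]_d R ;                 (* nu *)
  dens : nat -> set ('rV[R]_d -> R) }.                    (* Z_t *)

Section mean_field_game.
Context {R : realType} {d T : nat} (D : mfg_data R d T).
Local Notation V := 'rV[R]_d.

Definition ell (t : nat) (x a : V) (b : flow R d T) : R :=
  2^-1 * enorm a ^+ 2 + dotp a (price D t b) + cpl D t x b.

Definition ambiguity (t : nat) : set (probability V R) :=
  [set q | exists2 Z, dens D t Z &
     eq_law q (fun A => \int[noise D t]_(x in A) (Z x)%:E)%E].

Record well_formed_data : Prop := {
  init_moment : finite_moment 2 (init D) ;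
  noise_moment : forall t, (t < T)%N -> finite_moment 2 (noise D t) ;
  dens_nonempty : forall t, (t < T)%N -> dens D t !=set0 ;
  dens_convex : forall t, (t < T)%N -> @convex_set R (V -> R^o) (dens D t) ;
  dens_Linfty : forall t Z, (t < T)%N -> dens D t Z ->
    Z \in Lfun (noise D t) +oo%E ;
  dens_ge0 : forall t Z, (t < T)%N -> dens D t Z ->
    {ae noise D t, forall x, 0 <= Z x} ;
  dens_int1 : forall t Z, (t < T)%N -> dens D t Z ->
    (\int[noise D t]_x (Z x)%:E = 1)%E }.

Record standing_assumptions (C : R) : Prop := {
  init_bound : moment_le 2 C (init D) ;
  noise_bound : forall t, (t < T)%N -> moment_le 2 C (noise D t) ;
  dens_bound : forall t Z, (t < T)%N -> dens D t Z ->
    ('N[noise D t]_+oo[EFin \o Z] <= C%:E)%E ;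
  dens_lower : forall t, (t < T)%N -> exists2 Z, dens D t Z &
    {ae noise D t, forall x, C^-1 <= Z x} ;
  cpl_Q2 : forall t b, (t <= T)%N -> B2 b -> convex_growth 2 C (cpl D t ^~ b) ;
  cpl_Lip2 : forall t b c, (t <= T)%N -> B2 b -> B2 c ->
    (growth_norm Num.norm 2 (fun x => cpl D t x b - cpl D t x c)%R
      <= C%:E * d1_flow b c)%E ;
  price_Lip : forall t b c, (t < T)%N -> B2 b -> B2 c ->
    ((enorm (price D t b - price D t c)%R)%:E <= C%:E * d1_flow b c)%E ;
  price_bound : forall t b, (t < T)%N -> B2 b -> enorm (price D t b) <= C ;
  cpl_Q1 : forall t b, (t <= T)%N -> B2 b -> convex_growth 1 C (cpl D t ^~ b) ;
  cpl_Lip1 : forall t b c, (t <= T)%N -> B2 b -> B2 c ->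
    (growth_norm Num.norm 1 (fun x => cpl D t x b - cpl D t x c)%R
      <= C%:E * d1_flow b c)%E }.

(* The expression minimised over [a] in the dynamic programming equation;
   [v] stands for u(t+1,.). *)
Definition bellman (t : nat) (v : V -> R) (b : flow R d T) (x a : V) : \bar R :=
  ((ell t x a b)%:E +
   ereal_sup [set \int[q]_y (v (x + a + y)%R)%:E | q in ambiguity t])%E.

Record mfg_solution (u : nat -> V -> R) (alpha : nat -> V -> V)
    (m : nat -> probability V R) (mu : nat -> probability 'rV[R]_(d + d) R)
    (b : flow R d T) : Prop := {
  sol_u_growth : forall t, (t <= T)%N -> growth Num.norm 2 (u t) ;
  sol_alpha_growth : forall t, (t < T)%N -> growth enorm 1 (alpha t) ;
  sol_alpha_lip : forall t, (t < T)%N -> lip1 enorm (alpha t) ;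
  sol_m_moment : forall t, (t <= T)%N -> finite_moment 2 (m t) ;
  sol_mu_moment : forall t, (t < T)%N -> finite_moment 2 (mu t) ;
  sol_b_B2 : B2 b ;
  sol_u : forall t x, (t < T)%N ->
    (u t x)%:E = ereal_inf [set bellman t (u t.+1) b x a | a in [set: V]] ;
  sol_u_final : forall x, u T x = cpl D T x b ;
  sol_alpha_min : forall t x a, (t < T)%N ->
    (bellman t (u t.+1) b x (alpha t x) <= bellman t (u t.+1) b x a)%E ;
  sol_alpha_unique : forall t x a, (t < T)%N ->
    (forall a', (bellman t (u t.+1) b x a <= bellman t (u t.+1) b x a')%E) ->
    a = alpha t x ;
  sol_m_init : eq_law (m 0%N) (init D) ;
  sol_m_step : forall t, (t < T)%N ->
    eq_law (m t.+1)
      (convolution (noise D t) (pushforward (m t) (fun x : V => x + alpha t x))) ;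
  sol_mu : forall t, (t < T)%N ->
    eq_law (mu t) (pushforward (m t) (fun x : V => row_mx x (alpha t x))) ;
  sol_b_joint : forall t : 'I_T, eq_law (b.1 t) (mu t) ;
  sol_b_final : eq_law b.2 (m T) }.

End mean_field_game.

Section probability_notions.
Context {R : realType} {dO : measure_display} {Omega : measurableType dO}.
Variable Pr : probability Omega R.

Definition mutually_independent (I : finType) dE (E : measurableType dE)
    (X : I -> Omega -> E) : Prop :=
  forall (J : {set I}) (A : I -> set E), (forall i, measurable (A i)) ->
    Pr (\bigcap_(i in [set` J]) (X i @^-1` A i)) =
    (\prod_(i in J) Pr (X i @^-1` A i))%E.

Definition sigma_family (I : Type) dE (E : measurableType dE)
    (X : I -> Omega -> E) : set (set Omega) :=
  <<s [set B | exists i, exists2 A, measurable A & B = X i @^-1` A] >>.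

Definition independent_sigma (G H : set (set Omega)) : Prop :=
  forall A B, G A -> H B -> Pr (A `&` B) = (Pr A * Pr B)%E.

(* Here and below sub-sigma-algebras of Omega are given by a family [G] of generators. *)
Definition sub_measurable (G : set (set Omega)) dE (E : measurableType dE)
    (f : Omega -> E) : Prop :=
  measurable_fun [set: g_sigma_algebraType G] (f : g_sigma_algebraType G -> E).

(* [W] is a version of E[U | sigma(G)]. *)
Definition is_cond_exp (G : set (set Omega)) (U W : Omega -> R) : Prop :=
  [/\ sub_measurable G W, Pr.-integrable setT (EFin \o W) &
      forall B, <<s G >> B ->
        (\int[Pr]_(w in B) (W w)%:E = \int[Pr]_(w in B) (U w)%:E)%E].

(* [W] is a version of the essential supremum of [Phi], among
   sigma(G)-measurable functions. *)
Definition is_ess_supremum (G : set (set Omega)) (Phi : set (Omega -> R))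
    (W : Omega -> R) : Prop :=
  [/\ sub_measurable G W,
      forall f, Phi f -> {ae Pr, forall w, f w <= W w} &
      forall W', sub_measurable G W' ->
        (forall f, Phi f -> {ae Pr, forall w, f w <= W' w}) ->
        {ae Pr, forall w, W w <= W' w}].

End probability_notions.

(* The game has N = n.+1 players; a profile is a map ['I_n.+1 -> control]. *)
Section game.
Context {R : realType} {d T : nat} (D : mfg_data R d T).
Local Notation V := 'rV[R]_d.
Context {n : nat} {dO : measure_display} {Omega : measurableType dO}.
Variable Pr : probability Omega R.
Variables (X0 : 'I_n.+1 -> {RV Pr >-> V}) (Y : 'I_n.+1 -> nat -> {RV Pr >-> V}).

(* The variables [Y i t] with [T <= t] play no role. *)
Definition noise_family (k : 'I_n.+1 * 'I_T) : Omega -> V := Y k.1 k.2.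

Record game_noise : Prop := {
  X0_law : forall i, eq_law (distribution Pr (X0 i)) (init D) ;
  X0_indep : mutually_independent Pr (fun i => X0 i : Omega -> V) ;
  Y_law : forall i t, (t < T)%N -> eq_law (distribution Pr (Y i t)) (noise D t) ;
  Y_indep : mutually_independent Pr noise_family ;
  X0_Y_indep : independent_sigma Pr
    (sigma_family (fun i => X0 i : Omega -> V)) (sigma_family noise_family) }.

(* Generators of F_t. *)
Definition filt (t : nat) : set (set Omega) :=
  [set B | (exists i, exists2 A, measurable A & B = X0 i @^-1` A) \/
           (exists i s, exists2 A, (s < t)%N /\ measurable A & B = Y i s @^-1` A)].

Definition control : Type := nat -> Omega -> V.

Definition admissible : set control :=
  [set A | forall t, (t < T)%N -> sub_measurable (filt t) (A t) /\
           (\int[Pr]_w (enorm (A t w) ^+ 2)%:E < +oo)%E].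

Fixpoint state (i : 'I_n.+1) (A : control) (t : nat) (w : Omega) : V :=
  if t is s.+1 then state i A s w + A s w + Y i s w else X0 i w.

Definition empirical_flow (A : 'I_n.+1 -> control) (w : Omega) : flow R d T :=
  (fun t : 'I_T => empirical (fun j => row_mx (state j (A j) t w) (A j t w))
     : probability 'rV[R]_(d + d) R,
   empirical (fun j => state j (A j) T w) : probability V R).

(* [rho] and [rho_comp] are defined up to almost sure equality: [xget] picks
   one version of the essential supremum. *)
Definition rho (i : 'I_n.+1) (t : nat) (U : Omega -> R) : Omega -> R :=
  xget (cst 0 : Omega -> R)
    (is_ess_supremum Pr (filt t)
       [set W | exists2 Z, dens D t Z &
                is_cond_exp Pr (filt t) (fun w => U w * Z (Y i t w)) W]).

(* rho_0 \o ... \o rho_{t-1} *)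
Fixpoint rho_comp (i : 'I_n.+1) (t : nat) (U : Omega -> R) : Omega -> R :=
  if t is s.+1 then rho_comp i s (rho i s U) else U.

Definition risk (i : 'I_n.+1) (U : Omega -> R) : \bar R :=
  ('E_Pr[rho_comp i T U])%E.

Definition total_cost (i : 'I_n.+1) (A : control) (b : Omega -> flow R d T)
    (w : Omega) : R :=
  \sum_(t < T) ell D t (state i A t w) (A t w) (b w)
  + cpl D T (state i A T w) (b w).

(* J^{i,N}(A) *)
Definition J_game (i : 'I_n.+1) (A : 'I_n.+1 -> control) : \bar R :=
  risk i (total_cost i (A i) (empirical_flow A)).

(* J^i(A^i, b) *)
Definition J_mf (i : 'I_n.+1) (A : control) (b : flow R d T) : \bar R :=
  risk i (total_cost i A (fun=> b)).

Definition deviate (i : 'I_n.+1) (A' : control) (A : 'I_n.+1 -> control) :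
    'I_n.+1 -> control :=
  fun j => if j == i then A' else A j.

Definition eps_nash (eps : R) (A : 'I_n.+1 -> control) : Prop :=
  (forall i, admissible (A i)) /\
  forall i, (J_game i A <=
    ereal_inf [set J_game i (deviate i A' A) | A' in admissible] + eps%:E)%E.

Fixpoint feedback_state (alpha : nat -> V -> V) (i : 'I_n.+1) (t : nat)
    (w : Omega) : V :=
  if t is s.+1 then
    let x := feedback_state alpha i s w in x + alpha s x + Y i s w
  else X0 i w.

Definition feedback_control (alpha : nat -> V -> V) (i : 'I_n.+1) : control :=
  fun t w => alpha t (feedback_state alpha i t w).

End game.

Definition tau {R : realType} (d : nat) (xi : R) : R :=
  if (d <= 2)%N then 2^-1 - xi else d%:R^-1.

(* Main.v *)
Require Import Defs.
From HB Require Import structures.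
From mathcomp Require Import all_boot all_order all_algebra.
From mathcomp Require Import all_classical all_reals all_analysis.
From mathcomp Require Import measurable_realfun ess_sup_inf.
From mathcomp Require Import ring lra.

Set Implicit Arguments.
Unset Strict Implicit.
Unset Printing Implicit Defensive.

Import Order.TTheory GRing.Theory Num.Theory.
Import numFieldNormedType.Exports.

Local Open Scope classical_set_scope.
Local Open Scope ring_scope.


(** Why the equilibrium controls form an approximate Nash equilibrium.

    At equilibrium the trajectory of a player depends only on its own initial state and
    noises, so that the states of the N players at a given time are independent with the
    law m(t) of the mean field game ([own_indep], [fb_law]). Their empirical measure is
    therefore close to m(t): for a quantizer with few cells, the Wasserstein distance is at
    most the quantization error plus the weighted sampling error on the masses of the cells
    ([discrepancy_lip]), and independence bounds the second moment of the latter
    ([discrepancy_sqr]). A grid that is geometrically finer near the origin ([quantizer])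
    needs no more than a second moment of m(t). Its mean square error is of order N^(-tau) as
    soon as tau (1 + d/2) < 1 ([empirical_rate]), which holds for tau(d) ([tau_rate]). The
    joint empirical measures of states and actions converge equally fast, because the
    equilibrium action is a Lipschitz function of the state, and one deviating player moves
    the empirical flow by 1/N times the size of its path ([flow_error_bound]).

    Costs are Lipschitz in the flow, with weights that grow linearly in the states and
    actions ([cost_dist]), and the nested risk measure is Lipschitz in L^1 because the
    densities are bounded by C ([risk_dist]). Hence replacing the empirical flow by the mean
    field flow b changes the cost of a player by at most a constant times N^(-tau/2), where
    the constant depends only on a bound for the energy of its control ([cost_error]). For
    the equilibrium control this is the second claim.

    For the first claim, the cost against b is a risk-averse control problem with value u.
    The coupling is Lipschitz in the state since it is convex of linear growth, so that u is
    Lipschitz too ([value_lip]). Along any control, the cost already paid plus u at the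
    current state is a submartingale for the dynamic risk measure, and it is a martingale for
    the equilibrium control ([rho_total_ge], [rho_total_le]); both rest on the computation of
    a conditional expectation by integrating out the next noise with the past frozen
    ([freezing]). So every control costs at least the mean of u(0, .) under the initial law,
    with equality at equilibrium ([mf_cost_ge], [mf_cost_le]), and a deviation of bounded
    energy gains at most the sum of its error and of that of the equilibrium.

    A deviation of large energy is ruled out separately. In every scenario set there is a
    density bounded below by 1/C, so the risk dominates a multiple of the expectation
    ([risk_coercive]), and the cost is at least a quarter of the energy minus a constant
    ([cost_lower]): beyond
    a level that does not depend on N the deviation costs more than the equilibrium
    ([large_deviation_cost]). *)

(** * Euclidean norm and Borel measurability *)

Section euclid.
Context {R : realType}.
Implicit Types k l : nat.

Lemma dotp_ge0 k (x : 'rV[R]_k) : 0 <= dotp x x.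
Proof. by apply: sumr_ge0 => i _; rewrite -expr2 sqr_ge0. Qed.

Lemma enorm_ge0 k (x : 'rV[R]_k) : 0 <= enorm x.
Proof. exact: sqrtr_ge0. Qed.

Lemma enorm_sqr k (x : 'rV[R]_k) : enorm x ^+ 2 = dotp x x.
Proof. by rewrite sqr_sqrtr// dotp_ge0. Qed.

Lemma enorm_sqrE k (x : 'rV[R]_k) : enorm x ^+ 2 = \sum_(i < k) x 0 i ^+ 2.
Proof. by rewrite enorm_sqr; apply: eq_bigr => i _; rewrite expr2. Qed.

Lemma enorm0 k : enorm (0 : 'rV[R]_k) = 0.
Proof.
apply/eqP; rewrite -sqrf_eq0 enorm_sqrE big1// => i _; by rewrite mxE expr0n.
Qed.

Lemma enormN k (x : 'rV[R]_k) : enorm (- x) = enorm x.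
Proof.
by congr (Num.sqrt _); apply: eq_bigr => i _; rewrite !mxE mulrNN.
Qed.

Lemma enorm_distC k (x y : 'rV[R]_k) : enorm (x - y) = enorm (y - x).
Proof. by rewrite -enormN opprB. Qed.

Lemma coord_le_enorm k (x : 'rV[R]_k) i : `|x 0 i| <= enorm x.
Proof.
rewrite -ler_sqr ?nnegrE ?enorm_ge0// enorm_sqrE real_normK ?num_real//.
by rewrite (bigD1 i)//= lerDl sumr_ge0// => j _; rewrite sqr_ge0.
Qed.

Lemma dotp_le k (x y : 'rV[R]_k) : `|dotp x y| <= enorm x * enorm y.
Proof.
suff H (u v : 'rV[R]_k) : dotp u v <= enorm u * enorm v.
  rewrite ler_norml H andbT lerNl -[enorm x]enormN; apply: le_trans (H _ _).
  by rewrite /dotp -sumrN; apply: ler_sum => i _; rewrite !mxE mulNr.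
have [u0|u0] := eqVneq (enorm u) 0.
  rewrite u0 mul0r /dotp big1// => i _; apply/eqP; rewrite mulf_eq0.
  by have := coord_le_enorm u i; rewrite u0 normr_le0 => ->.
have [v0|v0] := eqVneq (enorm v) 0.
  rewrite v0 mulr0 /dotp big1// => i _; apply/eqP; rewrite mulf_eq0.
  by have := coord_le_enorm v i; rewrite v0 normr_le0 => ->; rewrite orbT.
have up : 0 < enorm u by rewrite lt0r u0 enorm_ge0.
have vp : 0 < enorm v by rewrite lt0r v0 enorm_ge0.
(* the squared norm of the difference of the vectors scaled to the same norm is nonnegative *)
have : 0 <= \sum_(i < k) (enorm v * u 0 i - enorm u * v 0 i) ^+ 2.
  by apply: sumr_ge0 => i _; rewrite sqr_ge0.
have -> : \sum_(i < k) (enorm v * u 0 i - enorm u * v 0 i) ^+ 2 =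
   enorm v ^+ 2 * dotp u u + enorm u ^+ 2 * dotp v v
   - (2 * enorm u * enorm v) * dotp u v.
  rewrite /dotp !mulr_sumr -big_split -sumrB /=; apply: eq_bigr => i _; ring.
rewrite -!enorm_sqr.
have uv : 0 < enorm u * enorm v by rewrite mulr_gt0.
by move=> H; rewrite -(ler_pM2l uv); nra.
Qed.

Lemma enormD k (x y : 'rV[R]_k) : enorm (x + y) <= enorm x + enorm y.
Proof.
rewrite -ler_sqr ?nnegrE ?addr_ge0 ?enorm_ge0//.
have -> : enorm (x + y) ^+ 2 = enorm x ^+ 2 + enorm y ^+ 2 + 2 * dotp x y.
  rewrite !enorm_sqrE /dotp mulr_sumr -!big_split/=.
  by apply: eq_bigr => i _; rewrite mxE; ring.
have := dotp_le x y; rewrite ler_norml => /andP[_ h]; lra.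
Qed.

Lemma enorm_dist k (x y : 'rV[R]_k) : `|enorm x - enorm y| <= enorm (x - y).
Proof.
rewrite ler_norml; apply/andP; split.
  have := enormD (y - x) x; rewrite subrK enorm_distC; lra.
by have := enormD (x - y) y; rewrite subrK; lra.
Qed.

Lemma enorm_le_sum k (x : 'rV[R]_k) : enorm x <= \sum_(i < k) `|x 0 i|.
Proof.
rewrite -ler_sqr ?nnegrE ?enorm_ge0// ?sumr_ge0//.
rewrite enorm_sqrE expr2 mulr_suml; apply: ler_sum => i _.
rewrite -real_normK ?num_real// expr2 ler_wpM2l// (bigD1 i)//=.
by rewrite lerDl sumr_ge0.
Qed.

Lemma enorm_row_mx k l (x : 'rV[R]_k) (y : 'rV[R]_l) :
  enorm (row_mx x y) <= enorm x + enorm y.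
Proof.
rewrite -ler_sqr ?nnegrE ?addr_ge0 ?enorm_ge0//.
rewrite sqrrD !enorm_sqrE big_split_ord/=.
under eq_bigr do rewrite row_mxEl.
under [X in _ + X <= _]eq_bigr do rewrite row_mxEr.
by rewrite addrAC lerDl mulrn_wge0// mulr_ge0// enorm_ge0.
Qed.

Lemma enormZ k a (x : 'rV[R]_k) : enorm (a *: x) = `|a| * enorm x.
Proof.
apply/eqP; rewrite -(@eqrXn2 _ 2)// ?mulr_ge0 ?enorm_ge0//.
rewrite exprMn real_normK ?num_real// !enorm_sqrE mulr_sumr; apply/eqP.
by apply: eq_bigr => i _; rewrite mxE exprMn.
Qed.

End euclid.

Section borel.
Context {R : realType}.

(** Countably many rational boxes generate the open sets of a finite power of R,
    so that openness in finitely many real coordinates gives measurability. *)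
Lemma measurable_open_coords (I : finType) d (T : measurableType d)
    (f : I -> T -> R) (U : set (I -> R)) :
  (forall i, measurable_fun setT (f i)) ->
  (forall x, U x -> exists2 e : R, 0 < e & forall y, (forall i, `|y i - x i| < e) -> U y) ->
  measurable [set w | U (f ^~ w)].
Proof.
move=> mf oU.
pose box (p : {ffun I -> rat} * nat) : set (I -> R) :=
  [set y | forall i, `|y i - ratr (p.1 i)| < p.2.+1%:R^-1].
have mbox p : measurable [set w | box p (f ^~ w)].
  rewrite (_ : [set _ | _] = \bigcap_(i in [set: I])
      [set w | `|f i w - ratr (p.1 i)| < p.2.+1%:R^-1]); last first.
    by apply/seteqP; split=> w /= h i; [move=> _; exact: h|exact: h].
  apply: fin_bigcap_measurable => // i _.
  have mg : measurable_fun setT (fun w => `|f i w - ratr (p.1 i)|).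
    by apply: measurableT_comp => //; apply: measurable_funB.
  rewrite (_ : [set _ | _] =
      setT `&` (fun w => `|f i w - ratr (p.1 i)|) @^-1` `]-oo, p.2.+1%:R^-1[).
    by apply: mg => //; exact: measurable_itv.
  by rewrite setTI; apply/seteqP; split=> w /=; rewrite in_itv.
rewrite (_ : [set _ | _] = \bigcup_(p in [set p | box p `<=` U]) [set w | box p (f ^~ w)]).
  rewrite bigcup_mkcond; apply: countable_bigcupT_measurable; first exact: countableP.
  by move=> p; case: ifP => // _; exact: measurable0.
apply/seteqP; split=> w /=; last by case=> p pU /pU.
move=> /[dup] Uw /oU[e e0 He].
have [n ne] : exists n : nat, n.+1%:R^-1 < e / 2.
  have [n] := @ltr_add_invr R 0 (e / 2) ltac:(lra).
  by rewrite add0r => h; exists n.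
have n0 : (0 : R) < n.+1%:R^-1 by rewrite invr_gt0.
set r : R := n.+1%:R^-1 in ne n0 *.
have Hq i : exists q : rat, `|f i w - ratr q| < r.
  have lt2 : f i w - r < f i w + r by lra.
  have [q] := rat_in_itvoo lt2.
  by rewrite in_itv/= => /andP[h1 h2]; exists q; rewrite ltr_norml; lra.
have [q Hq'] := choice Hq.
exists ([ffun i => q i], n) => /=; last by move=> i; rewrite ffunE.
move=> y Hy; apply: He => i; have := Hy i; have := Hq' i; rewrite /= ffunE.
rewrite -/r !ltr_norml; lra.
Qed.

Lemma measurable_fun_coords (I : finType) d (T : measurableType d)
    (f : I -> T -> R) (g : (I -> R) -> R) :
  (forall i, measurable_fun setT (f i)) ->
  (forall x e, 0 < e -> exists2 r : R, 0 < r &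
     forall y, (forall i, `|y i - x i| < r) -> `|g y - g x| < e) ->
  measurable_fun setT (fun w => g (f ^~ w)).
Proof.
move=> mf cg; apply: (measurability _ (RGenOInfty.measurableE R)) => //.
move=> _ [_ [a ->] <-]; rewrite setTI preimage_itvoy.
apply: (@measurable_open_coords I _ _ f [set x | a < g x]) => // x /= gx.
have [r r0 Hr] := cg x (g x - a) ltac:(lra).
by exists r => // y /Hr; rewrite /= ltr_norml; lra.
Qed.

(** A box around a point on which U holds is a neighbourhood of radius the least of the
    radii of its finitely many sides. *)
Lemma measurable_fun_mx d (T : measurableType d) p q (f : T -> 'M[R]_(p, q)) :
  (forall i j, measurable_fun setT (fun w => f w i j)) -> measurable_fun setT f.
Proof.
move=> mf; apply: (@measurability _ _ _ _ setT _ (@open 'M[R]_(p, q))) => //.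
move=> _ [U oU <-]; rewrite setTI.
pose U' : set ('I_p * 'I_q -> R) := [set x | U (\matrix_(i, j) x (i, j))].
rewrite (_ : f @^-1` U = [set w | U' ((fun (ij : 'I_p * 'I_q) w => f w ij.1 ij.2) ^~ w)]).
  apply: measurable_open_coords => //= x.
  rewrite /U'/= => Ux; move: oU; rewrite openE => /(_ _ Ux)[P nP sP].
  have HP (ij : 'I_p * 'I_q) : exists e : R, 0 < e /\ forall y, `|y - x ij| < e -> P ij.1 ij.2 y.
    have /nbhs_ballP[e /= e0 He] := nP ij.1 ij.2.
    exists e; split=> // y yx; apply: He; rewrite /ball/= mxE -surjective_pairing distrC.
    exact: yx.
  have [e He] := choice HP.
  exists (\big[Num.min/1]_ij e ij).
    by elim/big_rec: _ => // ij z _ z0; rewrite lt_min z0 andbT; case: (He ij).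
  move=> y Hy; apply: sP => i j; rewrite mxE.
  have [_ /(_ (y (i, j)))] := He (i, j); apply; apply: (lt_le_trans (Hy _)).
  exact: bigmin_le_cond.
apply/seteqP; split=> w; rewrite /U'/=; congr U; apply/matrixP => i j; by rewrite mxE.
Qed.

Lemma measurable_mx_coord p q (i : 'I_p) (j : 'I_q) :
  measurable_fun setT (fun x : 'M[R]_(p, q) => x i j).
Proof.
apply: (measurability _ (RGenOInfty.measurableE R)) => //.
move=> _ [_ [a ->] <-]; rewrite setTI preimage_itvoy.
apply: sub_sigma_algebra; rewrite openE => x /= ax.
exists (fun i' j' => if (i' == i) && (j' == j) then [set y | a < y] else setT).
  move=> i' j'; case: ifP => [/andP[/eqP-> /eqP->]|_]; last exact: filterT.
  apply/nbhs_ballP; exists (x i j - a) => /=; first by rewrite subr_gt0.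
  by move=> y; rewrite /ball/= ltr_norml => /andP[]; lra.
by move=> y /= /(_ i j); rewrite !eqxx.
Qed.

Lemma measurable_fun_mxP d (T : measurableType d) p q (f : T -> 'M[R]_(p, q)) :
  measurable_fun setT f <-> forall i j, measurable_fun setT (fun w => f w i j).
Proof.
split=> [mf i j|]; last exact: measurable_fun_mx.
exact: (measurableT_comp (@measurable_mx_coord p q i j) mf).
Qed.

Lemma measurable_rVD d (T : measurableType d) k (f g : T -> 'rV[R]_k) :
  measurable_fun setT f -> measurable_fun setT g ->
  measurable_fun setT (fun w => f w + g w).
Proof.
move=> /measurable_fun_mxP mf /measurable_fun_mxP mg.
apply/measurable_fun_mxP => i j; under eq_fun do rewrite mxE.
exact: measurable_funD.
Qed.

Lemma measurable_rVB d (T : measurableType d) k (f g : T -> 'rV[R]_k) :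
  measurable_fun setT f -> measurable_fun setT g ->
  measurable_fun setT (fun w => f w - g w).
Proof.
move=> /measurable_fun_mxP mf /measurable_fun_mxP mg.
apply/measurable_fun_mxP => i j; under eq_fun do rewrite !mxE.
exact: measurable_funB.
Qed.

Lemma measurable_row_mx d (T : measurableType d) k l
    (f : T -> 'rV[R]_k) (g : T -> 'rV[R]_l) :
  measurable_fun setT f -> measurable_fun setT g ->
  measurable_fun setT (fun w => row_mx (f w) (g w)).
Proof.
move=> /measurable_fun_mxP mf /measurable_fun_mxP mg.
apply/measurable_fun_mxP => i j; rewrite /row_mx.
under eq_fun do rewrite mxE; case: (fintype.split j) => j'; [exact: mf|exact: mg].
Qed.

Lemma measurable_dotp d (T : measurableType d) k (f g : T -> 'rV[R]_k) :
  measurable_fun setT f -> measurable_fun setT g ->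
  measurable_fun setT (fun w => dotp (f w) (g w)).
Proof.
move=> /measurable_fun_mxP mf /measurable_fun_mxP mg.
by apply: measurable_sum => i; apply: measurable_funM.
Qed.

(** Coordinatewise closeness controls the Euclidean distance, so maps that are
    continuous for the latter are Borel. *)
Lemma measurable_fun_econt d (T : measurableType d) k (f : T -> 'rV[R]_k)
    (g : 'rV[R]_k -> R) :
  measurable_fun setT f ->
  (forall x e, 0 < e -> exists2 r : R, 0 < r &
     forall y, enorm (y - x) < r -> `|g y - g x| < e) ->
  measurable_fun setT (fun w => g (f w)).
Proof.
move=> /measurable_fun_mxP mf cg.
rewrite (_ : (fun w => g (f w)) =
  (fun w => (fun x : 'I_k -> R => g (\row_i x i)) ((fun i w => f w 0 i) ^~ w))).
  apply: (@measurable_fun_coords _ _ _ (fun i w => f w 0 i)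
    (fun x => g (\row_i x i))) => [i|x e e0]; first exact: mf.
  have [r r0 Hr] := cg (\row_i x i) e e0.
  exists (r / k.+1%:R) => [|y Hy]; first by rewrite divr_gt0.
  apply: Hr; apply: (le_lt_trans (enorm_le_sum _)).
  apply: (@le_lt_trans _ _ (\sum_(i < k) r / k.+1%:R)).
    by apply: ler_sum => i _; rewrite !mxE ltW.
  rewrite sumr_const card_ord -[ltLHS]mulr_natr mulrAC ltr_pdivrMr// ltr_pM2l//.
  by rewrite ltr_nat.
apply/funext => w; congr g; apply/rowP => i; by rewrite mxE.
Qed.

Lemma measurable_fun_elip d (T : measurableType d) k (f : T -> 'rV[R]_k)
    (g : 'rV[R]_k -> R) (L : R) :
  measurable_fun setT f ->
  (forall x y, `|g x - g y| <= L * enorm (x - y)) ->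
  measurable_fun setT (fun w => g (f w)).
Proof.
move=> mf Lg; apply: measurable_fun_econt => // x e e0.
have L1 : 0 < `|L| + 1 by rewrite ltr_wpDl.
exists (e / (`|L| + 1)) => [|y]; first by rewrite divr_gt0.
rewrite ltr_pdivlMr// => Hy; apply: le_lt_trans (Lg _ _) _; apply: le_lt_trans Hy.
rewrite mulrC ler_wpM2l ?enorm_ge0//; have := ler_norm L; lra.
Qed.

Lemma measurable_enorm d (T : measurableType d) k (f : T -> 'rV[R]_k) :
  measurable_fun setT f -> measurable_fun setT (fun w => enorm (f w)).
Proof.
move=> mf; apply: (@measurable_fun_elip _ _ _ f _ 1) => // x y.
by rewrite mul1r enorm_dist.
Qed.

Lemma measurable_elip_map d (T : measurableType d) k l (f : T -> 'rV[R]_k)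
    (g : 'rV[R]_k -> 'rV[R]_l) (L : R) :
  measurable_fun setT f ->
  (forall x y, enorm (g x - g y) <= L * enorm (x - y)) ->
  measurable_fun setT (fun w => g (f w)).
Proof.
move=> mf Lg; apply/measurable_fun_mxP => i j; rewrite ord1.
apply: (@measurable_fun_elip _ _ _ f (fun x => g x 0 j) L) => // x y.
by apply: le_trans (Lg x y); have := coord_le_enorm (g x - g y) j; rewrite !mxE.
Qed.

End borel.

(** * Expectation of real random variables *)

Section expectation.
Context {d : measure_display} {T : measurableType d} {R : realType}.
Variable P : probability T R.
Implicit Types f g h : T -> R.

Definition L1 f : Prop := P.-integrable setT (EFin \o f).

Definition Ex f : R := fine (\int[P]_x (f x)%:E).

Lemma L1_meas f : L1 f -> measurable_fun setT f.
Proof. by move=> /integrableP[/measurable_EFinP]. Qed.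

Lemma L1_finite f : measurable_fun setT f -> (\int[P]_x `|(f x)%:E| < +oo)%E -> L1 f.
Proof. by move=> mf h; apply/integrableP; split => //; apply/measurable_EFinP. Qed.

Lemma ExE f : L1 f -> (\int[P]_x (f x)%:E)%E = (Ex f)%:E.
Proof. by move=> h; rewrite /Ex fineK//; exact: integrable_fin_num. Qed.

Lemma L1_le f g : measurable_fun setT f -> (forall x, `|f x| <= g x) -> L1 g -> L1 f.
Proof.
move=> mf fg; apply: le_integrable => //; first exact/measurable_EFinP.
by move=> x _ /=; rewrite lee_fin (le_trans (fg x))// ler_norm.
Qed.

Lemma L1_le_ae f g : measurable_fun setT f -> {ae P, forall x, `|f x| <= g x} ->
  L1 g -> L1 f.
Proof.
move=> mf fg Lg; apply: L1_finite => //.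
have /integrableP[mg goo] := Lg.
apply: le_lt_trans goo; apply: ae_ge0_le_integral => //.
- by apply: measurableT_comp => //; exact/measurable_EFinP.
- exact: measurableT_comp.
- apply: filterS fg => x fg _ /=.
  by rewrite lee_fin (le_trans fg)// ler_norm.
Qed.

Lemma L1_cst c : L1 (fun=> c).
Proof. exact: finite_measure_integrable_cst. Qed.

Lemma L1D f g : L1 f -> L1 g -> L1 (fun x => f x + g x).
Proof. by move=> hf hg; exact: (integrableD measurableT hf hg). Qed.

Lemma L1N f : L1 f -> L1 (fun x => - f x).
Proof. by move=> hf; exact: (integrableN hf). Qed.

Lemma L1B f g : L1 f -> L1 g -> L1 (fun x => f x - g x).
Proof. by move=> hf hg; apply: L1D => //; exact: L1N. Qed.

Lemma L1Z c f : L1 f -> L1 (fun x => c * f x).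
Proof. by move=> hf; exact: (integrableZl measurableT c hf). Qed.

Lemma L1_norm f : L1 f -> L1 (fun x => `|f x|).
Proof. exact: integrable_norm. Qed.

Lemma L1_sum (I : Type) (s : seq I) (F : I -> T -> R) :
  (forall i, L1 (F i)) -> L1 (fun x => \sum_(i <- s) F i x).
Proof.
move=> hF; elim: s => [|i s IH].
  by under eq_fun do rewrite big_nil; exact: L1_cst.
by under eq_fun do rewrite big_cons; exact: L1D.
Qed.

Lemma L1_max f g : L1 f -> L1 g -> L1 (fun x => Num.max (f x) (g x)).
Proof.
move=> hf hg; apply: (@L1_le _ (fun x => `|f x| + `|g x|)).
- by apply: measurable_maxr; exact: L1_meas.
- by move=> x; rewrite /Num.max; case: ifP => _; rewrite ?lerDl ?lerDr.
- by apply: L1D; exact: L1_norm.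
Qed.

Lemma L1_min f g : L1 f -> L1 g -> L1 (fun x => Num.min (f x) (g x)).
Proof.
move=> hf hg; apply: (@L1_le _ (fun x => `|f x| + `|g x|)).
- by apply: measurable_minr; exact: L1_meas.
- by move=> x; rewrite /Num.min; case: ifP => _; rewrite ?lerDl ?lerDr.
- by apply: L1D; exact: L1_norm.
Qed.

Lemma indic01 (B : set T) x : 0 <= (\1_B x : R) <= 1.
Proof. by rewrite indicE; case: (_ \in _) => /=; rewrite ?lexx ler01. Qed.

Lemma L1_indic f (B : set T) : measurable B -> L1 f -> L1 (fun x => f x * \1_B x).
Proof.
move=> mB hf; apply: (@L1_le _ (fun x => `|f x|)); last exact: L1_norm.
  by apply: measurable_funM; [exact: L1_meas|exact: measurable_indic].
move=> x; rewrite normrM ler_piMr//; have /andP[h0 h1] := indic01 B x.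
by rewrite ger0_norm.
Qed.

Lemma ExD f g : L1 f -> L1 g -> Ex (fun x => f x + g x) = Ex f + Ex g.
Proof. by move=> hf hg; apply: RintegralD. Qed.

Lemma ExB f g : L1 f -> L1 g -> Ex (fun x => f x - g x) = Ex f - Ex g.
Proof. by move=> hf hg; apply: RintegralB. Qed.

Lemma ExZ c f : L1 f -> Ex (fun x => c * f x) = c * Ex f.
Proof. by move=> hf; apply: RintegralZl. Qed.

Lemma Ex_cst c : Ex (fun=> c) = c.
Proof.
by rewrite /Ex (integral_cst P measurableT c%:E) [X in (_ * X)%E](probability_setT P) mule1.
Qed.

Lemma Ex_le f g : L1 f -> L1 g -> (forall x, f x <= g x) -> Ex f <= Ex g.
Proof. by move=> hf hg fg; apply: le_Rintegral. Qed.

Lemma Ex_ext f g : f =1 g -> Ex f = Ex g.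
Proof. by move=> /funext->. Qed.

Lemma L1_ext f g : f =1 g -> L1 f -> L1 g.
Proof. by move=> /funext->. Qed.

Lemma Ex_ge0 f : (forall x, 0 <= f x) -> 0 <= Ex f.
Proof. by move=> f0; apply: fine_ge0; apply: integral_ge0 => x _; rewrite lee_fin. Qed.

Lemma Ex_eq_ae f g : measurable_fun setT f -> measurable_fun setT g ->
  {ae P, forall x, f x = g x} -> Ex f = Ex g.
Proof.
move=> mf mg fg; congr fine; apply: ae_eq_integral => //; try exact/measurable_EFinP.
by apply: filterS fg => x -> _.
Qed.

Lemma L1_eq_ae f g : measurable_fun setT g -> {ae P, forall x, f x = g x} -> L1 f -> L1 g.
Proof.
move=> mg fg hf; apply: (@L1_le_ae _ (fun x => `|f x|)) => //; last exact: L1_norm.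
by apply: filterS fg => x ->.
Qed.

(** Replacing f by its minimum with g, which has the same integral, makes the inequality
    hold everywhere. *)
Lemma Ex_le_ae f g : L1 f -> L1 g -> {ae P, forall x, f x <= g x} -> Ex f <= Ex g.
Proof.
move=> hf hg fg.
rewrite (@Ex_eq_ae f (fun x => Num.min (f x) (g x))); first last.
- by apply: filterS fg => x ?; rewrite min_l.
- by apply: measurable_minr; exact: L1_meas.
- exact: L1_meas.
by apply: Ex_le => //; [exact: L1_min|move=> x; rewrite ge_min lexx orbT].
Qed.

Lemma Ex_sum (I : Type) (s : seq I) (F : I -> T -> R) : (forall i, L1 (F i)) ->
  Ex (fun x => \sum_(i <- s) F i x) = \sum_(i <- s) Ex (F i).
Proof.
move=> hF; elim: s => [|i s IH].
  by under Ex_ext do rewrite big_nil; rewrite Ex_cst big_nil.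
under Ex_ext do rewrite big_cons.
by rewrite ExD ?IH ?big_cons//; exact: L1_sum.
Qed.

Lemma Ex_norm f : L1 f -> `|Ex f| <= Ex (fun x => `|f x|).
Proof.
move=> hf; rewrite ler_norml -[- Ex _]mulN1r -ExZ; last exact: L1_norm.
apply/andP; split; apply: Ex_le => //.
- by apply: L1Z; exact: L1_norm.
- by move=> x; rewrite mulN1r; have := ler_norm (- f x); rewrite normrN lerNl.
- exact: L1_norm.
- by move=> x; exact: ler_norm.
Qed.

Lemma Ex_eq0 f : L1 f -> (forall x, 0 <= f x) -> Ex f <= 0 -> {ae P, forall x, f x = 0}.
Proof.
move=> hf f0 E0.
have /ae_eq_integral_abs : (\int[P]_x `|(EFin \o f) x| = 0)%E.
  under eq_integral do rewrite /= ger0_norm//.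
  by rewrite ExE//; congr EFin; apply/eqP; rewrite eq_le E0 Ex_ge0.
move=> /(_ measurableT (measurable_int _ hf)).
by apply: filterS => x /(_ I) /= [].
Qed.

Lemma Ex_indic_integral f (B : set T) : measurable B -> L1 f ->
  (\int[P]_(x in B) (f x)%:E)%E = (Ex (fun x => f x * \1_B x))%:E.
Proof.
move=> mB hf; rewrite -ExE; last exact: L1_indic.
rewrite integral_mkcond; apply: eq_integral => x _ /=.
by rewrite patchE indicE; case: (x \in B); rewrite ?mulr1 ?mulr0.
Qed.

End expectation.

Section change_of_variables.
Context {d d' : measure_display} {T : measurableType d} {E : measurableType d'} {R : realType}.
Variables (P : probability T R) (m : probability E R) (X : T -> E).
Hypothesis mX : measurable_fun setT X.
Hypothesis lawX : eq_law (pushforward P X) m.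

Lemma law_integral (f : E -> \bar R) : measurable_fun setT f -> (forall x, 0 <= f x)%E ->
  (\int[m]_x f x = \int[P]_w f (X w))%E.
Proof.
move=> mf f0; rewrite -(@eq_measure_integral _ _ _ _ _ (pushforward P X)).
  by rewrite ge0_integral_pushforward.
by move=> A mA _; exact: lawX.
Qed.

Lemma L1_law (f : E -> R) : measurable_fun setT f ->
  L1 m f <-> L1 P (fun w => f (X w)).
Proof.
move=> mf.
have H : (\int[m]_x `|(f x)%:E| = \int[P]_w `|(f (X w))%:E|)%E.
  by rewrite law_integral//; apply/measurable_EFinP; exact: measurableT_comp.
split=> /integrableP[_ h]; (apply: L1_finite; first by [|exact: measurableT_comp]).
- by rewrite -H.
- by rewrite H.
Qed.

Lemma Ex_law (f : E -> R) : L1 m f -> Ex m f = Ex P (fun w => f (X w)).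
Proof.
move=> hf; congr fine.
rewrite -(@eq_measure_integral _ _ _ _ _ (pushforward P X)); last first.
  by move=> A mA _; exact: lawX.
rewrite integral_pushforward//.
- exact: measurable_int hf.
- by rewrite preimage_setT; apply/(L1_law (L1_meas hf)).
Qed.

End change_of_variables.

(** * Conditional expectation and essential supremum *)

Section push_law.
Context {d d' : measure_display} {T : measurableType d} {E : measurableType d'} {R : realType}.
Variable P : probability T R.

(** The image law as a probability for a map that need not be a bundled random variable. *)
Definition push_law (X : T -> E) (mX : measurable_fun setT X) : probability E R :=
  distribution P (HB.pack X (isMeasurableFun.Build _ _ _ _ X mX) : {mfun T >-> E}).

Lemma push_lawE (X : T -> E) (mX : measurable_fun setT X) :
  eq_law (pushforward P X) (push_law mX).
Proof. by []. Qed.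

End push_law.

Section conditional_expectation.
Context {dO : measure_display} {Omega : measurableType dO} {R : realType}.
Variables (Pr : probability Omega R) (G : set (set Omega)).
Hypothesis hG : G `<=` measurable.
Local Notation OG := (g_sigma_algebraType G).

Lemma sigma_sub_measurable B : <<s G >> B -> measurable B.
Proof. by apply: smallest_sub => //; exact: sigma_algebra_measurable. Qed.

Lemma measurable_idG : measurable_fun setT (id : Omega -> OG).
Proof. by move=> _ B mB; rewrite setTI; exact: sigma_sub_measurable. Qed.

Lemma sub_measurableW d (E : measurableType d) (f : Omega -> E) :
  sub_measurable G f -> measurable_fun setT f.
Proof. by move=> mf; exact: (measurableT_comp mf measurable_idG). Qed.

Lemma sub_measurable_lt (f g : Omega -> R) : sub_measurable G f -> sub_measurable G g ->
  <<s G >> [set w | f w < g w].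
Proof.
move=> mf mg; have : @measurable _ OG (setT `&` (fun x : OG => f x < g x) @^-1` [set true]).
  by apply: (measurable_fun_ltr mf mg).
rewrite setTI => H; rewrite (_ : [set w | _] = (fun x : OG => f x < g x) @^-1` [set true])//.
Qed.

(** Conditional expectations tested with real expectations instead of extended integrals. *)
Lemma is_cond_expE (U W : Omega -> R) : L1 Pr U ->
  is_cond_exp Pr G U W <->
  [/\ sub_measurable G W, L1 Pr W &
   forall B, <<s G >> B -> Ex Pr (fun w => W w * \1_B w) = Ex Pr (fun w => U w * \1_B w)].
Proof.
move=> hU; split=> -[mW iW HW]; split=> // B GB; have := HW B GB;
  rewrite !Ex_indic_integral//; try exact: sigma_sub_measurable.
- by case.
- by move=> ->.
Qed.

(** Order between functions measurable for a sub-sigma-algebra can be tested on the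
    integrals over its sets: the set where the inequality fails is one of them. *)
Lemma sub_measurable_le_ae (f g : Omega -> R) :
  sub_measurable G f -> sub_measurable G g -> L1 Pr f -> L1 Pr g ->
  (forall B, <<s G >> B ->
     Ex Pr (fun w => f w * \1_B w) <= Ex Pr (fun w => g w * \1_B w)) ->
  {ae Pr, forall w, f w <= g w}.
Proof.
move=> mf mg hf hg H; set B := [set w | g w < f w].
have GB : <<s G >> B by exact: sub_measurable_lt.
have mB := sigma_sub_measurable GB.
have h0 w : 0 <= (f w - g w) * \1_B w.
  rewrite indicE; case: (boolP (w \in B)) => [|_]; last by rewrite mulr0.
  by rewrite inE /B/= => ?; rewrite mulr1 subr_ge0 ltW.
have hfg : L1 Pr (fun w => (f w - g w) * \1_B w) by apply: L1_indic => //; exact: L1B.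
have : {ae Pr, forall w, (f w - g w) * \1_B w = 0}.
  apply: Ex_eq0 => //; under Ex_ext do rewrite mulrBl.
  by rewrite ExB ?subr_le0 ?H//; exact: L1_indic.
apply: filterS => w; apply: contra_eqT; rewrite -ltNge => gf.
by rewrite indicE mem_set// mulr1 subr_eq0 gt_eqF.
Qed.

(** Radon-Nikodym derivative, on the sub-sigma-algebra, of the charge of density [U] with
    respect to the restriction of the probability, which is the law of the identity seen
    as a map to the coarser measurable space. *)
Lemma cond_exp_exists (U : Omega -> R) : L1 Pr U -> exists W, is_cond_exp Pr G U W.
Proof.
move=> hU.
pose nu : {charge set OG -> \bar R} :=
  charge.measure_function_pushforward__canonical__charge_Charge (induced_charge hU) measurable_idG.
pose mu := push_law Pr measurable_idG.
have dom : nu `<< mu.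
  apply/null_content_dominatesP => A mA muA.
  rewrite /nu/= /pushforward/= /induced_charge.
  apply: null_set_integral => //; first exact: sigma_sub_measurable.
  by apply: measurable_funTS; apply/measurable_EFinP; exact: L1_meas hU.
have fin w := Radon_Nikodym_fin_num w dom.
have int := Radon_Nikodym_integrable dom.
pose W (w : Omega) : R := fine (Radon_Nikodym nu mu w).
have WE w : (W w)%:E = Radon_Nikodym nu mu w by rewrite /W fineK.
have L1W : L1 mu (W : OG -> R).
  by apply: (eq_integrable _ _ _ _ int) => // w _; rewrite /= WE.
have mW := L1_meas L1W.
have L1W' : L1 Pr W.
  by apply/(L1_law measurable_idG (push_lawE Pr measurable_idG) mW).
exists W; split => // B GB.
transitivity (\int[mu]_(w in B) (W w)%:E)%E.
  rewrite integral_pushforward//.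
  - exact/measurable_EFinP.
  - by apply: integrableS L1W' => //; exact: sigma_sub_measurable.
transitivity (nu B) => //.
rewrite (Radon_Nikodym_integral dom GB); apply: eq_integral => w _.
by rewrite WE.
Qed.

End conditional_expectation.

Section essential_supremum.
Context {dO : measure_display} {Omega : measurableType dO} {R : realType}.
Variables (Pr : probability Omega R) (G : set (set Omega)).
Hypothesis hG : G `<=` measurable.
Variables (Phi : set (Omega -> R)) (H : Omega -> R).
Hypotheses (mH : sub_measurable G H) (L1H : L1 Pr H) (H0 : forall w, 0 <= H w).
Hypothesis Phi_meas : forall f, Phi f -> sub_measurable G f.
Hypothesis Phi_le : forall f, Phi f -> {ae Pr, forall w, `|f w| <= H w}.
Hypothesis Phi0 : Phi !=set0.

(* Members of the family are dominated by H only almost everywhere. *)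
Let clip (f : Omega -> R) w := Num.max (- H w) (Num.min (f w) (H w)).

Let clip_ae f : Phi f -> {ae Pr, forall w, clip f w = f w}.
Proof.
move=> /Phi_le; apply: filterS => w; rewrite ler_norml => /andP[h1 h2].
by rewrite /clip min_l// max_r.
Qed.

(** Starting from - H instead of from a member of the family keeps these maxima integrable
    and does not change the suprema, as H dominates the family. *)
Inductive finite_max : (Omega -> R) -> Prop :=
| finite_max0 : finite_max (fun w => - H w)
| finite_maxS f g : Phi f -> finite_max g -> finite_max (fun w => Num.max (clip f w) (g w)).

Let fm_bound g : finite_max g -> forall w, - H w <= g w <= H w.
Proof.
elim=> [|f {}g _ _ IH] w; have := H0 w; first by lra.
have /andP[h1 h2] := IH w => h0; rewrite le_max h1 orbT/= ge_max h2 andbT.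
by rewrite /clip ge_max ge_min lexx orbT andbT; lra.
Qed.

Let fm_meas g : finite_max g -> sub_measurable G g.
Proof.
elim=> [|f {}g /Phi_meas mf _ IH]; first exact: measurable_funN.
apply: measurable_maxr => //; apply: measurable_maxr; first exact: measurable_funN.
exact: measurable_minr.
Qed.

Let fm_L1 g : finite_max g -> L1 Pr g.
Proof.
move=> fg; apply: (L1_le (sub_measurableW hG (fm_meas fg)) _ L1H).
by move=> w; rewrite ler_norml; exact: fm_bound.
Qed.

(** A countable subfamily whose finite maxima exhaust the supremum of the expectations
    of finite maxima has the essential supremum as its pointwise supremum: a further
    member exceeding it on a non-null set would increase that supremum. *)
Lemma ess_supremum_exists : exists W, is_ess_supremum Pr G Phi W /\ L1 Pr W.
Proof.
pose A : set R := [set Ex Pr g | g in finite_max].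
have A0 : A !=set0 by exists (Ex Pr (fun w => - H w)); exists (fun w => - H w) => //; constructor.
have Aub : ubound A (Ex Pr H).
  move=> _ [g fg <-]; apply: Ex_le => //; first exact: fm_L1.
  by move=> w; have /andP[] := fm_bound fg w.
have hA : has_sup A by split => //; exists (Ex Pr H).
have ex k : exists g, finite_max g /\ sup A - k.+1%:R^-1 < Ex Pr g.
  have k0 : 0 < k.+1%:R^-1 :> R by rewrite invr_gt0.
  by have [_ [g fg <-] hg] := sup_adherent k0 hA; exists g.
have [g gP] := choice ex.
have fg k : finite_max (g k) by case: (gP k).
pose W w := sups (fun k => g k w) 0.
have ubg w : has_ubound (range (fun k => g k w)).
  by exists (H w) => _ [k _ <-]; have /andP[] := fm_bound (fg k) w.
have Wge k w : g k w <= W w.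
  apply: ub_le_sup; last by exists k.
  by have [M HM] := ubg w; exists M => _ [j _ <-]; apply: HM; exists j.
have Wle w c : (forall k, g k w <= c) -> W w <= c.
  move=> Hc; apply: ge_sup; first by exists (g 0%N w); exists 0%N.
  by move=> _ [k _ <-].
have mW : sub_measurable G W.
  apply: (@measurable_fun_sups _ (g_sigma_algebraType G) R setT (fun k => g k) 0%N).
    by move=> w _; exact: ubg.
  by move=> k; exact: fm_meas.
have WH w : `|W w| <= H w.
  rewrite ler_norml (le_trans _ (Wge 0%N w)); last by have /andP[] := fm_bound (fg 0%N) w.
  by apply: Wle => k; have /andP[] := fm_bound (fg k) w.
have L1W : L1 Pr W by apply: (L1_le (sub_measurableW hG mW) WH L1H).
exists W; split=> //; split=> // [f Pf|W' mW' HW'].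
- (* the excess of f over W is less than the slack left in the supremum by each g k *)
  pose e w := Num.max (clip f w) (W w) - W w.
  have mclip : sub_measurable G (clip f).
    apply: measurable_maxr; first exact: measurable_funN.
    by apply: measurable_minr => //; exact: Phi_meas.
  have L1clip : L1 Pr (clip f).
    apply: (L1_le (sub_measurableW hG mclip) _ L1H) => w.
    by have := H0 w; rewrite ler_norml /clip le_max lexx/= ge_max ge_min lexx orbT andbT; lra.
  have L1e : L1 Pr e by apply: L1B => //; exact: L1_max.
  have e0 w : 0 <= e w by rewrite /e subr_ge0 le_max lexx orbT.
  have : {ae Pr, forall w, e w = 0}.
    apply: Ex_eq0 => //; rewrite leNgt; apply/negP => Ee0.
    have [k] := @ltr_add_invr R 0 _ Ee0; rewrite add0r => hk.
    have : Ex Pr e <= k.+1%:R^-1.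
      apply: (@le_trans _ _ (Ex Pr (fun w => Num.max (clip f w) (g k w) - g k w))).
        apply: Ex_le => //; first by apply: L1B; [apply: L1_max => //; exact: fm_L1|exact: fm_L1].
        move=> w; rewrite /e; have := Wge k w.
        by case: (leP (clip f w) (W w)); case: (leP (clip f w) (g k w)); lra.
      rewrite ExB; [|by apply: L1_max => //; exact: fm_L1|exact: fm_L1].
      have : Ex Pr (fun w => Num.max (clip f w) (g k w)) <= sup A.
        apply: ub_le_sup; first by exists (Ex Pr H).
        by exists (fun w => Num.max (clip f w) (g k w)) => //; constructor.
      move=> h1; have [_ h2] := gP k; rewrite lerBlDr (le_trans h1)// -lerBlDl; exact: ltW.
    by rewrite leNgt hk.
  move=> he; have hc := clip_ae Pf; apply: filterS (filterI he hc) => w [].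
  by rewrite /e => /eqP + <-; rewrite subr_eq0 => /eqP <-; rewrite le_max lexx.
- have ge_fm h : finite_max h -> {ae Pr, forall w, h w <= W' w}.
    elim=> [|f {}h Pf fh IH].
      have [f Pf] := Phi0; have h1 := HW' _ Pf; have h2 := Phi_le Pf.
      apply: filterS (filterI h1 h2) => w [{}h1]; rewrite ler_norml => /andP[{}h2 _].
      exact: le_trans h1.
    have h1 := HW' _ Pf; have h2 := clip_ae Pf.
    apply: filterS (filterI (filterI h1 h2) IH) => w [[{}h1 {}h2] h3].
    by rewrite ge_max h2 h1 h3.
  have : {ae Pr, forall w, forall k, g k w <= W' w}.
    by apply/ae_foralln => k; exact: ge_fm.
  by apply: filterS => w hw; exact: Wle.
Qed.

End essential_supremum.

(** * Independence *)

Section independence.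
Context {dO : measure_display} {Omega : measurableType dO} {R : realType}.
Variable Pr : probability Omega R.

(** Both sides of the product formula are finite measures in [A], so they agree on the
    sigma-algebra generated by a pi-system on which they agree. *)
Lemma indep_sigma_extend (C : set (set Omega)) (B : set Omega) :
  C `<=` measurable -> setI_closed C -> C setT -> measurable B ->
  (forall A, C A -> Pr (A `&` B) = (Pr A * Pr B)%E) ->
  forall A, <<s C >> A -> Pr (A `&` B) = (Pr A * Pr B)%E.
Proof.
move=> Cm CI CT mB H A CA.
have r0 : 0 <= fine (Pr B) by exact: fine_ge0.
pose m1 : {measure set Omega -> \bar R} := mrestr Pr mB.
pose m2 : {measure set Omega -> \bar R} := mscale (NngNum r0) Pr.
have PB : Pr B \is a fin_num by exact: fin_num_measure.
have m2E X : m2 X = (Pr X * Pr B)%E by rewrite /m2/= /mscale/= fineK// muleC.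
rewrite -m2E; change (m1 A = m2 A).
apply: (@g_sigma_algebra_measure_unique _ R Omega C Cm (fun=> setT)) => //.
- by apply/seteqP; split=> // x _; exists 0%N.
- by move=> X CX; rewrite m2E -H.
- move=> _; rewrite /m1 /= /mrestr setTI.
  by rewrite ltey_eq PB.
Qed.

Section family.
Context {I : finType} {d : measure_display} {E : measurableType d}.
Variable X : I -> Omega -> E.
Hypothesis mX : forall i, measurable_fun setT (X i).
Hypothesis indX : mutually_independent Pr X.

Definition cylinders (J : {set I}) : set (set Omega) :=
  [set B | exists2 A : I -> set E, (forall i, measurable (A i)) &
     B = \bigcap_(i in [set` J]) (X i @^-1` A i)].

Lemma cylinders_measurable J : cylinders J `<=` measurable.
Proof.
move=> _ [A mA ->]; apply: fin_bigcap_measurable => // i _.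
by rewrite -[X in measurable X]setTI; exact: mX.
Qed.

Lemma cylindersT J : cylinders J setT.
Proof. by exists (fun=> setT) => //; apply/seteqP; split=> w //= _ i _. Qed.

Lemma cylindersI J : setI_closed (cylinders J).
Proof.
move=> _ _ [A mA ->] [B mB ->]; exists (fun i => A i `&` B i).
  by move=> i; exact: measurableI.
by rewrite -bigcapI; apply: eq_bigcapr.
Qed.

Lemma cylinders_disjoint (J K : {set I}) A B : (forall i, i \in J -> i \notin K) ->
  cylinders J A -> cylinders K B -> Pr (A `&` B) = (Pr A * Pr B)%E.
Proof.
move=> JK [A' mA ->] [B' mB ->].
pose D i := if i \in J then A' i else B' i.
have DJ i : i \in J -> D i = A' i by rewrite /D => ->.
have DK i : i \in K -> D i = B' i.
  by move=> iK; rewrite /D; case: ifPn => // /JK; rewrite iK.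
have mD i : measurable (D i) by rewrite /D; case: ifP.
rewrite (eq_bigcapr (fun i (iJ : [set` J] i) => congr1 (fun S => X i @^-1` S) (esym (DJ i iJ)))).
rewrite (eq_bigcapr (fun i (iK : [set` K] i) => congr1 (fun S => X i @^-1` S) (esym (DK i iK)))).
rewrite -bigcap_setU (_ : [set` J] `|` [set` K] = [set` J :|: K]); last first.
  by apply/seteqP; split=> i /=; rewrite inE => /orP.
rewrite !indX//; rewrite (eq_bigl (fun i => (i \in J) || (i \in K))); last first.
  by move=> i; rewrite !inE.
rewrite (bigID (fun i => i \in J))/=; congr (_ * _)%E; apply: eq_bigl => i.
  by case: (i \in J) => //; rewrite andbF.
by have := JK i; case: (i \in J) => [/(_ isT)/negbTE->|_]; rewrite ?andbF ?andbT.
Qed.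

(** Disjoint subfamilies of a mutually independent family generate independent
    sigma-algebras: the product formula on the pi-systems of cylinders extends in each
    argument. *)
Lemma cylinders_sigma_indep (J K : {set I}) A B : (forall i, i \in J -> i \notin K) ->
  <<s cylinders J >> A -> <<s cylinders K >> B -> Pr (A `&` B) = (Pr A * Pr B)%E.
Proof.
move=> JK JA KB.
have mB : measurable B by apply: sigma_sub_measurable KB; exact: cylinders_measurable.
apply: (indep_sigma_extend (@cylinders_measurable J) (@cylindersI J) (@cylindersT J) mB _ JA).
move=> A' JA'; rewrite setIC muleC.
apply: (indep_sigma_extend (@cylinders_measurable K) (@cylindersI K) (@cylindersT K) _ _ KB).
  exact: cylinders_measurable JA'.
by move=> B' KB'; rewrite setIC muleC; exact: (cylinders_disjoint JK).
Qed.

Lemma cylinders_coord (J : {set I}) i A : i \in J -> measurable A -> cylinders J (X i @^-1` A).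
Proof.
move=> iJ mA; exists (fun j => if j == i then A else setT).
  by move=> j; case: ifP.
apply/seteqP; split=> w /=.
  by move=> Aw j _ /=; case: ifPn => // /eqP ->.
by move=> /(_ i iJ); rewrite /= eqxx.
Qed.

End family.
End independence.

Section freezing.
Context {dO : measure_display} {Omega : measurableType dO} {R : realType}.
Context {d : measure_display} {E : measurableType d}.
Variables (Pr : probability Omega R) (G : set (set Omega)).
Hypothesis hG : G `<=` measurable.
Variables (Y : Omega -> E) (nu : probability E R).
Hypothesis mY : measurable_fun setT Y.
Hypothesis lawY : eq_law (pushforward Pr Y) nu.
Hypothesis indY : forall B A, <<s G >> B -> measurable A ->
  Pr (B `&` Y @^-1` A) = (Pr B * Pr (Y @^-1` A))%E.
Local Notation OG := (g_sigma_algebraType G).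

Let PrG : probability OG R := push_law Pr (measurable_idG hG).

Let joint (w : Omega) : OG * E := (w, Y w).

Let mjoint : measurable_fun setT joint.
Proof. by apply/measurable_fun_pairP; split=> //; exact: measurable_idG. Qed.

(** The product formula on rectangles characterises the product measure. *)
Lemma joint_law_product : eq_law (pushforward Pr joint) (PrG \x nu)%E.
Proof.
move=> A mA; rewrite (@product_measure_unique _ _ _ _ _ PrG nu (push_law Pr mjoint))//.
by move=> B C mB mC; rewrite /= -lawY// -indY.
Qed.

Variables (h : OG * E -> R) (g : Omega -> R).
Hypothesis mh : measurable_fun setT h.
Hypothesis L1h : L1 Pr (fun w => h (w, Y w)).
Hypothesis hg : forall w, (g w)%:E = (\int[nu]_y (h (w, y))%:E)%E.

(** The conditional expectation given the past is computed by integrating out the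
    independent variable with the past frozen (Fubini). *)
Lemma freezing : is_cond_exp Pr G (fun w => h (w, Y w)) g.
Proof.
have H B (GB : <<s G >> B) : L1 PrG (fun w => g w * \1_B w) /\
    Ex PrG (fun w => g w * \1_B w) = Ex Pr (fun w => h (w, Y w) * \1_B w).
  have mB := sigma_sub_measurable hG GB.
  pose f (z : OG * E) : R := h z * \1_B z.1.
  have mf : measurable_fun setT f.
    apply: measurable_funM => //.
    apply: (measurableT_comp _ measurable_fst).
    exact: (@measurable_indic _ OG R setT B).
  have L1f : L1 (PrG \x nu)%E f.
    by apply/(L1_law mjoint joint_law_product mf); exact: L1_indic.
  have FE w : fubini_F nu (EFin \o f) w = (g w * \1_B w)%:E.
    rewrite /fubini_F /f/= indicE; case: (w \in B).
      by rewrite mulr1 hg; apply: eq_integral => y _; rewrite mulr1.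
    by rewrite mulr0; apply: integral0_eq => y _; rewrite mulr0.
  have FE' : fubini_F nu (EFin \o f) = EFin \o (fun w => g w * \1_B w) by exact/funext.
  split; first by rewrite /L1 -FE'; exact: integrable_fubini_F.
  rewrite -[RHS](Ex_law mjoint joint_law_product L1f) /Ex.
  by congr fine; rewrite -integral12_prod_meas1// FE'.
have gT : g = (fun w => g w * \1_[set: Omega] w).
  by apply/funext => w; rewrite indicT mulr1.
have GT : <<s G >> [set: Omega] by exact: (@measurableT _ OG).
have [L1T _] := H _ GT.
rewrite -gT in L1T.
have L1g : L1 Pr g.
  by apply/(L1_law (measurable_idG hG) (push_lawE Pr (measurable_idG hG)) (L1_meas L1T)).
apply/(is_cond_expE hG _ L1h); split => //; first exact: L1_meas L1T.
move=> B GB; have [L1B <-] := H B GB.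
by rewrite (Ex_law (measurable_idG hG) (push_lawE Pr (measurable_idG hG)) L1B).
Qed.

End freezing.

(** * Independence of the initial states and noises of the game *)

Section noise_structure.
Context {R : realType} {d T : nat} (D : mfg_data R d T).
Local Notation V := 'rV[R]_d.
Context {n : nat} {dO : measure_display} {Omega : measurableType dO}.
Context {Pr : probability Omega R}.
Variables (X0 : 'I_n.+1 -> {RV Pr >-> V}) (Y : 'I_n.+1 -> nat -> {RV Pr >-> V}).
Hypothesis hN : game_noise D X0 Y.

Lemma sub_measurable_gen (G : set (set Omega)) d' (E : measurableType d') (f : Omega -> E) :
  (forall A, measurable A -> G (f @^-1` A)) -> sub_measurable G f.
Proof. by move=> H _ A mA; rewrite setTI; apply: sub_sigma_algebra; exact: H. Qed.

Lemma sub_measurableS (G H : set (set Omega)) d' (E : measurableType d') (f : Omega -> E) :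
  <<s G >> `<=` <<s H >> -> sub_measurable G f -> sub_measurable H f.
Proof. by move=> GH mf _ A mA; apply: GH; exact: mf. Qed.

(** Initial states and noises form one mutually independent family, in which both the
    filtration and the data of a single player are generated by subfamilies. *)
Definition source (k : 'I_n.+1 + 'I_n.+1 * 'I_T) : Omega -> V :=
  match k with inl i => X0 i | inr k => noise_family Y k end.

Lemma source_measurable k : measurable_fun setT (source k).
Proof. by case: k => k; exact: measurable_funPT. Qed.

Lemma source_indep : mutually_independent Pr source.
Proof.
move=> J A mA.
pose JX := [set i : 'I_n.+1 | inl i \in J]%SET.
pose JY := [set k : 'I_n.+1 * 'I_T | inr k \in J]%SET.
pose BX := \bigcap_(i in [set` JX]) (X0 i @^-1` A (inl i)).
pose BY := \bigcap_(k in [set` JY]) (noise_family Y k @^-1` A (inr k)).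
have -> : \bigcap_(k in [set` J]) (source k @^-1` A k) = BX `&` BY.
  apply/seteqP; split=> w /=.
    move=> H; split=> k /=; rewrite inE => kJ; exact: (H _ kJ).
  move=> [HX HY] [i|k] kJ /=; [apply: HX|apply: HY]; by rewrite /= inE.
have sX : sigma_family (fun i => X0 i : Omega -> V) BX.
  pose g := [set B | exists i, exists2 A, measurable A & B = X0 i @^-1` A].
  apply: (@fin_bigcap_measurable _ (g_sigma_algebraType g)) => // i _.
  by apply: sub_sigma_algebra; exists i, (A (inl i)).
have sY : sigma_family (@noise_family R d T n dO Omega Pr Y) BY.
  pose g := [set B | exists k, exists2 A, measurable A &
    B = @noise_family R d T n dO Omega Pr Y k @^-1` A].
  apply: (@fin_bigcap_measurable _ (g_sigma_algebraType g)) => // k _.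
  by apply: sub_sigma_algebra; exists k, (A (inr k)).
rewrite (X0_Y_indep hN sX sY) (X0_indep hN)// (Y_indep hN)// big_sumType/=.
by congr (_ * _)%E; apply: eq_bigl => k; rewrite inE.
Qed.

Lemma filt_measurable t : filt X0 Y t `<=` measurable.
Proof.
move=> _ [[i [A mA ->]]|[i [s [A [_ mA] ->]]]];
  by rewrite -[X in measurable X]setTI; apply: measurable_funPT.
Qed.

Lemma filtS s t : (s <= t)%N -> <<s filt X0 Y s >> `<=` <<s filt X0 Y t >>.
Proof.
move=> st; apply: sub_sigma_algebra2 => B [H|[i [r [A [rs mA] BE]]]]; [by left|right].
by exists i, r, A => //; split => //; exact: leq_trans st.
Qed.

Lemma X0_filt i t : sub_measurable (filt X0 Y t) (X0 i).
Proof. by apply: sub_measurable_gen => A mA; left; exists i, A. Qed.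

Lemma Y_filt i s t : (s < t)%N -> sub_measurable (filt X0 Y t) (Y i s).
Proof. by move=> st; apply: sub_measurable_gen => A mA; right; exists i, s, A. Qed.

Let past (t : nat) : {set 'I_n.+1 + 'I_n.+1 * 'I_T} :=
  [set k : 'I_n.+1 + 'I_n.+1 * 'I_T | match k with inl _ => true | inr k => (k.2 < t)%N end]%SET.

Lemma Y_indep_filt i t B A : (t < T)%N -> <<s filt X0 Y t >> B -> measurable A ->
  Pr (B `&` Y i t @^-1` A) = (Pr B * Pr (Y i t @^-1` A))%E.
Proof.
move=> tT sB mA.
pose K : {set 'I_n.+1 + 'I_n.+1 * 'I_T} := [set inr (i, Ordinal tT)]%SET.
apply: (@cylinders_sigma_indep _ _ _ Pr _ _ _ source source_measurable source_indep (past t) K).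
- by move=> [j|[j s]]; rewrite !inE//=; apply: contraTneq => -[_ ->]; rewrite ltnn.
- apply: smallest_sub sB; first exact: smallest_sigma_algebra.
  move=> _ [[j [A' mA' ->]]|[j [s [A' [st mA'] ->]]]]; apply: sub_sigma_algebra.
    by apply: (@cylinders_coord _ _ _ _ _ source (past t) (inl j)) => //; rewrite inE.
  have sT := ltn_trans st tT.
  by apply: (@cylinders_coord _ _ _ _ _ source (past t) (inr (j, Ordinal sT))) => //; rewrite inE.
- apply: sub_sigma_algebra.
  by apply: (@cylinders_coord _ _ _ _ _ source K (inr (i, Ordinal tT))) => //; rewrite inE.
Qed.

(** At equilibrium the trajectory of player [i] depends on its own data only, and these
    sigma-algebras are independent for distinct players, contrary to the filtration that
    they share. *)
Definition own (i : 'I_n.+1) : set (set Omega) :=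
  [set B | (exists2 A, measurable A & B = X0 i @^-1` A) \/
           (exists s, exists2 A, (s < T)%N /\ measurable A & B = Y i s @^-1` A)].

Lemma own_measurable i : own i `<=` measurable.
Proof.
move=> _ [[A mA ->]|[s [A [_ mA] ->]]];
  by rewrite -[X in measurable X]setTI; apply: measurable_funPT.
Qed.

Let own_sources (i : 'I_n.+1) : {set 'I_n.+1 + 'I_n.+1 * 'I_T} :=
  [set k : 'I_n.+1 + 'I_n.+1 * 'I_T | match k with inl j => j == i | inr k => k.1 == i end]%SET.

Let own_cylinders i : <<s own i >> `<=` <<s cylinders source (own_sources i) >>.
Proof.
move=> B sB; apply: smallest_sub sB; first exact: smallest_sigma_algebra.
move=> _ [[A' mA' ->]|[s [A' [sT mA'] ->]]]; apply: sub_sigma_algebra.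
  by apply: (@cylinders_coord _ _ _ _ _ source (own_sources i) (inl i)) => //; rewrite inE.
by apply: (@cylinders_coord _ _ _ _ _ source (own_sources i) (inr (i, Ordinal sT))) => //;
  rewrite inE.
Qed.

Lemma own_indep i j A B : i != j -> <<s own i >> A -> <<s own j >> B ->
  Pr (A `&` B) = (Pr A * Pr B)%E.
Proof.
move=> ij /own_cylinders sA /own_cylinders sB.
apply: (@cylinders_sigma_indep _ _ _ Pr _ _ _ source source_measurable source_indep
  (own_sources i) (own_sources j)) => //.
by case=> [k|[k s]]; rewrite !inE => /= /eqP ->.
Qed.

Lemma X0_own i : sub_measurable (own i) (X0 i).
Proof. by apply: sub_measurable_gen => A mA; left; exists A. Qed.

Lemma Y_own i s : (s < T)%N -> sub_measurable (own i) (Y i s).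
Proof. by move=> sT; apply: sub_measurable_gen => A mA; right; exists s, A. Qed.

End noise_structure.

(** * The dynamic risk measure *)

Section transfer_ae.
Context {d d' : measure_display} {T : measurableType d} {E : measurableType d'} {R : realType}.
Variables (P : probability T R) (m : probability E R) (X : T -> E).
Hypothesis mX : measurable_fun setT X.
Hypothesis lawX : eq_law (pushforward P X) m.

Lemma ae_law (Q : E -> Prop) : {ae m, forall x, Q x} -> {ae P, forall w, Q (X w)}.
Proof.
move=> [N [mN N0 QN]]; exists (X @^-1` N); split.
- by rewrite -[X in measurable X]setTI; exact: mX.
- by rewrite -N0 -lawX.
- by move=> w nQ; apply: QN.
Qed.

End transfer_ae.

Section densities.
Context {R : realType} {d T : nat} (D : mfg_data R d T) (C : R).
Hypotheses (hwf : well_formed_data D) (C0 : 0 < C) (hass : standing_assumptions D C).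

Lemma dens_measurable t Z : (t < T)%N -> dens D t Z -> measurable_fun setT Z.
Proof.
move=> tT /(dens_Linfty hwf tT); rewrite inE => /andP[+ _].
by rewrite inE.
Qed.

Lemma dens_bounds t Z : (t < T)%N -> dens D t Z -> {ae noise D t, forall y, 0 <= Z y <= C}.
Proof.
move=> tT DZ; have h0 := dens_ge0 hwf tT DZ; have := dens_bound hass tT DZ.
rewrite unlock/= probability_setT lte01 => /ess_supP hC.
apply: filterS (filterI h0 hC) => y [-> /=].
by rewrite lee_fin => h; rewrite (le_trans (ler_norm _) h).
Qed.

End densities.

Section risk_measure.
Context {R : realType} {d T : nat} (D : mfg_data R d T) (C : R).
Local Notation V := 'rV[R]_d.
Hypotheses (hwf : well_formed_data D) (C0 : 0 < C) (hass : standing_assumptions D C).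
Context {n : nat} {dO : measure_display} {Omega : measurableType dO}.
Context {Pr : probability Omega R}.
Variables (X0 : 'I_n.+1 -> {RV Pr >-> V}) (Y : 'I_n.+1 -> nat -> {RV Pr >-> V}).
Hypothesis hN : game_noise D X0 Y.
Local Notation F := (filt X0 Y).
Implicit Types U W : Omega -> R.

Let mF t : F t `<=` measurable. Proof. exact: filt_measurable. Qed.

Definition scenarios i t U : set (Omega -> R) :=
  [set W | exists2 Z, dens D t Z & is_cond_exp Pr (F t) (fun w => U w * Z (Y i t w)) W].

Lemma noise_law i t : (t < T)%N -> eq_law (pushforward Pr (Y i t)) (noise D t).
Proof. by move=> tT A mA; exact: (Y_law hN i tT mA). Qed.

Lemma noise_measurable i t : measurable_fun setT (Y i t).
Proof. exact: measurable_funPT. Qed.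

Lemma densY_bounds i t Z : (t < T)%N -> dens D t Z -> {ae Pr, forall w, 0 <= Z (Y i t w) <= C}.
Proof.
move=> tT DZ; have h := dens_bounds hwf hass tT DZ.
exact: (ae_law (noise_measurable i t) (noise_law i tT) h).
Qed.

Lemma densY_meas i t Z : (t < T)%N -> dens D t Z -> measurable_fun setT (fun w => Z (Y i t w)).
Proof.
by move=> tT DZ; exact: (measurableT_comp (dens_measurable hwf tT DZ) (noise_measurable i t)).
Qed.

Lemma L1_dens i t Z U : (t < T)%N -> dens D t Z -> L1 Pr U ->
  L1 Pr (fun w => U w * Z (Y i t w)).
Proof.
move=> tT DZ hU; apply: (@L1_le_ae _ _ _ _ _ (fun w => C * `|U w|)).
- by apply: measurable_funM; [exact: L1_meas hU|exact: densY_meas].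
- apply: filterS (densY_bounds i tT DZ) => w /andP[Z0 ZC].
  by rewrite normrM mulrC ler_wpM2r// ger0_norm.
- by apply: L1Z; exact: L1_norm.
Qed.

Lemma scenarios_exist i t U : (t < T)%N -> L1 Pr U -> scenarios i t U !=set0.
Proof.
move=> tT hU; have [Z DZ] := dens_nonempty hwf tT.
have [W HW] := cond_exp_exists (@mF t) (L1_dens i tT DZ hU).
by exists W, Z.
Qed.

Lemma indic_le (B : set Omega) (x y : R) w : (x <= y) -> x * \1_B w <= y * \1_B w.
Proof. by move=> xy; have /andP[h _] := indic01 (R := R) B w; rewrite ler_wpM2r. Qed.

Lemma cond_exp_le (G : set (set Omega)) U U' W W' : G `<=` measurable ->
  L1 Pr U -> L1 Pr U' -> is_cond_exp Pr G U W -> is_cond_exp Pr G U' W' ->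
  {ae Pr, forall w, U w <= U' w} -> {ae Pr, forall w, W w <= W' w}.
Proof.
move=> hG hU hU' /(is_cond_expE hG _ hU)[mW LW EW] /(is_cond_expE hG _ hU')[mW' LW' EW'] UU'.
apply: (sub_measurable_le_ae hG) => // B GB; rewrite EW// EW'//.
have mB := sigma_sub_measurable hG GB.
apply: Ex_le_ae; [exact: L1_indic|exact: L1_indic|].
by apply: filterS UU' => w; exact: indic_le.
Qed.

Lemma cond_exp_lin (G : set (set Omega)) a b U U' W W' : G `<=` measurable ->
  L1 Pr U -> L1 Pr U' -> is_cond_exp Pr G U W -> is_cond_exp Pr G U' W' ->
  is_cond_exp Pr G (fun w => a * U w + b * U' w) (fun w => a * W w + b * W' w).
Proof.
move=> hG hU hU' /(is_cond_expE hG _ hU)[mW LW EW] /(is_cond_expE hG _ hU')[mW' LW' EW'].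
have L1s f g : L1 Pr f -> L1 Pr g -> L1 Pr (fun w => a * f w + b * g w).
  by move=> hf hg; apply: L1D; exact: L1Z.
apply/(is_cond_expE hG); first exact: L1s.
split; first by apply: measurable_funD; apply: measurable_funM => //; exact: measurable_cst.
- exact: L1s.
move=> B GB; have mB := sigma_sub_measurable hG GB.
have E f g : L1 Pr f -> L1 Pr g -> Ex Pr (fun w => (a * f w + b * g w) * \1_B w) =
    a * Ex Pr (fun w => f w * \1_B w) + b * Ex Pr (fun w => g w * \1_B w).
  move=> hf hg; rewrite -!ExZ; try exact: L1_indic.
  rewrite -ExD; try by apply: L1Z; exact: L1_indic.
  by apply: Ex_ext => w; ring.
by rewrite !E// EW// EW'.
Qed.

Lemma cond_exp_mean (G : set (set Omega)) U W : G `<=` measurable -> L1 Pr U ->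
  is_cond_exp Pr G U W -> Ex Pr W = Ex Pr U.
Proof.
move=> hG hU /(is_cond_expE hG _ hU)[mW LW /(_ setT) EW].
have GT : <<s G >> [set: Omega] by exact: (@measurableT _ (g_sigma_algebraType G)).
have := EW GT; under Ex_ext do rewrite indicT mulr1.
by under [in X in _ = X]Ex_ext do rewrite indicT mulr1.
Qed.

(** An essential supremum exists because the scenarios are dominated by C times the
    conditional expectation of |U|, so that the choice made in [rho] is a version of it. *)
Lemma rho_spec i t U : (t < T)%N -> L1 Pr U ->
  is_ess_supremum Pr (F t) (scenarios i t U) (rho D X0 Y i t U) /\
  L1 Pr (rho D X0 Y i t U).
Proof.
move=> tT hU; have hG := @mF t.
have hN' : L1 Pr (fun w => `|U w|) by exact: L1_norm.
have [K HK] := cond_exp_exists hG hN'.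
have [mK LK _] := HK.
pose H w := `|C * K w|.
have mCK : sub_measurable (F t) (fun w => C * K w).
  by apply: measurable_funM => //; exact: measurable_cst.
have [W [HW LW]] : exists W, is_ess_supremum Pr (F t) (scenarios i t U) W /\ L1 Pr W.
  apply: (@ess_supremum_exists _ _ _ _ _ hG _ H) => //.
  - exact: (measurableT_comp _ mCK).
  - by apply: L1_norm; exact: L1Z.
  - by move=> w; exact: normr_ge0.
  - by move=> f [Z _ []].
  - move=> f [Z DZ Hf].
    have LUZ := L1_dens i tT DZ hU.
    (* the terms with factor 0 only serve to use linearity for a single function *)
    have h0 : is_cond_exp Pr (F t) (fun w => C * `|U w| + 0 * `|U w|)
        (fun w => C * K w + 0 * K w) by exact: cond_exp_lin.
    have L0 : L1 Pr (fun w => C * `|U w| + 0 * `|U w|) by apply: L1D; exact: L1Z.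
    have b w : 0 <= Z (Y i t w) <= C -> `|U w * Z (Y i t w)| <= C * `|U w| + 0 * `|U w|.
      by move=> /andP[z0 zC]; rewrite mul0r addr0 normrM mulrC ler_wpM2r// ger0_norm.
    have h1 : {ae Pr, forall w, f w <= C * K w + 0 * K w}.
      apply: (cond_exp_le hG LUZ L0 Hf h0).
      by apply: filterS (densY_bounds i tT DZ) => w /b; exact: le_trans (ler_norm _).
    have Hf' : is_cond_exp Pr (F t)
      (fun w => -1 * (U w * Z (Y i t w)) + 0 * (U w * Z (Y i t w)))
      (fun w => -1 * f w + 0 * f w) by exact: cond_exp_lin.
    have h2 : {ae Pr, forall w, -1 * f w + 0 * f w <= C * K w + 0 * K w}.
      apply: (cond_exp_le hG _ L0 Hf' h0); first by apply: L1D; exact: L1Z.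
      apply: filterS (densY_bounds i tT DZ) => w /b.
      by rewrite ler_norml => /andP[]; lra.
    apply: filterS (filterI h1 h2) => w []; rewrite /H.
    have := ler_norm (C * K w); rewrite ler_norml; lra.
  - exact: (scenarios_exist i tT hU).
have HR : is_ess_supremum Pr (F t) (scenarios i t U) (rho D X0 Y i t U).
  by rewrite /rho; apply: xgetPex; exists W.
split=> //; have [mR uR lR] := HR; have [mW uW lW] := HW.
apply: L1_eq_ae LW; first exact: sub_measurableW mR.
by apply: filterS (filterI (lR _ mW uW) (lW _ mR uR)) => w [h1 h2]; apply/eqP; rewrite eq_le h1 h2.
Qed.

Lemma rho_L1 i t U : (t < T)%N -> L1 Pr U -> L1 Pr (rho D X0 Y i t U).
Proof. by move=> tT hU; case: (rho_spec i tT hU). Qed.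

Lemma rho_ge i t U W : (t < T)%N -> L1 Pr U -> scenarios i t U W ->
  {ae Pr, forall w, W w <= rho D X0 Y i t U w}.
Proof. by move=> tT hU HW; case: (rho_spec i tT hU) => -[_ + _] _; exact. Qed.

Lemma rho_le i t U W : (t < T)%N -> L1 Pr U -> sub_measurable (F t) W ->
  (forall W', scenarios i t U W' -> {ae Pr, forall w, W' w <= W w}) ->
  {ae Pr, forall w, rho D X0 Y i t U w <= W w}.
Proof. by move=> tT hU; case: (rho_spec i tT hU) => -[_ _ +] _; exact. Qed.

(** Densities take their values in [0, C], so that [rho] is monotone and, up to the
    factor [C], controlled by the conditional expectation. *)
Lemma rho_leD i t U U' H K : (t < T)%N -> L1 Pr U -> L1 Pr U' -> L1 Pr H ->
  (forall w, 0 <= H w) -> {ae Pr, forall w, U w <= U' w + H w} ->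
  is_cond_exp Pr (F t) H K ->
  {ae Pr, forall w, rho D X0 Y i t U w <= rho D X0 Y i t U' w + C * K w}.
Proof.
move=> tT hU hU' hH H0 UU' HK; have hG := @mF t.
have [[mR' _ _] _] := rho_spec i tT hU'; have [mK LK _] := HK.
apply: rho_le => //.
  by apply: measurable_funD => //; apply: measurable_funM => //; exact: measurable_cst.
move=> f [Z DZ Hf].
have LZ := L1_dens i tT DZ hU; have LZ' := L1_dens i tT DZ hU'.
have [f' Hf'] := cond_exp_exists hG LZ'.
have h1 : {ae Pr, forall w, f w <= 1 * f' w + C * K w}.
  apply: (cond_exp_le hG LZ _ Hf (cond_exp_lin 1 C hG LZ' hH Hf' HK)).
    by apply: L1D; exact: L1Z.
  apply: filterS (filterI UU' (densY_bounds i tT DZ)) => w [h /andP[z0 zC]].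
  apply: (@le_trans _ _ ((U' w + H w) * Z (Y i t w))); first by rewrite ler_wpM2r.
  by rewrite mulrDl mul1r lerD2l mulrC ler_wpM2r.
have h2 : {ae Pr, forall w, f' w <= rho D X0 Y i t U' w} by apply: rho_ge => //; exists Z.
by apply: filterS (filterI h1 h2) => w [{}h1 {}h2]; rewrite (le_trans h1)// mul1r lerD2r.
Qed.

Lemma rho_mono i t U U' : (t < T)%N -> L1 Pr U -> L1 Pr U' ->
  {ae Pr, forall w, U w <= U' w} ->
  {ae Pr, forall w, rho D X0 Y i t U w <= rho D X0 Y i t U' w}.
Proof.
move=> tT hU hU' UU'; have hG := @mF t.
have h0 : is_cond_exp Pr (F t) (fun=> 0) (fun=> 0).
  apply/(is_cond_expE hG _ (L1_cst _ _)); split=> //; [exact: measurable_cst|exact: L1_cst].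
have := @rho_leD i t U U' _ _ tT hU hU' (L1_cst _ 0) _ _ h0.
move=> /(_ (fun=> lexx _)) H; apply: filterS (H _).
  by move=> w; rewrite mulr0 addr0.
by apply: filterS UU' => w; rewrite addr0.
Qed.

Lemma rho_dist i t U U' : (t < T)%N -> L1 Pr U -> L1 Pr U' ->
  Ex Pr (fun w => `|rho D X0 Y i t U w - rho D X0 Y i t U' w|) <=
  C * Ex Pr (fun w => `|U w - U' w|).
Proof.
move=> tT hU hU'; have hG := @mF t.
have hH : L1 Pr (fun w => `|U w - U' w|) by apply: L1_norm; exact: L1B.
have [K HK] := cond_exp_exists hG hH; have [_ LK _] := HK.
have h0 w : 0 <= `|U w - U' w| by [].
have h1 := @rho_leD i t U U' _ _ tT hU hU' hH h0 _ HK.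
have h2 := @rho_leD i t U' U _ _ tT hU' hU hH h0 _ HK.
rewrite -(cond_exp_mean hG hH HK) -ExZ//; apply: Ex_le_ae.
- by apply: L1_norm; apply: L1B; exact: rho_L1.
- exact: L1Z.
- have a1 : {ae Pr, forall w, U w <= U' w + `|U w - U' w|}.
    by apply: aeW => w; have := ler_norm (U w - U' w); lra.
  have a2 : {ae Pr, forall w, U' w <= U w + `|U w - U' w|}.
    by apply: aeW => w; have := ler_norm (U' w - U w); rewrite distrC; lra.
  apply: filterS (filterI (h1 a1) (h2 a2)) => w []; rewrite ler_norml.
  by lra.
Qed.

Lemma rho_comp_L1 i t U : (t <= T)%N -> L1 Pr U -> L1 Pr (rho_comp D X0 Y i t U).
Proof.
elim: t U => [//|t IH] U tT hU /=.
by apply: IH; [exact: ltnW|exact: rho_L1].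
Qed.

Lemma rho_comp_mono i t U U' : (t <= T)%N -> L1 Pr U -> L1 Pr U' ->
  {ae Pr, forall w, U w <= U' w} ->
  {ae Pr, forall w, rho_comp D X0 Y i t U w <= rho_comp D X0 Y i t U' w}.
Proof.
elim: t U U' => [//|t IH] U U' tT hU hU' UU' /=.
apply: IH; [exact: ltnW|exact: rho_L1|exact: rho_L1|exact: rho_mono].
Qed.

Lemma rho_comp_dist i t U U' : (t <= T)%N -> L1 Pr U -> L1 Pr U' ->
  Ex Pr (fun w => `|rho_comp D X0 Y i t U w - rho_comp D X0 Y i t U' w|) <=
  C ^+ t * Ex Pr (fun w => `|U w - U' w|).
Proof.
elim: t U U' => [|t IH] U U' tT hU hU' /=; first by rewrite mul1r.
apply: le_trans (IH _ _ (ltnW tT) (rho_L1 i tT hU) (rho_L1 i tT hU')) _.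
by rewrite exprSr -mulrA; apply: ler_wpM2l; [rewrite exprn_ge0// ltW|exact: rho_dist].
Qed.

Lemma riskE i U : L1 Pr U -> risk D X0 Y i U = (Ex Pr (rho_comp D X0 Y i T U))%:E.
Proof. by move=> hU; rewrite /risk unlock ExE//; exact: rho_comp_L1. Qed.

Lemma risk_dist i U U' : L1 Pr U -> L1 Pr U' ->
  `|Ex Pr (rho_comp D X0 Y i T U) - Ex Pr (rho_comp D X0 Y i T U')| <=
  C ^+ T * Ex Pr (fun w => `|U w - U' w|).
Proof.
move=> hU hU'; apply: le_trans (rho_comp_dist i (leqnn T) hU hU').
rewrite -ExB; try exact: rho_comp_L1.
by apply: Ex_norm; apply: L1B; exact: rho_comp_L1.
Qed.

(** Choosing at every step the density bounded below by 1/C bounds the risk from below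
    by an expectation; this is what makes the cost coercive. *)
Lemma risk_coercive i t k U : (t <= T)%N -> L1 Pr U -> {ae Pr, forall w, - k <= U w} ->
  C^-1 ^+ t * Ex Pr (fun w => U w + k) - k <= Ex Pr (rho_comp D X0 Y i t U).
Proof.
elim: t U => [|t IH] U tT hU Uk /=.
  by rewrite mul1r ExD ?Ex_cst ?addrK//; exact: L1_cst.
have hG := @mF t.
have hUk : L1 Pr (fun w => U w + k) by apply: L1D => //; exact: L1_cst.
have [W HW] := cond_exp_exists hG hUk; have [mW LW _] := HW.
have [Z DZ Zlow] := dens_lower hass tT.
have LZ := L1_dens i tT DZ hU.
have [f Hf] := cond_exp_exists hG LZ.
have L1one : L1 Pr (fun w => 1 * Z (Y i t w)) by apply: L1_dens => //; exact: L1_cst.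
(* the density has mean one given the past, so that constants can be added *)
have hone : is_cond_exp Pr (F t) (fun w => 1 * Z (Y i t w)) (fun=> 1).
  apply: (@freezing _ _ _ _ _ Pr _ hG (Y i t) (noise D t) (noise_measurable i t) (noise_law i tT) _
    (fun z => 1 * Z z.2) (fun=> 1)) => //.
  - by move=> B A GB mA; exact: (Y_indep_filt hN).
  - apply: measurable_funM => //.
    exact: (measurableT_comp (dens_measurable hwf tT DZ) measurable_snd).
  - by move=> w; under eq_integral do rewrite mul1r; rewrite (dens_int1 hwf tT DZ).
have W0 : {ae Pr, forall w, 0 <= W w}.
  apply: (cond_exp_le hG (L1_cst _ 0) hUk _ HW).
    apply/(is_cond_expE hG _ (L1_cst _ _)); split=> //; [exact: measurable_cst|exact: L1_cst].
  by apply: filterS Uk => w; lra.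
have h1 : {ae Pr, forall w, C^-1 * W w + 0 * W w <= 1 * f w + k * 1}.
  apply: (cond_exp_le hG _ _ (cond_exp_lin C^-1 0 hG hUk hUk HW HW)
    (cond_exp_lin 1 k hG LZ L1one Hf hone)).
  - by apply: L1D; exact: L1Z.
  - by apply: L1D; exact: L1Z.
  have Zl := ae_law (noise_measurable i t) (noise_law i tT) Zlow.
  apply: filterS (filterI Uk Zl) => w [u z].
  have : C^-1 * (U w + k) <= Z (Y i t w) * (U w + k) by rewrite ler_wpM2r//; lra.
  by lra.
have h2 : {ae Pr, forall w, f w <= rho D X0 Y i t U w} by apply: rho_ge => //; exists Z.
pose W' w := C^-1 * W w - k.
have LW' : L1 Pr W' by apply: L1B; [exact: L1Z|exact: L1_cst].
have h3 : {ae Pr, forall w, W' w <= rho D X0 Y i t U w}.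
  apply: filterS (filterI h1 h2) => w []; rewrite /W'; lra.
have h4 : {ae Pr, forall w, - k <= W' w}.
  apply: filterS W0 => w w0; rewrite /W'.
  have : 0 <= C^-1 * W w by rewrite mulr_ge0// invr_ge0 ltW.
  by lra.
apply: (@le_trans _ _ (Ex Pr (rho_comp D X0 Y i t W'))).
  apply: le_trans (IH _ (ltnW tT) LW' h4); rewrite lerD2r /W'.
  under [in leRHS]Ex_ext do rewrite subrK.
  by rewrite ExZ// (cond_exp_mean hG hUk HW) exprSr mulrA.
apply: Ex_le_ae; [exact: rho_comp_L1 (ltnW tT) _|exact: rho_comp_L1 (ltnW tT) (rho_L1 i tT hU)|].
by apply: rho_comp_mono => //; [exact: ltnW|exact: rho_L1].
Qed.

End risk_measure.

(** * Square integrable functions and empirical means *)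

(** The difference of the two sides is half the sum of the squares (f i - f j) ^ 2. *)
Lemma sum_sqr_le {R : realType} (I : finType) (f : I -> R) :
  (\sum_i f i) ^+ 2 <= #|I|%:R * \sum_i f i ^+ 2.
Proof.
have : 0 <= \sum_i \sum_j (f i - f j) ^+ 2.
  by apply: sumr_ge0 => i _; apply: sumr_ge0 => j _; exact: sqr_ge0.
have sumC (x : R) : \sum_(i : I) x = #|I|%:R * x by rewrite sumr_const mulr_natl.
set Q := \sum_i f i ^+ 2; set S := \sum_i f i.
rewrite (eq_bigr (fun i => #|I|%:R * f i ^+ 2 + (- 2 * S) * f i + Q)); last first.
  move=> i _; rewrite /Q /S -sumC mulr_sumr mulr_suml -!big_split/=.
  by apply: eq_bigr => j _; ring.
rewrite !big_split/= -!mulr_sumr sumC -/Q -/S; lra.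
Qed.

Section square_integrable.
Context {d : measure_display} {T : measurableType d} {R : realType}.
Variable P : probability T R.
Implicit Types f g h : T -> R.

Definition L2 f : Prop := measurable_fun setT f /\ L1 P (fun x => f x ^+ 2).

Lemma L2_le f g : measurable_fun setT f -> (forall x, `|f x| <= g x) -> L2 g -> L2 f.
Proof.
move=> mf fg [mg hg]; split=> //; apply: (@L1_le _ _ _ _ _ (fun x => g x ^+ 2)) => //.
  exact: measurable_funX.
move=> x; rewrite normrX -ler_sqrt ?sqr_ge0// !sqrtr_sqr normr_id.
by rewrite (le_trans (fg x))// ler_norm.
Qed.

Lemma L2M f g : L2 f -> L2 g -> L1 P (fun x => f x * g x).
Proof.
move=> [mf hf] [mg hg]; apply: (@L1_le _ _ _ _ _ (fun x => f x ^+ 2 + g x ^+ 2)).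
- exact: measurable_funM.
- move=> x; rewrite ler_norml.
  have := sqr_ge0 (f x + g x); have := sqr_ge0 (f x - g x).
  have := sqr_ge0 (f x); have := sqr_ge0 (g x); nra.
- exact: L1D.
Qed.

Lemma L2_cst c : L2 (fun=> c).
Proof. by split; [exact: measurable_cst|exact: L1_cst]. Qed.

Lemma L2D f g : L2 f -> L2 g -> L2 (fun x => f x + g x).
Proof.
move=> hf hg; split; first by apply: measurable_funD; [case: hf|case: hg].
apply: (@L1_ext _ _ _ _ (fun x => f x ^+ 2 + (g x ^+ 2 + 2 * (f x * g x)))).
  by move=> x; ring.
apply: L1D; first by case: hf.
by apply: L1D; [case: hg|apply: L1Z; exact: L2M].
Qed.

Lemma L2Z c f : L2 f -> L2 (fun x => c * f x).
Proof.
move=> [mf hf]; split; first by apply: measurable_funM => //; exact: measurable_cst.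
apply: (@L1_ext _ _ _ _ (fun x => c ^+ 2 * f x ^+ 2)); last exact: L1Z.
by move=> x; rewrite exprMn.
Qed.

Lemma L2N f : L2 f -> L2 (fun x => - f x).
Proof. by move=> /(L2Z (-1)); under eq_fun do rewrite mulN1r. Qed.

Lemma L2B f g : L2 f -> L2 g -> L2 (fun x => f x - g x).
Proof. by move=> hf hg; apply: L2D => //; exact: L2N. Qed.

Lemma L2_norm f : L2 f -> L2 (fun x => `|f x|).
Proof.
move=> hf; have [mf _] := hf; split; first exact: measurableT_comp.
by under eq_fun do rewrite real_normK ?num_real//; case: hf.
Qed.

Lemma L2_sum (I : Type) (s : seq I) (F : I -> T -> R) :
  (forall i, L2 (F i)) -> L2 (fun x => \sum_(i <- s) F i x).
Proof.
move=> hF; elim: s => [|i s IH].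
  by under eq_fun do rewrite big_nil; exact: L2_cst.
by under eq_fun do rewrite big_cons; exact: L2D.
Qed.

Lemma L2_L1 f : L2 f -> L1 P f.
Proof. by move=> hf; apply: L1_ext (L2M hf (L2_cst 1)) => x; rewrite mulr1. Qed.

Lemma L2_sqr f : L2 f -> L1 P (fun x => f x ^+ 2).
Proof. by case. Qed.

Lemma L2_indic (B : set T) : measurable B -> L2 (\1_B).
Proof.
move=> mB; apply: (L2_le _ _ (L2_cst 1)); first exact: measurable_indic.
by move=> x; rewrite ger0_norm//; have /andP[] := indic01 (R := R) B x.
Qed.

End square_integrable.

Section empirical_mean.
Context {R : realType} {dO : measure_display} {Omega : measurableType dO}.
Context {d : measure_display} {E : measurableType d}.
Context {Pr : probability Omega R} {m : probability E R} {n : nat}.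
Variables (X : 'I_n.+1 -> Omega -> E) (G : 'I_n.+1 -> set (set Omega)).
Hypothesis hG : forall i, G i `<=` measurable.
Hypothesis mX : forall i, sub_measurable (G i) (X i).
Hypothesis lawX : forall i, eq_law (pushforward Pr (X i)) m.
Hypothesis indX : forall i j B A, i != j -> <<s G i >> B -> measurable A ->
  Pr (B `&` X j @^-1` A) = (Pr B * Pr (X j @^-1` A))%E.

Let mX' i : measurable_fun setT (X i).
Proof. exact: (sub_measurableW (@hG i) (@mX i)). Qed.

Lemma L2_lawX i (f : E -> R) : L2 m f -> L2 Pr (fun w => f (X i w)).
Proof.
move=> [mf hf]; split; first exact: (measurableT_comp mf (mX' i)).
by apply/(L1_law (mX' i) (@lawX i) (f := fun x => f x ^+ 2)) => //; exact: measurable_funX.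
Qed.

(** Freezing X_i turns g (X_j) into its mean. *)
Lemma Ex_indep_prod i j (f g : E -> R) : i != j -> L2 m f -> L2 m g ->
  Ex Pr (fun w => f (X i w) * g (X j w)) = Ex m f * Ex m g.
Proof.
move=> ij hf hg.
have hfg : L1 Pr (fun w => f (X i w) * g (X j w)) by apply: L2M; exact: L2_lawX.
have ce : is_cond_exp Pr (G i) (fun w => f (X i w) * g (X j w)) (fun w => f (X i w) * Ex m g).
  apply: (@freezing _ _ _ _ _ Pr _ (@hG i) (X j) m (mX' j) (@lawX j) _
    (fun z => f (X i z.1) * g z.2)) => //.
  - by move=> B A; exact: indX.
  - apply: measurable_funM.
      apply: (@measurableT_comp _ _ _ _ _ _ (fun w : g_sigma_algebraType (G i) => f (X i w))).
        by apply: (measurableT_comp _ (@mX i)); case: hf.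
      exact: measurable_fst.
    by apply: (measurableT_comp _ measurable_snd); case: hg.
  - move=> w /=; under eq_integral do rewrite EFinM.
    rewrite integralZl//; last exact: L2_L1 hg.
    by rewrite (ExE (L2_L1 hg)).
rewrite -(cond_exp_mean (@hG i) hfg ce).
under Ex_ext do rewrite mulrC.
have L1f := L2_L1 hf.
rewrite ExZ; last by apply/(L1_law (mX' i) (@lawX i) (f := f)) => //; case: hf.
by rewrite -(Ex_law (mX' i) (@lawX i) L1f) mulrC.
Qed.

(** Of the N ^ 2 products in the square of the sum only the N diagonal ones do not factor
    by independence. *)
Lemma empirical_mean_sqr (f : E -> R) : L2 m f ->
  Ex Pr (fun w => (n.+1%:R^-1 * \sum_j f (X j w)) ^+ 2) <=
  n.+1%:R^-1 * Ex m (fun x => f x ^+ 2) + (Ex m f) ^+ 2.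
Proof.
move=> hf; set N : R := n.+1%:R.
have N0 : 0 < N by rewrite ltr0n.
have L1p i j : L1 Pr (fun w => f (X i w) * f (X j w)) by apply: L2M; exact: L2_lawX.
have EL i j : Ex Pr (fun w => f (X i w) * f (X j w)) <=
    (if j == i then Ex m (fun x => f x ^+ 2) else 0) + (Ex m f) ^+ 2.
  case: eqP => [->|/eqP ji].
    rewrite (Ex_law (mX' i) (@lawX i) (L2_sqr hf)).
    by under Ex_ext do rewrite -expr2; rewrite lerDl sqr_ge0.
  by rewrite add0r expr2 Ex_indep_prod// eq_sym.
rewrite (_ : Ex Pr _ = N^-1 ^+ 2 * \sum_i \sum_j Ex Pr (fun w => f (X i w) * f (X j w))).
  have -> : N^-1 * Ex m (fun x => f x ^+ 2) + (Ex m f) ^+ 2 =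
     N^-1 ^+ 2 * \sum_(i < n.+1) (Ex m (fun x => f x ^+ 2) + N * Ex m f ^+ 2).
    rewrite sumr_const card_ord -[in RHS]mulr_natr -/N; field; lra.
  rewrite ler_wpM2l ?sqr_ge0//; apply: ler_sum => i _.
  apply: le_trans (ler_sum _ (fun j _ => EL i j)) _.
  rewrite big_split/= sumr_const card_ord -mulr_natl lerD2r.
  by rewrite (bigD1 i)//= eqxx big1 ?addr0// => j /negbTE ->.
have LS i : L1 Pr (fun w => \sum_j f (X i w) * f (X j w)) by apply: L1_sum.
rewrite -(eq_bigr _ (fun i _ => Ex_sum _ (L1p i))) -Ex_sum// -ExZ; last exact: L1_sum.
apply: Ex_ext => w; rewrite exprMn; congr (_ * _).
by rewrite expr2 mulr_suml; apply: eq_bigr => i _; rewrite mulr_sumr.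
Qed.

End empirical_mean.

(** * Quantization of the Euclidean space *)

Section quantizer.
Context {R : realType}.

Lemma bernoulli_ge (h : R) k : 0 <= h -> 1 + k%:R * h <= (1 + h) ^+ k.
Proof.
move=> h0; elim: k => [|k IH]; first by rewrite mul0r addr0.
rewrite exprS -natr1; have k0 : (0 : R) <= k%:R by [].
apply: (@le_trans _ _ ((1 + h) * (1 + k%:R * h))); last by rewrite ler_wpM2l ?addr_ge0.
have : 0 <= h * (k%:R * h) by rewrite !mulr_ge0//.
by lra.
Qed.

(** Index of the point of the geometric grid g ^ j - 1 just below s, capped at k. *)
Fixpoint level (g : R) k s : nat :=
  if k is k'.+1 then if g ^+ k <= 1 + s then k else level g k' s else 0%N.

Lemma level_le g k s : (level g k s <= k)%N.
Proof. by elim: k => //= k IH; case: ifP => // _; rewrite ltnW. Qed.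

Lemma level_lower g k s : 0 <= s -> g ^+ level g k s <= 1 + s.
Proof. by move=> s0; elim: k => /= [|k IH]; [rewrite expr0; lra|case: ifP]. Qed.

Lemma level_upper g k s : (level g k s < k)%N -> 1 + s < g ^+ (level g k s).+1.
Proof.
elim: k => //= k IH; case: ifPn => [_|]; first by rewrite ltnn.
rewrite -ltNge => sk; rewrite ltnS leq_eqVlt => /orP[/eqP->//|]; exact: IH.
Qed.

Lemma measurable_level g k : measurable_fun setT (level g k).
Proof.
elim: k => [|k IH]; first exact: measurable_cst.
apply: (@measurable_fun_ifT _ _ _ _ (fun=> k.+1) (level g k) (fun s => g ^+ k.+1 <= 1 + s)) => //.
apply: measurable_fun_ler; first exact: measurable_cst.
by apply: (@measurable_funD _ _ _ _ (fun=> 1) id).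
Qed.

Lemma enorm_mono k (x y : 'rV[R]_k) : (forall i, `|x 0 i| <= `|y 0 i|) -> enorm x <= enorm y.
Proof.
move=> h; rewrite -ler_sqr ?nnegrE ?enorm_ge0// !enorm_sqrE; apply: ler_sum => i _.
by rewrite -[leLHS]real_normK ?num_real// -[leRHS]real_normK ?num_real// ler_sqr ?nnegrE.
Qed.

(** Rounding every coordinate towards zero on the grid (1 + 1/r) ^ k - 1, k <= r e: the
    mesh at distance s of the origin is at most (1 + s) / r and the grid reaches 2 ^ e - 1,
    so that few cells give a small error relative to 1 + |x|. *)
Lemma quantizer d r e : (0 < r)%N ->
  exists (J : finType) (cell : 'rV[R]_d -> J) (rep : J -> 'rV[R]_d),
  [/\ forall c, measurable (cell @^-1` [set c]),
      #|J| = ((2 * (r * e).+1) ^ d)%N,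
      forall x, enorm (rep (cell x)) <= enorm x,
      forall x, enorm (x - rep (cell x)) <= enorm x &
      forall x, enorm (x - rep (cell x)) <=
        d%:R * (r%:R^-1 * (1 + enorm x) + (1 + enorm x) ^+ 2 / 2 ^+ e)].
Proof.
move=> r0; pose h : R := r%:R^-1; pose g := 1 + h; pose M := (r * e)%N.
have rp : (0 : R) < r%:R by rewrite ltr0n.
have h0 : 0 < h by rewrite invr_gt0.
have g1 : 1 <= g by rewrite /g; lra.
pose J : finType := {ffun 'I_d -> bool * 'I_M.+1}.
pose cell (x : 'rV[R]_d) : J := [ffun i => (x 0 i < 0, inord (level g M `|x 0 i|))].
pose rep (c : J) : 'rV[R]_d := \row_i ((if (c i).1 then -1 else 1) * (g ^+ (c i).2 - 1)).
have repE x i : rep (cell x) 0 i =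
    (if x 0 i < 0 then -1 else 1) * (g ^+ level g M `|x 0 i| - 1).
  by rewrite mxE ffunE /= inordK// ltnS level_le.
pose a (x : 'rV[R]_d) i := g ^+ level g M `|x 0 i| - 1.
have a0 x i : 0 <= a x i by rewrite subr_ge0 exprn_ege1.
have aU x i : a x i <= `|x 0 i| by rewrite lerBlDl level_lower.
have absrep x i : `|rep (cell x) 0 i| = a x i.
  by rewrite repE -/(a x i); case: ifP => _; rewrite ?mulN1r ?mul1r ?normrN ger0_norm.
have absdif x i : `|(x - rep (cell x)) 0 i| = `|x 0 i| - a x i.
  have -> : (x - rep (cell x)) 0 i = x 0 i - rep (cell x) 0 i by rewrite !mxE.
  rewrite repE -/(a x i); have := aU x i; have := a0 x i.
  case: (ltP (x 0 i) 0) => x0; [rewrite (ltr0_norm x0)|rewrite (ger0_norm x0)] => h1 h2.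
    by rewrite mulN1r opprK ler0_norm; lra.
  by rewrite mul1r ger0_norm; lra.
exists J, cell, rep; split.
- move=> c; rewrite (_ : _ @^-1` _ = \bigcap_(i in [set: 'I_d])
    ([set x : 'rV[R]_d | (x 0 i < 0) = (c i).1] `&`
     [set x : 'rV[R]_d | level g M `|x 0 i| = (c i).2])).
    apply: fin_bigcap_measurable => // i _; apply: measurableI.
      have mx : measurable_fun setT (fun x : 'rV[R]_d => x 0 i < 0).
        by apply: measurable_fun_ltr; [exact: measurable_mx_coord|exact: measurable_cst].
      have := mx measurableT [set (c i).1] I; rewrite setTI.
      by congr measurable; apply/seteqP; split.
    have mx : measurable_fun setT (fun x : 'rV[R]_d => level g M `|x 0 i|).
      apply: (measurableT_comp (measurable_level g M)).
      by apply: measurableT_comp => //; exact: measurable_mx_coord.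
    have := mx measurableT [set (c i).2 : nat] I; rewrite setTI.
    by congr measurable; apply/seteqP; split.
  apply/seteqP; split=> x /=.
    by move=> <- i _; rewrite ffunE/= inordK ?ltnS ?level_le.
  move=> H; apply/ffunP => i; rewrite ffunE; have [/= -> ->] := H i I.
  by rewrite inord_val -surjective_pairing.
- by rewrite card_ffun card_prod card_bool !card_ord.
- by move=> x; apply: enorm_mono => i; rewrite absrep.
- by move=> x; apply: enorm_mono => i; rewrite absdif; have := a0 x i; lra.
- move=> x; apply: (le_trans (enorm_le_sum _)).
  have sumE (B : R) : d%:R * B = \sum_(i < d) B by rewrite sumr_const card_ord mulr_natl.
  rewrite sumE; apply: ler_sum => i _.
  rewrite absdif; have xi := coord_le_enorm x i.
  set s := `|x 0 i| in xi *; have s0 : 0 <= s by exact: normr_ge0.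
  have e0 : 0 < 2 ^+ e :> R by rewrite exprn_gt0.
  have n0 := enorm_ge0 x.
  have T1 : h * (1 + s) <= h * (1 + enorm x) by rewrite ler_wpM2l; lra.
  have T2 : 0 <= (1 + enorm x) ^+ 2 / 2 ^+ e by rewrite divr_ge0 ?sqr_ge0 ?ltW.
  have [lM|Ml] := ltnP (level g M s) M.
    have := level_upper lM; rewrite exprS => up.
    have lo := level_lower g M s0.
    have : h * g ^+ level g M s <= h * (1 + s) by rewrite ler_wpM2l// ltW.
    rewrite /a -/s; move: up; rewrite {1}/g mulrDl mul1r -/h; lra.
  (* beyond the end of the grid the error is at most s, hence of second order in 1 + s *)
  have lE : level g M s = M by apply/eqP; rewrite eqn_leq level_le.
  have lo := level_lower g M s0; rewrite lE in lo.
  have g2 : 2 <= g ^+ r.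
    have rh : r%:R * h = 1 by rewrite mulfV// gt_eqF.
    by apply: le_trans (bernoulli_ge r (ltW h0)); rewrite rh; lra.
  have g0 : 0 <= g ^+ r by lra.
  have e2 : 2 ^+ e <= g ^+ M by rewrite /M exprM lerXn2r ?nnegrE.
  have : 1 <= (1 + enorm x) / 2 ^+ e by rewrite ler_pdivlMr// mul1r; lra.
  move=> H1; have : (1 + enorm x) * 1 <= (1 + enorm x) * ((1 + enorm x) / 2 ^+ e).
    by rewrite ler_wpM2l//; lra.
  rewrite mulr1 mulrA -expr2 -/h => H2.
  have : 0 <= h * (1 + enorm x) by rewrite mulr_ge0; lra.
  have := a0 x i; lra.
Qed.

End quantizer.

(** * Discrepancy of an empirical measure *)

Section empirical_discrepancy.
Context {R : realType} {dO : measure_display} {Omega : measurableType dO} {d n : nat}.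
Local Notation V := 'rV[R]_d.
Context {Pr : probability Omega R} {m : probability V R}.
Variables (X : 'I_n.+1 -> Omega -> V) (G : 'I_n.+1 -> set (set Omega)).
Hypothesis hG : forall i, G i `<=` measurable.
Hypothesis mX : forall i, sub_measurable (G i) (X i).
Hypothesis lawX : forall i, eq_law (pushforward Pr (X i)) m.
Hypothesis indX : forall i j B A, i != j -> <<s G i >> B -> measurable A ->
  Pr (B `&` X j @^-1` A) = (Pr B * Pr (X j @^-1` A))%E.
Hypothesis mom : L2 m enorm.
Variables (J : finType) (cell : V -> J) (rep : J -> V).
Hypothesis mcell : forall c, measurable (cell @^-1` [set c]).
Hypothesis rep_le : forall x, enorm (rep (cell x)) <= enorm x.
Hypothesis dist_le : forall x, enorm (x - rep (cell x)) <= enorm x.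

Local Notation N := (n.+1%:R : R).

Let ind (c : J) : V -> R := \1_(cell @^-1` [set c]).

Let indE c x : ind c x = (cell x == c)%:R.
Proof.
rewrite /ind indicE; congr (_%:R); congr nat_of_bool.
by apply/idP/eqP; rewrite inE.
Qed.

Let sum_ind (f : J -> R) x : f (cell x) = \sum_c f c * ind c x.
Proof.
rewrite (bigD1 (cell x))//= indE eqxx mulr1 big1 ?addr0// => c /negbTE cx.
by rewrite indE eq_sym cx mulr0.
Qed.

Let L2_ind c : L2 m (ind c). Proof. exact: L2_indic. Qed.

Let measurable_cellfun (f : J -> R) : measurable_fun setT (fun x => f (cell x)).
Proof.
under eq_fun do rewrite sum_ind.
apply: measurable_sum => c; apply: measurable_funM; first exact: measurable_cst.
by case: (L2_ind c).
Qed.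

Let psi (x : V) : R := enorm (x - rep (cell x)).

Lemma L2_cell_dist : L2 m (fun x => enorm (x - rep (cell x))).
Proof.
apply: (L2_le _ _ mom); last by move=> x; rewrite ger0_norm; [exact: dist_le|exact: enorm_ge0].
apply: measurable_enorm; apply: measurable_rVB => //.
by apply: measurable_fun_mx => i j; exact: (measurable_cellfun (fun c => rep c i j)).
Qed.

Let L2_psi : L2 m psi. Proof. exact: L2_cell_dist. Qed.

Let mass (c : J) : R := Ex m (ind c).

Let dev (c : J) (w : Omega) : R := N^-1 * \sum_j (ind c (X j w) - mass c).

(** Bounds the Wasserstein distance between the empirical measure and m without a supremum
    over test functions, so that it is measurable and its second moment can be computed. *)
Definition discrepancy (w : Omega) : R :=
  N^-1 * (\sum_j psi (X j w)) + Ex m psi + \sum_c enorm (rep c) * `|dev c w|.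

Let N0 : 0 < N. Proof. by rewrite ltr0n. Qed.

Lemma discrepancy_ge0 w : 0 <= discrepancy w.
Proof.
rewrite /discrepancy !addr_ge0//.
- apply: mulr_ge0; first by rewrite invr_ge0.
  by apply: sumr_ge0 => j _; exact: enorm_ge0.
- by apply: Ex_ge0 => x; exact: enorm_ge0.
- by apply: sumr_ge0 => c _; rewrite mulr_ge0 ?enorm_ge0.
Qed.

(** The discrepancy bounds the error of the empirical mean for all Lipschitz functions at
    once: replace each point by the centre of its cell. *)
Lemma discrepancy_lip (phi : V -> R) (L : R) w : 0 <= L ->
  (forall x y, `|phi x - phi y| <= L * enorm (x - y)) ->
  `|N^-1 * (\sum_j phi (X j w)) - Ex m phi| <= L * discrepancy w.
Proof.
move=> L0 phiL.
pose f x := phi x - phi (rep (cell x)).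
pose b c := phi (rep c) - phi 0.
have phiE x : phi x = f x + (phi 0 + \sum_c b c * ind c x).
  by rewrite -sum_ind /f /b; ring.
have mphi : measurable_fun setT phi by apply: (@measurable_fun_elip _ _ _ _ id phi L).
have fpsi x : `|f x| <= L * psi x by exact: phiL.
have L2f : L2 m f.
  apply: (L2_le _ fpsi (L2Z L L2_psi)).
  by apply: measurable_funB => //; exact: (measurable_cellfun (fun c => phi (rep c))).
have L1f := L2_L1 L2f; have L1psi := L2_L1 L2_psi.
have L1i c : L1 m (fun x => b c * ind c x) by apply: L1Z; exact: L2_L1.
have Ephi : Ex m phi = Ex m f + (phi 0 + \sum_c b c * mass c).
  rewrite (Ex_ext _ phiE) ExD//; last by apply: L1D; [exact: L1_cst|exact: L1_sum].
  rewrite ExD; [|exact: L1_cst|exact: L1_sum].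
  rewrite Ex_cst Ex_sum//; congr (_ + (_ + _)); apply: eq_bigr => c _.
  by rewrite ExZ//; exact: L2_L1.
have Sphi : N^-1 * (\sum_j phi (X j w)) = N^-1 * (\sum_j f (X j w)) + phi 0 +
    \sum_c b c * (dev c w + mass c).
  have devE c : dev c w + mass c = N^-1 * \sum_j ind c (X j w).
    by rewrite /dev sumrB sumr_const card_ord -[mass c *+ _]mulr_natl mulrBr mulKf ?gt_eqF// subrK.
  have -> : \sum_c b c * (dev c w + mass c) = N^-1 * \sum_j \sum_c b c * ind c (X j w).
    rewrite exchange_big mulr_sumr; apply: eq_bigr => c _.
    by rewrite devE mulrCA mulr_sumr.
  have -> : phi 0 = N^-1 * \sum_(j < n.+1) phi 0.
    by rewrite sumr_const card_ord -[phi 0 *+ _]mulr_natl mulKf ?gt_eqF.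
  rewrite -!mulrDr; congr (_ * _); rewrite -!big_split/=; apply: eq_bigr => j _.
  by rewrite {1}phiE addrA.
rewrite Sphi Ephi.
have -> : N^-1 * (\sum_j f (X j w)) + phi 0 + \sum_c b c * (dev c w + mass c) -
    (Ex m f + (phi 0 + \sum_c b c * mass c)) =
    N^-1 * (\sum_j f (X j w)) - Ex m f + \sum_c b c * dev c w.
  have -> : \sum_c b c * (dev c w + mass c) = \sum_c b c * dev c w + \sum_c b c * mass c.
    by rewrite -big_split; apply: eq_bigr => c _; rewrite mulrDr.
  by ring.
rewrite /discrepancy !mulrDr; apply: le_trans (ler_normD _ _) _; apply: lerD.
  apply: le_trans (ler_normB _ _) _; apply: lerD.
    have N1 : 0 <= N^-1 by rewrite invr_ge0 ltW.
    rewrite normrM (ger0_norm N1) [leRHS]mulrCA; apply: ler_wpM2l => //.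
    by rewrite mulr_sumr; apply: le_trans (ler_norm_sum _ _ _) _; apply: ler_sum => j _.
  rewrite -ExZ//; apply: le_trans (Ex_norm L1f) _; apply: Ex_le => //.
    exact: L1_norm.
  exact: L1Z.
apply: le_trans (ler_norm_sum _ _ _) _; rewrite mulr_sumr; apply: ler_sum => c _.
rewrite normrM mulrA ler_wpM2r//; apply: le_trans (phiL _ _) _.
by rewrite subr0.
Qed.

Let L2_mean (f : V -> R) : L2 m f -> L2 Pr (fun w => N^-1 * \sum_j f (X j w)).
Proof.
move=> hf; apply: L2Z; apply: L2_sum => j.
exact: (L2_lawX hG mX lawX).
Qed.

Let L2_dev c : L2 m (fun x => ind c x - mass c).
Proof. by apply: L2B => //; exact: L2_cst. Qed.

Lemma L2_discrepancy : L2 Pr discrepancy.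
Proof.
apply: L2D; first by apply: L2D; [exact: L2_mean|exact: L2_cst].
by apply: L2_sum => c; apply: L2Z; apply: L2_norm; exact: (L2_mean (L2_dev c)).
Qed.

(** The error on the mass of a cell is of order the square root of mass / N by independence,
    and there are #|J| cells to add up. *)
Lemma discrepancy_sqr :
  Ex Pr (fun w => discrepancy w ^+ 2) <=
  3 * (N^-1 * (1 + #|J|%:R) * Ex m (fun x => enorm x ^+ 2) + 2 * Ex m psi ^+ 2).
Proof.
set M2 := Ex m (fun x => enorm x ^+ 2).
have mean_psi := empirical_mean_sqr hG mX lawX indX L2_psi.
have psi2 : Ex m (fun x => psi x ^+ 2) <= M2.
  apply: Ex_le; [exact: L2_sqr|exact: L2_sqr|move=> x].
  by rewrite ler_sqr ?nnegrE; [exact: dist_le|exact: enorm_ge0|exact: enorm_ge0].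
have N1 : 0 <= N^-1 by rewrite invr_ge0 ltW.
have dev2 c : Ex Pr (fun w => dev c w ^+ 2) <= N^-1 * mass c.
  apply: le_trans (empirical_mean_sqr hG mX lawX indX (L2_dev c)) _.
  have L1ic := L2_L1 (L2_ind c).
  have -> : Ex m (fun x => ind c x - mass c) = 0.
    by rewrite ExB ?Ex_cst ?subrr//; exact: L1_cst.
  rewrite expr0n addr0 ler_wpM2l//.
  have -> : Ex m (fun x => (ind c x - mass c) ^+ 2) =
      Ex m (fun x => (1 - 2 * mass c) * ind c x + mass c ^+ 2).
    apply: Ex_ext => x; rewrite indE; case: (cell x == c) => /=; ring.
  rewrite ExD ?Ex_cst ?ExZ//; [|exact: L1Z|exact: L1_cst].
  by rewrite -/(mass c); have := sqr_ge0 (mass c); lra.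
(* Cauchy-Schwarz inequality over the cells *)
pose S3 w := \sum_c enorm (rep c) * `|dev c w|.
have S3sq w : S3 w ^+ 2 <= #|J|%:R * \sum_c (enorm (rep c) ^+ 2 * dev c w ^+ 2).
  pose a c := enorm (rep c) * `|dev c w|.
  rewrite (_ : \sum_c (enorm (rep c) ^+ 2 * dev c w ^+ 2) = \sum_c a c ^+ 2); last first.
    by apply: eq_bigr => c _; rewrite /a [in RHS]exprMn real_normK ?num_real.
  exact: sum_sqr_le.
have L1dev c : L1 Pr (fun w => dev c w ^+ 2) by apply: L2_sqr; exact: (L2_mean (L2_dev c)).
have L1rd c : L1 Pr (fun w => enorm (rep c) ^+ 2 * dev c w ^+ 2) by exact: L1Z.
have L2S3 : L2 Pr S3.
  by apply: L2_sum => c; apply: L2Z; apply: L2_norm; exact: (L2_mean (L2_dev c)).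
have ES3 : Ex Pr (fun w => S3 w ^+ 2) <= N^-1 * #|J|%:R * M2.
  apply: (@le_trans _ _ (Ex Pr (fun w => #|J|%:R * \sum_c (enorm (rep c) ^+ 2 * dev c w ^+ 2)))).
    by apply: Ex_le => //; [exact: L2_sqr|apply: L1Z; exact: L1_sum].
  rewrite ExZ; last exact: L1_sum.
  rewrite [N^-1 * _]mulrC -mulrA ler_wpM2l// Ex_sum//.
  apply: (@le_trans _ _ (N^-1 * \sum_c enorm (rep c) ^+ 2 * mass c)).
    rewrite mulr_sumr; apply: ler_sum => c _; rewrite ExZ// mulrCA.
    by rewrite ler_wpM2l ?sqr_ge0.
  rewrite ler_wpM2l//.
  have L1i c : L1 m (fun x => enorm (rep c) ^+ 2 * ind c x) by apply: L1Z; exact: L2_L1.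
  under eq_bigr do rewrite -(ExZ _ (L2_L1 (L2_ind _))).
  rewrite -Ex_sum//; apply: Ex_le => [||x]; [exact: L1_sum|exact: L2_sqr|].
  by rewrite -(sum_ind (fun c => enorm (rep c) ^+ 2)) ler_sqr ?nnegrE ?enorm_ge0.
pose S1 w := N^-1 * \sum_j psi (X j w).
have L2S1 : L2 Pr S1 by exact: L2_mean.
apply: (@le_trans _ _ (Ex Pr (fun w => 3 * (S1 w ^+ 2 + (Ex m psi ^+ 2 + S3 w ^+ 2))))).
  apply: Ex_le; first by apply: L2_sqr; exact: L2_discrepancy.
    apply: L1Z; apply: L1D; first exact: L2_sqr.
    by apply: L1D; [exact: L1_cst|exact: L2_sqr].
  move=> w; rewrite /discrepancy -/(S1 w) -/(S3 w).
  have := sqr_ge0 (S1 w - Ex m psi); have := sqr_ge0 (S1 w - S3 w).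
  have := sqr_ge0 (Ex m psi - S3 w); nra.
have h1 := L2_sqr L2S1; have h3 := L2_sqr L2S3; have h2 := L1_cst Pr (Ex m psi ^+ 2).
have h23 := L1D h2 h3.
rewrite ExZ; last exact: L1D.
rewrite ler_wpM2l// ExD// ExD// Ex_cst.
have : N^-1 * Ex m (fun x => psi x ^+ 2) <= N^-1 * M2 by rewrite ler_wpM2l.
have : Ex Pr (fun w => S1 w ^+ 2) <= N^-1 * Ex m (fun x => psi x ^+ 2) + Ex m psi ^+ 2.
  exact: mean_psi.
by move: ES3; rewrite mulrDr mulr1 mulrDl; set Ni := n.+1%:R^-1; lra.
Qed.

End empirical_discrepancy.

(** * Rate of convergence of empirical measures *)

Section rate.
Context {R : realType}.

(** A mesh r^-1 of order N^(-tau/2) up to distance 2^e >= N takes about (r e)^d cells, where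
    e is logarithmic in N. The logarithm is absorbed in the power N^a, for which the strict
    inequality tau (1 + d/2) < 1 leaves room. *)
Lemma grid_choice (d : nat) (tau : R) : (0 < d)%N -> 0 < tau -> tau * (1 + d%:R / 2) < 1 ->
  exists K : R, 0 < K /\ forall n : nat, exists r e : nat,
  [/\ (0 < r)%N,
      r%:R^-1 <= n.+1%:R `^ (- (tau / 2)) :> R,
      (2 ^+ e)^-1 <= n.+1%:R `^ (- (tau / 2)) :> R &
      n.+1%:R^-1 * (1 + ((2 * (r * e).+1) ^ d)%:R) <= K * n.+1%:R `^ (- tau) :> R].
Proof.
move=> d0 tau0 tau1.
have dR : (0 : R) < d%:R by rewrite ltr0n.
pose a := (1 - tau * (1 + d%:R / 2)) / d%:R.
have a0 : 0 < a by rewrite divr_gt0// subr_gt0.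
(* trunc_log N <= N^a / eta by Bernoulli's inequality for (1 + eta)^e = 2^(a e) <= N^a *)
pose eta := 2 `^ a - 1 : R.
have eta0 : 0 < eta.
  have : 1 `^ a < 2 `^ a :> R by apply: gt0_ltr_powR; rewrite ?nnegrE ?ltr1n.
  by rewrite powR1 subr_gt0.
pose A := eta^-1 + 1; have A0 : 0 < A by rewrite addr_gt0 ?invr_gt0.
exists (2 * (8 * A) ^+ d); split; first by rewrite mulr_gt0// exprn_gt0// mulr_gt0.
move=> n; set N : R := n.+1%:R.
have N1 : 1 <= N by rewrite /N ler1n.
have N0 : 0 < N by lra.
have N00 : 0 <= N by lra.
have Nn0 : N != 0 by rewrite gt_eqF.
pose x := N `^ (tau / 2).
have x1 : 1 <= x by rewrite -(powRr0 N); apply: ler_powR => //; lra.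
pose r := (Num.truncn x).+1.
have xr : x <= r%:R by rewrite ltW// truncnS_gt.
have rx : r%:R <= 2 * x.
  have : (Num.truncn x)%:R <= x by rewrite truncn_le; lra.
  rewrite /r -natr1; lra.
pose e := (trunc_log 2 n.+1).+1.
have Ne : N <= 2 ^+ e by rewrite -natrX ler_nat ltnW// trunc_log_ltn.
have eN : e%:R <= A * N `^ a.
  have h1 : (2 ^+ (trunc_log 2 n.+1))%R <= N by rewrite -natrX ler_nat trunc_logP.
  have h2 : (2 `^ a) ^+ trunc_log 2 n.+1 <= N `^ a.
    rewrite -powR_mulrn ?powR_ge0// powRAC powR_mulrn//.
    by apply: ge0_ler_powR => //; rewrite ?nnegrE ?exprn_ge0// ltW.
  have h3 := bernoulli_ge (trunc_log 2 n.+1) (ltW eta0).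
  have etaE : 1 + eta = 2 `^ a by rewrite /eta; lra.
  rewrite etaE in h3.
  have h4 : (trunc_log 2 n.+1)%:R * eta <= N `^ a by lra.
  rewrite /e -natr1 /A mulrDl mul1r; apply: lerD.
    by rewrite mulrC -ler_pdivrMr ?invr_gt0// invrK.
  by rewrite -(powRr0 N); apply: ler_powR => //; lra.
have xpos : 0 < x by lra.
exists r, e; split => //.
- by rewrite powRN lef_pV2// posrE ltr0n.
- rewrite powRN lef_pV2 ?posrE ?exprn_gt0//; apply: le_trans Ne.
  apply: ler1_powR => //.
  have : 0 < tau * (d%:R / 2) by rewrite mulr_gt0// divr_gt0.
  by lra.
have Na1 : 1 <= N `^ a by rewrite -(powRr0 N); apply: ler_powR => //; lra.
have card_le : ((2 * (r * e).+1)%N)%:R <= 8 * A * (x * N `^ a) :> R.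
  have : (1 : R) <= r%:R * e%:R by rewrite -natrM ler1n muln_gt0.
  have : r%:R * e%:R <= (2 * x) * (A * N `^ a) by rewrite ler_pM.
  rewrite natrM -[(r * e).+1%:R]natr1 natrM; lra.
have h1 : (1 : R) <= ((2 * (r * e).+1) ^ d)%:R by rewrite ler1n expn_gt0.
have h2 : ((2 * (r * e).+1) ^ d)%:R <= (8 * A) ^+ d * (N * N `^ (- tau)).
  rewrite natrX; apply: (@le_trans _ _ ((8 * A * (x * N `^ a)) ^+ d)).
    apply: lerXn2r; rewrite ?nnegrE//; apply: mulr_ge0.
      by apply: mulr_ge0 => //; exact: ltW.
    by apply: mulr_ge0; [exact: ltW|exact: powR_ge0].
  have A80 : 0 <= (8 * A) ^+ d by apply: exprn_ge0; apply: mulr_ge0 => //; exact: ltW.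
  rewrite exprMn; apply: ler_wpM2l => //.
  rewrite -powRD; last by rewrite Nn0 implybT.
  rewrite -powR_mulrn ?powR_ge0// -powRrM -{2}(powRr1 N00) -powRD; last by rewrite Nn0 implybT.
  apply: ler_powR => //; rewrite /a le_eqVlt; apply/orP; left; apply/eqP; field.
  by rewrite gt_eqF.
have : N^-1 * (1 + ((2 * (r * e).+1) ^ d)%:R) <= N^-1 * (2 * ((8 * A) ^+ d * (N * N `^ (- tau)))).
  by rewrite ler_wpM2l ?invr_ge0//; lra.
move=> /le_trans; apply.
have -> : N^-1 * (2 * ((8 * A) ^+ d * (N * N `^ (- tau)))) =
    (N^-1 * N) * (2 * (8 * A) ^+ d * N `^ (- tau)) by ring.
by rewrite mulVf ?gt_eqF// mul1r.
Qed.

(** For a quantizer of mesh about N^(-tau/2), both the distance to the centres of the cells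
    and the sampling error on the masses of the cells are of that order in mean square; the
    bound q does not depend on the test function. *)
Lemma empirical_rate (d : nat) (tau : R) (m : probability 'rV[R]_d R) :
  (0 < d)%N -> 0 < tau -> tau * (1 + d%:R / 2) < 1 -> L2 m enorm ->
  exists K : R, 0 < K /\
  forall (n : nat) (dO : measure_display) (Omega : measurableType dO)
    (Pr : probability Omega R) (X : 'I_n.+1 -> Omega -> 'rV[R]_d)
    (G : 'I_n.+1 -> set (set Omega)),
  (forall i, G i `<=` measurable) -> (forall i, sub_measurable (G i) (X i)) ->
  (forall i, eq_law (pushforward Pr (X i)) m) ->
  (forall i j B A, i != j -> <<s G i >> B -> measurable A ->
     Pr (B `&` X j @^-1` A) = (Pr B * Pr (X j @^-1` A))%E) ->
  exists q : Omega -> R,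
  [/\ L2 Pr q, forall w, 0 <= q w,
      Ex Pr (fun w => q w ^+ 2) <= K * n.+1%:R `^ (- tau) &
      forall phi L, 0 <= L -> (forall x y, `|phi x - phi y| <= L * enorm (x - y)) ->
      forall w, `|n.+1%:R^-1 * (\sum_j phi (X j w)) - Ex m phi| <= L * q w].
Proof.
move=> d0 tau0 tau1 mom.
have [K [K0 HK]] := grid_choice d0 tau0 tau1.
pose M2 := Ex m (fun x => enorm x ^+ 2).
have M20 : 0 <= M2 by apply: Ex_ge0 => x; exact: sqr_ge0.
have L2one : L2 m (fun x => 1 + enorm x) by apply: L2D => //; exact: L2_cst.
have L1one := L2_L1 L2one; have L1sq := L2_sqr L2one.
pose A := Ex m (fun x => (1 + enorm x) ^+ 2).
have A1 : Ex m (fun x => 1 + enorm x) <= A.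
  by apply: Ex_le => // x; have := enorm_ge0 x; nra.
have A0 : 0 <= A by apply: Ex_ge0 => x; exact: sqr_ge0.
pose K' := 3 * (K * M2 + 8 * d%:R ^+ 2 * A ^+ 2) + 1.
have d20 : 0 <= 8 * (d%:R : R) ^+ 2 * A ^+ 2 by rewrite !mulr_ge0// sqr_ge0.
exists K'; split.
  have : 0 <= K * M2 by rewrite mulr_ge0// ltW.
  by rewrite /K'; lra.
move=> n dO Omega Pr X G hG mX lawX indX.
have [r [e [r0 hr he hc]]] := HK n.
have [J [cell [rep [mcell cardJ rep_le dist_le dist_le2]]]] := @quantizer R d r e r0.
exists (discrepancy X cell rep (m := m)); split.
- exact: (L2_discrepancy hG mX lawX mom).
- exact: discrepancy_ge0.
- apply: le_trans (discrepancy_sqr hG mX lawX indX mom mcell rep_le dist_le) _.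
  rewrite cardJ -/M2.
  set z := n.+1%:R `^ (- (tau / 2)) in hr he *.
  have z0 : 0 <= z by exact: powR_ge0.
  have zz : n.+1%:R `^ (- tau) = z ^+ 2.
    rewrite /z -powR_mulrn ?powR_ge0// -powRrM; congr (_ `^ _); lra.
  have hpsi : Ex m (fun x => enorm (x - rep (cell x))) <= d%:R * (2 * z * A).
    have hi : 0 <= (2 ^+ e)^-1 :> R by rewrite invr_ge0 exprn_ge0.
    have hri : 0 <= r%:R^-1 :> R by rewrite invr_ge0.
    have L1b : L1 m (fun x => r%:R^-1 * (1 + enorm x) + (2 ^+ e)^-1 * (1 + enorm x) ^+ 2).
      by apply: L1D; exact: L1Z.
    apply: (@le_trans _ _ (Ex m (fun x =>
        d%:R * (r%:R^-1 * (1 + enorm x) + (2 ^+ e)^-1 * (1 + enorm x) ^+ 2)))).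
      apply: Ex_le; last by move=> x; rewrite [(2 ^+ e)^-1 * _]mulrC.
        apply: L2_L1; exact: (L2_cell_dist mom mcell dist_le).
      exact: L1Z.
    rewrite ExZ// ler_wpM2l// ExD; [|exact: L1Z|exact: L1Z].
    rewrite !ExZ// -/A.
    have h1 : r%:R^-1 * Ex m (fun x => 1 + enorm x) <= z * A.
      by apply: ler_pM => //; apply: Ex_ge0 => x; rewrite addr_ge0// enorm_ge0.
    have h2 : (2 ^+ e)^-1 * A <= z * A by rewrite ler_wpM2r.
    by lra.
  have hp0 : 0 <= Ex m (fun x => enorm (x - rep (cell x))).
    by apply: Ex_ge0 => x; exact: enorm_ge0.
  have hp2 : Ex m (fun x => enorm (x - rep (cell x))) ^+ 2 <= (d%:R * (2 * z * A)) ^+ 2.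
    by rewrite ler_sqr ?nnegrE// !mulr_ge0.
  rewrite (_ : (d%:R * (2 * z * A)) ^+ 2 = 4 * d%:R ^+ 2 * A ^+ 2 * z ^+ 2) in hp2; last by ring.
  have hc2 := ler_wpM2r M20 hc.
  have z20 : 0 <= z ^+ 2 by exact: sqr_ge0.
  move: hc2; rewrite zz /K'; set Q := _ * (1 + _) * M2 => hc2; lra.
- by move=> phi L L0 hphi w; exact: discrepancy_lip.
Qed.

End rate.

(** * Densities, and Lipschitz regularity of the coupling *)

Section change_of_density.
Context {d : measure_display} {E : measurableType d} {R : realType}.
Variable nu : probability E R.

Lemma density_probability (Z : E -> R) : measurable_fun setT Z -> (forall x, 0 <= Z x) ->
  (\int[nu]_x (Z x)%:E = 1)%E ->
  exists q : probability E R, eq_law q (fun A => \int[nu]_(x in A) (Z x)%:E)%E.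
Proof.
move=> mZ Z0 Z1.
pose f (A : set E) := (\int[nu]_(x in A) (Z x)%:E)%E.
have f0 : f set0 = 0%E by rewrite /f integral_set0.
have fge0 A : (0 <= f A)%E by apply: integral_ge0 => x _; rewrite lee_fin.
have fsa : semi_sigma_additive f.
  apply: semi_sigma_additive_nng_induced; first exact/measurable_EFinP.
  by move=> x; rewrite lee_fin.
pose q0 : {measure set E -> \bar R} := HB.pack f (isMeasure.Build _ _ _ f f0 fge0 fsa).
have q01 : q0 setT = 1%E by [].
pose q : probability E R := HB.pack f (Measure.class q0) (Measure_isProbability.Build _ _ _ q0 q01).
by exists q.
Qed.

Variables (Z : E -> R) (q : probability E R).
Hypothesis mZ : measurable_fun setT Z.
Hypothesis Z0 : {ae nu, forall x, 0 <= Z x}.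
Hypothesis qE : eq_law q (fun A => \int[nu]_(x in A) (Z x)%:E)%E.

Let qnu : q `<< nu.
Proof.
apply/null_content_dominatesP => A mA nuA; rewrite qE//.
by apply: null_set_integral => //; apply: measurable_funTS; exact/measurable_EFinP.
Qed.

(** The density agrees almost everywhere with the Radon-Nikodym derivative. *)
Lemma density_integral (f : E -> R) : measurable_fun setT f -> (forall x, 0 <= f x) ->
  (\int[q]_x (f x)%:E = \int[nu]_x (f x * Z x)%:E)%E.
Proof.
move=> mf f0.
rewrite -(Radon_Nikodym_SigmaFinite.change_of_variables qnu)//; last exact/measurable_EFinP.
have intg := Radon_Nikodym_SigmaFinite.f_integrable qnu.
apply: ae_eq_integral => //.
- apply: emeasurable_funM; first exact/measurable_EFinP.
  exact: measurable_int intg.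
- by apply/measurable_EFinP; exact: measurable_funM.
have : ae_eq nu setT (Radon_Nikodym_SigmaFinite.f q nu) (EFin \o Z).
  apply: integral_ae_eq => //; first exact/measurable_EFinP.
  move=> A _ mA; transitivity (q A); last exact: qE.
  by rewrite -Radon_Nikodym_SigmaFinite.f_integral.
by apply: filterS => x /(_ I) -> _; rewrite EFinM.
Qed.

Lemma L1_density (f : E -> R) : measurable_fun setT f -> L1 nu (fun x => f x * Z x) -> L1 q f.
Proof.
move=> mf hf; apply: L1_finite => //.
rewrite (density_integral (f := fun x => `|f x|))//; last exact: measurableT_comp.
have <- : (\int[nu]_x `|(f x * Z x)%:E| = \int[nu]_x (`|f x| * Z x)%:E)%E.
  apply: ae_eq_integral => //.
  - by apply/measurableT_comp => //; exact: measurable_int hf.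
  - by apply/measurable_EFinP; apply: measurable_funM => //; exact: measurableT_comp.
  - by apply: filterS Z0 => x z0 _ /=; rewrite normrM (ger0_norm z0).
by have /integrableP[] := hf.
Qed.

Lemma Ex_density (f : E -> R) : measurable_fun setT f -> L1 nu (fun x => f x * Z x) ->
  Ex q f = Ex nu (fun x => f x * Z x).
Proof.
move=> mf hf; have hq := L1_density mf hf.
have mfa : measurable_fun setT (fun x => `|f x|) by exact: measurableT_comp.
have hfa : L1 nu (fun x => `|f x| * Z x).
  apply: L1_eq_ae (L1_norm hf); first exact: measurable_funM.
  by apply: filterS Z0 => x z0; rewrite normrM (ger0_norm z0).
have nn (g : E -> R) : measurable_fun setT g -> (forall x, 0 <= g x) ->
    Ex q g = Ex nu (fun x => g x * Z x).
  by move=> mg g0; congr fine; exact: density_integral.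
have E1 : Ex q (fun x => `|f x| + f x) = Ex nu (fun x => (`|f x| + f x) * Z x).
  apply: nn; first exact: measurable_funD.
  by move=> x; have := ler_norm (- f x); rewrite normrN; lra.
have E2 : Ex q (fun x => `|f x|) = Ex nu (fun x => `|f x| * Z x) by exact: nn.
have : Ex nu (fun x => (`|f x| + f x) * Z x) =
   Ex nu (fun x => `|f x| * Z x) + Ex nu (fun x => f x * Z x).
  by rewrite -ExD//; apply: Ex_ext => x; rewrite mulrDl.
by move: E1; rewrite ExD//; [lra|exact: L1_norm].
Qed.

End change_of_density.

Section lipschitz_costs.
Context {R : realType} {d T : nat} (D : mfg_data R d T) (C : R).
Local Notation V := 'rV[R]_d.
Hypotheses (hwf : well_formed_data D) (C0 : 0 < C) (hass : standing_assumptions D C).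

Definition elip (L : R) (v : V -> R) := forall x y, `|v x - v y| <= L * enorm (x - y).

Lemma elip_meas L v : elip L v -> measurable_fun setT v.
Proof. by move=> hv; apply: (@measurable_fun_elip _ _ _ _ id v L). Qed.

Lemma L2_enorm k (m : probability 'rV[R]_k R) : finite_moment 2 m -> L2 m enorm.
Proof.
move=> hm; split; first exact: (@measurable_enorm _ _ _ _ id).
apply: L1_finite; first by apply: measurable_funX; exact: (@measurable_enorm _ _ _ _ id).
by under eq_integral do rewrite /= ger0_norm ?sqr_ge0//.
Qed.

Lemma L2_noise t : (t < T)%N -> L2 (noise D t) enorm.
Proof. by move=> tT; apply: L2_enorm; exact: noise_moment. Qed.

(** A convex function of linear growth is Lipschitz: the slope in a given direction is at
    most the asymptotic slope. *)
Lemma cpl_lip t b : (t <= T)%N -> B2 b -> elip C (cpl D t ^~ b).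
Proof.
move=> tT hb.
have [cf gf] := cpl_Q1 hass tT hb.
have half x y : cpl D t y b - cpl D t x b <= C * enorm (y - x).
  apply/ler_addgt0Pr => e e0.
  pose A := C * (2 + enorm x); have A0 : 0 < A.
    by rewrite mulr_gt0//; have := enorm_ge0 x; lra.
  (* y is a convex combination of x and of a far point z in the same direction *)
  pose s := 1 + A / e; have s1 : 1 <= s by rewrite lerDl divr_ge0// ltW.
  have s0 : 0 < s by lra.
  have si : 0 <= s^-1 <= 1 by rewrite invr_ge0 ltW//= invf_le1.
  pose z := x + s *: (y - x).
  have zy : y = (1 - s^-1) *: x + s^-1 *: z.
    by apply/rowP => i; rewrite /z !mxE; field; rewrite gt_eqF.
  have cv : cpl D t y b <= (1 - s^-1) * cpl D t x b + s^-1 * cpl D t z b.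
    have si' : (0 <= 1 - s^-1 <= 1)%R by lra.
    have oE : unstable.onem (1 - s^-1) = s^-1 :> R by rewrite /unstable.onem; lra.
    have := cf (Itv01 (proj1 (andP si')) (proj2 (andP si'))) x z (mem_setT _) (mem_setT _).
    rewrite /conv/= oE -zy => H; apply: le_trans H _.
    change ((1 - s^-1) * cpl D t x b + unstable.onem (1 - s^-1) * cpl D t z b <=
            (1 - s^-1) * cpl D t x b + s^-1 * cpl D t z b).
    by rewrite oE.
  have /andP[lx _] := gf x; have /andP[_ uz] := gf z; rewrite expr1 in uz.
  have nz : enorm z <= enorm x + s * enorm (y - x).
    by apply: le_trans (enormD _ _) _; rewrite enormZ gtr0_norm.
  have uz' : cpl D t z b <= C * (1 + enorm x + s * enorm (y - x)).
    by apply: le_trans uz _; apply: ler_wpM2l; [exact: ltW|lra].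
  have : s^-1 * (cpl D t z b - cpl D t x b) <= s^-1 * (A + s * (C * enorm (y - x))).
    by apply: ler_wpM2l; [rewrite invr_ge0 ltW|rewrite /A; lra].
  rewrite [s^-1 * (A + _)]mulrDr mulKf ?gt_eqF//.
  have : s^-1 * A <= e.
    by rewrite ler_pdivrMl// /s mulrDl mul1r divfK ?gt_eqF// lerDr ltW.
  by lra.
move=> x y; rewrite ler_norml; have := half x y; have := half y x.
by rewrite (enorm_distC y x); lra.
Qed.

Lemma growth_normP (f : V -> R) p (c : R) : (growth_norm Num.norm p f <= c%:E)%E ->
  forall x, `|f x| <= c * (1 + enorm x ^+ p).
Proof.
move=> h x; rewrite -ler_pdivrMr ?ltr_wpDr ?exprn_ge0 ?enorm_ge0//.
by rewrite -lee_fin; apply: le_trans h; apply: ereal_sup_ubound; exists x.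
Qed.

Lemma cpl_dist t b c x (delta : R) : (t <= T)%N -> B2 b -> B2 c ->
  (d1_flow b c <= delta%:E)%E ->
  `|cpl D t x b - cpl D t x c| <= C * delta * (1 + enorm x).
Proof.
move=> tT hb hc bc.
have h : (growth_norm Num.norm 1 (fun x => cpl D t x b - cpl D t x c)%R <= (C * delta)%:E)%E.
  apply: le_trans (cpl_Lip1 hass tT hb hc) _.
  by rewrite EFinM lee_wpmul2l// lee_fin ltW.
by have := growth_normP h x; rewrite expr1.
Qed.

Lemma price_dist t b c (delta : R) : (t < T)%N -> B2 b -> B2 c ->
  (d1_flow b c <= delta%:E)%E -> enorm (price D t b - price D t c) <= C * delta.
Proof.
move=> tT hb hc bc; rewrite -lee_fin EFinM.
by apply: le_trans (price_Lip hass tT hb hc) _; rewrite lee_wpmul2l// lee_fin ltW.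
Qed.

End lipschitz_costs.

(** * Dynamic programming *)

Section dynamic_programming.
Context {R : realType} {d T : nat} (D : mfg_data R d T) (C : R).
Local Notation V := 'rV[R]_d.
Hypotheses (hwf : well_formed_data D) (C0 : 0 < C) (hass : standing_assumptions D C).

(** The operator of the dynamic programming equation, [worst], is a supremum over densities
    instead of probabilities, as in the definition of [rho]. *)
Definition payoff t (v : V -> R) (z : V) (Z : V -> R) : R :=
  Ex (noise D t) (fun y => v (z + y) * Z y).

Definition worst t (v : V -> R) (z : V) : R := sup [set payoff t v z Z | Z in dens D t].

Section one_step.
Variables (t : nat) (v : V -> R) (L : R).
Hypotheses (tT : (t < T)%N) (vL : elip L v) (L0 : 0 <= L).

Let nu := noise D t.

Lemma elip_growth z : `|v z| <= `|v 0| + L * enorm z.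
Proof.
have := vL z 0; rewrite subr0; have := ler_normD (v z - v 0) (v 0); rewrite subrK; lra.
Qed.

Lemma shift_meas (z : V) : measurable_fun setT (fun y => v (z + y)).
Proof.
apply: (@measurable_fun_elip _ _ _ _ (fun y => z + y) v L) => //.
by apply: measurable_rVD; [exact: measurable_cst|exact: measurable_id].
Qed.

Let envelope (z y : V) : R := C * (`|v 0| + L * enorm z + L * enorm y).

Let envelope_L1 z : L1 nu (envelope z).
Proof.
by apply: L1Z; apply: L1D; [exact: L1_cst|apply: L1Z; apply: L2_L1; exact: L2_noise].
Qed.

Let envelope_ge Z z : dens D t Z -> {ae nu, forall y, `|v (z + y) * Z y| <= envelope z y}.
Proof.
move=> DZ; apply: filterS (dens_bounds hwf hass tT DZ) => y /andP[z0 zC].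
rewrite normrM (ger0_norm z0) mulrC /envelope.
apply: ler_pM => //; apply: le_trans (elip_growth _) _.
rewrite -addrA lerD2l -mulrDr ler_wpM2l//; exact: enormD.
Qed.

Lemma L1_payoff Z (z : V) : dens D t Z -> L1 nu (fun y => v (z + y) * Z y).
Proof.
move=> DZ; apply: (L1_le_ae _ (envelope_ge z DZ) (envelope_L1 z)).
have mZ := dens_measurable hwf tT DZ.
apply: measurable_funM; first exact: shift_meas.
exact: mZ.
Qed.

Lemma L1_density_fun Z : dens D t Z -> L1 nu Z.
Proof.
move=> DZ; apply: (L1_le_ae (dens_measurable hwf tT DZ) _ (L1_cst nu C)).
by apply: filterS (dens_bounds hwf hass tT DZ) => y /andP[z0 zC]; rewrite ger0_norm.
Qed.

Lemma Ex_density_fun Z : dens D t Z -> Ex nu Z = 1.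
Proof. by move=> DZ; rewrite /Ex (dens_int1 hwf tT DZ). Qed.

Lemma payoff_lip (Z : V -> R) : dens D t Z -> elip L (payoff t v ^~ Z).
Proof.
move=> DZ z z'; have L1Z' := L1_density_fun DZ.
rewrite /payoff -ExB; try exact: L1_payoff.
apply: le_trans (Ex_norm _) _; first by apply: L1B; exact: L1_payoff.
apply: (@le_trans _ _ (Ex nu (fun y => L * enorm (z - z') * Z y))); last first.
  by rewrite ExZ// Ex_density_fun// mulr1.
apply: Ex_le_ae.
- by apply: L1_norm; apply: L1B; exact: L1_payoff.
- exact: L1Z.
apply: filterS (dens_bounds hwf hass tT DZ) => y /andP[z0 _].
rewrite -mulrBl normrM (ger0_norm z0) ler_wpM2r//.
by apply: le_trans (vL _ _) _; rewrite opprD addrACA subrr addr0.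
Qed.

Let payoffs_ub z : has_ubound [set payoff t v z Z | Z in dens D t].
Proof.
exists (Ex nu (envelope z)) => _ [Z DZ <-]; apply: Ex_le_ae => //; first exact: L1_payoff.
by apply: filterS (envelope_ge z DZ) => y; apply: le_trans (ler_norm _).
Qed.

Let payoffs_ne z : [set payoff t v z Z | Z in dens D t] !=set0.
Proof. by have [Z DZ] := dens_nonempty hwf tT; exists (payoff t v z Z); exists Z. Qed.

Lemma worst_ge Z z : dens D t Z -> payoff t v z Z <= worst t v z.
Proof. by move=> DZ; apply: ub_le_sup => //; exists Z. Qed.

Lemma worst_le z c : (forall Z, dens D t Z -> payoff t v z Z <= c) -> worst t v z <= c.
Proof. by move=> H; apply: ge_sup => // _ [Z DZ <-]; exact: H. Qed.

Lemma worst_adherent z e : 0 < e ->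
  exists2 Z, dens D t Z & worst t v z - e < payoff t v z Z.
Proof.
move=> e0; have hs : has_sup [set payoff t v z Z | Z in dens D t] by split.
by have [_ [Z DZ <-] h] := sup_adherent e0 hs; exists Z.
Qed.

Lemma worst_lip : elip L (worst t v).
Proof.
have half z z' : worst t v z <= worst t v z' + L * enorm (z - z').
  apply: worst_le => Z DZ; have := payoff_lip DZ z z'; have := worst_ge z' DZ.
  by rewrite ler_norml; lra.
move=> z z'; have := half z z'; have := half z' z.
by rewrite (enorm_distC z' z) ler_norml; lra.
Qed.

(** A density is nonnegative only almost everywhere; its positive part defines the
    probability with that density. *)
Lemma worstE z :
  ereal_sup [set \int[q]_y (v (z + y)%R)%:E | q in ambiguity D t]%E = (worst t v z)%:E.
Proof.
rewrite /worst -ereal_sup_EFin//; congr ereal_sup; apply/seteqP; split.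
  move=> _ [q [Z DZ qZ] <-]; exists (payoff t v z Z); first by exists Z.
  have mZ := dens_measurable hwf tT DZ.
  have Z0 : {ae nu, forall x, 0 <= Z x}.
    by apply: filterS (dens_bounds hwf hass tT DZ) => y /andP[].
  have h1 := L1_payoff z DZ; have ms := shift_meas z.
  have hq := L1_density mZ Z0 qZ ms h1.
  by rewrite ExE// (Ex_density mZ Z0 qZ).
move=> _ [_ [Z DZ <-] <-].
have mZ := dens_measurable hwf tT DZ.
have Z0 : {ae nu, forall x, 0 <= Z x}.
  by apply: filterS (dens_bounds hwf hass tT DZ) => y /andP[].
pose Zp y := Num.max (Z y) 0.
have mZp : measurable_fun setT Zp by apply: measurable_maxr => //; exact: measurable_cst.
have ZZp : {ae nu, forall y, Zp y = Z y}.
  by apply: filterS Z0 => y z0; rewrite /Zp max_l.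
have intE A : measurable A -> (\int[nu]_(x in A) (Zp x)%:E = \int[nu]_(x in A) (Z x)%:E)%E.
  move=> mA; apply: ae_eq_integral => //.
  - by apply: measurable_funTS; exact/measurable_EFinP.
  - by apply: measurable_funTS; exact/measurable_EFinP.
  - by apply: filterS ZZp => y -> _.
have Zp0 y : 0 <= Zp y by rewrite le_max lexx orbT.
have Zp1 : (\int[nu]_x (Zp x)%:E = 1)%E by rewrite intE//; exact: (dens_int1 hwf tT DZ).
have [q qZp] := density_probability mZp Zp0 Zp1.
have qZ : eq_law q (fun A => \int[nu]_(x in A) (Z x)%:E)%E.
  by move=> A mA; rewrite qZp// intE.
exists q; first by exists Z.
have h1 := L1_payoff z DZ; have ms := shift_meas z.
have hq := L1_density mZ Z0 qZ ms h1.
by rewrite ExE// (Ex_density mZ Z0 qZ).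
Qed.

End one_step.

Variables (u : nat -> V -> R) (alpha : nat -> V -> V) (m : nat -> probability V R).
Variables (mu : nat -> probability 'rV[R]_(d + d) R) (b : flow R d T).
Hypothesis hsol : mfg_solution D u alpha m mu b.

Let lipc t : R := (T - t).+1%:R * C.

Let lipc_ge0 t : 0 <= lipc t. Proof. by rewrite mulr_ge0// ltW. Qed.

Let bellmanE t x a : (t < T)%N -> elip (lipc t.+1) (u t.+1) ->
  bellman D t (u t.+1) b x a = (ell D t x a b + worst t (u t.+1) (x + a))%:E.
Proof. by move=> tT uL; rewrite /bellman (worstE tT uL (lipc_ge0 _)) -EFinD. Qed.

Let value_step_le t x a : (t < T)%N -> elip (lipc t.+1) (u t.+1) ->
  u t x <= ell D t x a b + worst t (u t.+1) (x + a).
Proof.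
move=> tT uL; rewrite -lee_fin (sol_u hsol x tT) -bellmanE//.
by apply: ereal_inf_lbound; exists a.
Qed.

Let value_step_eq t x : (t < T)%N -> elip (lipc t.+1) (u t.+1) ->
  u t x = ell D t x (alpha t x) b + worst t (u t.+1) (x + alpha t x).
Proof.
move=> tT uL; apply/eqP; rewrite eq_le value_step_le//=.
rewrite -lee_fin -bellmanE// (sol_u hsol x tT); apply: le_ereal_inf_tmp => _ [a _ <-].
exact: (sol_alpha_min hsol x a tT).
Qed.

(** Lipschitz continuity goes backwards in time: the infimum over the action of functions
    of x sharing a Lipschitz constant has that Lipschitz constant. *)
Lemma value_lip t : (t <= T)%N -> elip (lipc t) (u t).
Proof.
move=> tT; have [k kE] : exists k, k = (T - t)%N by exists (T - t)%N.
elim: k t tT kE => [|k IH] t tT kE.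
  have -> : t = T by apply/eqP; rewrite eqn_leq tT -subn_eq0 -kE.
  move=> x y; rewrite !(sol_u_final hsol) /lipc subnn mul1r.
  exact: (cpl_lip C0 hass (leqnn T) (sol_b_B2 hsol)).
have tT' : (t < T)%N by rewrite -subn_gt0 -kE.
have uL : elip (lipc t.+1) (u t.+1) by apply: IH => //; rewrite subnS -kE.
have wL := worst_lip tT' uL (lipc_ge0 t.+1).
have cL := cpl_lip C0 hass tT (sol_b_B2 hsol).
have half x y : u t x <= u t y + lipc t * enorm (x - y).
  rewrite (value_step_eq y tT' uL).
  apply: le_trans (value_step_le x (alpha t y) tT' uL) _.
  have := wL (x + alpha t y) (y + alpha t y).
  rewrite opprD addrACA subrr addr0 => h1; have := cL x y.
  have -> : lipc t = lipc t.+1 + C.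
    by rewrite /lipc subnS -kE/= -[k.+2%:R]natr1 mulrDl mul1r.
  move: h1; rewrite !ler_norml /ell; lra.
move=> x y; have := half x y; have := half y x.
by rewrite (enorm_distC y x) ler_norml; lra.
Qed.

Lemma value_le t x a : (t < T)%N -> u t x <= ell D t x a b + worst t (u t.+1) (x + a).
Proof. by move=> tT; apply: value_step_le => //; exact: value_lip. Qed.

Lemma value_eq t x : (t < T)%N ->
  u t x = ell D t x (alpha t x) b + worst t (u t.+1) (x + alpha t x).
Proof. by move=> tT; apply: value_step_eq => //; exact: value_lip. Qed.

End dynamic_programming.

(** * Flows of empirical measures *)

Section empirical_integral.
Context {R : realType} {dT : measure_display} {E : measurableType dT} {n : nat}.
Variable x : 'I_n.+1 -> E.
Local Notation N := (n.+1%:R : R).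

Let emp : probability E R := empirical x.

Lemma ge0_integral_empirical (f : E -> R) : measurable_fun setT f -> (forall y, 0 <= f y) ->
  (\int[emp]_y (f y)%:E = (N^-1 * \sum_j f (x j))%:E)%E.
Proof.
move=> mf f0; have mEf : measurable_fun setT (EFin \o f) by exact/measurable_EFinP.
have empE : emp = mscale (N^-1)%:nng (msum (fun k => \d_(x (inord k))) n.+1) :> (set E -> \bar R).
  apply/funext => A; rewrite /emp/= /empirical /mscale /msum/=; congr (_ * _)%E.
  by apply: eq_bigr => i _; rewrite inord_val.
rewrite empE ge0_integral_mscale//; last by move=> y _; rewrite lee_fin.
rewrite ge0_integral_measure_sum//; last by move=> y _; rewrite lee_fin.
rewrite /= EFinM -sumEFin; congr (_ * _)%E; apply: eq_bigr => i _.
by rewrite integral_dirac// diracT mul1e /= inord_val.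
Qed.

Lemma L1_empirical (f : E -> R) : measurable_fun setT f -> L1 emp f.
Proof.
move=> mf; apply: L1_finite => //.
by rewrite (ge0_integral_empirical (f := fun y => `|f y|)) ?ltry//; exact: measurableT_comp.
Qed.

Lemma Ex_empirical (f : E -> R) : measurable_fun setT f -> Ex emp f = N^-1 * \sum_j f (x j).
Proof.
move=> mf; have mfa : measurable_fun setT (fun y => `|f y|) by exact: measurableT_comp.
have ge0 (g : E -> R) : measurable_fun setT g -> (forall y, 0 <= g y) ->
    Ex emp g = N^-1 * \sum_j g (x j).
  by move=> mg g0; rewrite /Ex ge0_integral_empirical.
have h1 := ge0 _ mfa (fun y => normr_ge0 (f y)).
have h2 : Ex emp (fun y => `|f y| + f y) = N^-1 * \sum_j (`|f (x j)| + f (x j)).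
  apply: ge0; first exact: measurable_funD.
  by move=> y; have := ler_norm (- f y); rewrite normrN; lra.
move: h2; rewrite ExD; [|exact: L1_empirical|exact: L1_empirical].
by rewrite h1 big_split/= mulrDr => /addrI.
Qed.

End empirical_integral.

Section flows.
Context {R : realType} {d T n : nat}.
Local Notation V := 'rV[R]_d.
Local Notation N := (n.+1%:R : R).

Lemma lip1_elip k (phi : 'rV[R]_k -> R) : lip1 Num.norm phi -> elip 1 phi.
Proof. by move=> h x y; rewrite mul1r. Qed.

Lemma elip_L1 k (m : probability 'rV[R]_k R) L phi : L2 m enorm -> 0 <= L -> elip L phi -> L1 m phi.
Proof.
move=> hm L0 hphi; apply: (@L1_le _ _ _ _ _ (fun x => `|phi 0| + L * enorm x)).
- exact: elip_meas hphi.
- by move=> x; exact: elip_growth hphi x.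
- by apply: L1D; [exact: L1_cst|apply: L1Z; exact: L2_L1].
Qed.

Lemma d1_le k (mu nu : probability 'rV[R]_k R) (delta : R) :
  (forall phi, lip1 Num.norm phi -> [/\ L1 mu phi, L1 nu phi & Ex mu phi - Ex nu phi <= delta]) ->
  (d1 mu nu <= delta%:E)%E.
Proof.
move=> H; apply: ge_ereal_sup => _ [phi lphi <-].
by have [h1 h2 h3] := H phi lphi; rewrite (ExE h1) (ExE h2) -EFinB lee_fin.
Qed.

(** Deterministic counterpart of [empirical_flow], in which the points can be moved. *)
Definition point_flow (xs acts : 'I_n.+1 -> nat -> V) : flow R d T :=
  (fun t : 'I_T => empirical (fun j => row_mx (xs j t) (acts j t)) : probability 'rV[R]_(d + d) R,
   empirical (fun j => xs j T) : probability V R).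

Lemma empirical_moment k (x : 'I_n.+1 -> 'rV[R]_k) :
  finite_moment 2 (empirical x : probability 'rV[R]_k R).
Proof.
rewrite /finite_moment/= /moment ge0_integral_empirical; first exact: ltry.
- by apply: measurable_funX; exact: (@measurable_enorm _ _ _ _ id).
- by move=> y; exact: sqr_ge0.
Qed.

Lemma point_flow_B2 xs acts : B2 (point_flow xs acts).
Proof. by split=> [t|]; exact: empirical_moment. Qed.

Lemma d1_flow_le (b c : flow R d T) (delta : 'I_T -> R) (deltaT : R) :
  (forall t, d1 (b.1 t) (c.1 t) <= (delta t)%:E)%E -> (d1 b.2 c.2 <= deltaT%:E)%E ->
  (d1_flow b c <= (\sum_t delta t + deltaT)%:E)%E.
Proof.
by move=> h hT; rewrite /d1_flow EFinD -sumEFin; apply: leeD => //; apply: lee_sum => t _.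
Qed.

Definition gap (xs ys acts bs : 'I_n.+1 -> nat -> V) t : R :=
  N^-1 * \sum_j (enorm (xs j t - ys j t) + enorm (acts j t - bs j t)).

Definition gapT (xs ys : 'I_n.+1 -> nat -> V) : R := N^-1 * \sum_j enorm (xs j T - ys j T).

Lemma mean_lip k (phi : 'rV[R]_k -> R) (x y : 'I_n.+1 -> 'rV[R]_k) (e : 'I_n.+1 -> R) :
  lip1 Num.norm phi -> (forall j, enorm (x j - y j) <= e j) ->
  N^-1 * \sum_j phi (x j) <= N^-1 * \sum_j phi (y j) + N^-1 * \sum_j e j.
Proof.
move=> lphi xye; rewrite -mulrDr ler_wpM2l ?invr_ge0// -big_split/=.
apply: ler_sum => j _; have := lphi (x j) (y j); have := xye j; rewrite ler_norml.
by move=> h1 /andP[_ h2]; lra.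
Qed.

(** Moving each point costs at most the average displacement. *)
Lemma point_flow_dist (xs ys acts bs : 'I_n.+1 -> nat -> V) (c : flow R d T)
    (delta : 'I_T -> R) (deltaT : R) : B2 c ->
  (forall (t : 'I_T) phi, lip1 Num.norm phi ->
     N^-1 * (\sum_j phi (row_mx (ys j t) (bs j t))) - Ex (c.1 t) phi <= delta t) ->
  (forall phi, lip1 Num.norm phi -> N^-1 * (\sum_j phi (ys j T)) - Ex c.2 phi <= deltaT) ->
  (d1_flow (point_flow xs acts) c <=
    (\sum_(t < T) (gap xs ys acts bs t + delta t) + (gapT xs ys + deltaT))%:E)%E.
Proof.
move=> [hc1 hc2] h hT; apply: d1_flow_le => [t|]; apply: d1_le => phi lphi.
  have mphi := elip_meas (lip1_elip lphi).
  split; first exact: L1_empirical.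
    exact: (elip_L1 (L2_enorm (hc1 t)) ler01 (lip1_elip lphi)).
  rewrite Ex_empirical//; have := h t phi lphi.
  have := @mean_lip _ phi (fun j => row_mx (xs j t) (acts j t))
    (fun j => row_mx (ys j t) (bs j t))
    (fun j => enorm (xs j t - ys j t) + enorm (acts j t - bs j t)) lphi.
  move=> H.
  have hj j : enorm (row_mx (xs j t) (acts j t) - row_mx (ys j t) (bs j t)) <=
      enorm (xs j t - ys j t) + enorm (acts j t - bs j t).
    by rewrite opp_row_mx add_row_mx; exact: enorm_row_mx.
  have := H hj; rewrite /= /gap; set Ni := n.+1%:R^-1; lra.
have mphi := elip_meas (lip1_elip lphi).
split; first exact: L1_empirical.
  exact: (elip_L1 (L2_enorm hc2) ler01 (lip1_elip lphi)).
rewrite Ex_empirical//; have := hT phi lphi.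
have := @mean_lip _ phi (fun j => xs j T) (fun j => ys j T)
  (fun j => enorm (xs j T - ys j T)) lphi (fun j => lexx _).
by rewrite /= /gapT; set Ni := n.+1%:R^-1; lra.
Qed.

Lemma point_flow_near (xs ys acts bs : 'I_n.+1 -> nat -> V) :
  (d1_flow (point_flow xs acts) (point_flow ys bs) <=
    (\sum_(t < T) gap xs ys acts bs t + gapT xs ys)%:E)%E.
Proof.
apply: le_trans (@point_flow_dist xs ys acts bs _ (fun=> 0) 0 _ _ _) _.
- exact: point_flow_B2.
- by move=> t phi lphi; rewrite Ex_empirical ?subrr//; exact: (elip_meas (lip1_elip lphi)).
- by move=> phi lphi; rewrite Ex_empirical ?subrr//; exact: (elip_meas (lip1_elip lphi)).
by rewrite addr0; under eq_bigr do rewrite addr0.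
Qed.

(** A function of a state and of an empirical flow that is continuous for d_1 is a
    continuous function of finitely many real coordinates, hence measurable. *)
Lemma measurable_point_flow (H : V -> flow R d T -> R) (A : R)
    dS (S : measurableType dS) (x : S -> V) (xs acts : 'I_n.+1 -> nat -> S -> V) :
  0 <= A ->
  (forall x y b c (delta : R), B2 b -> B2 c -> (d1_flow c b <= delta%:E)%E ->
    `|H y c - H x b| <= A * (enorm (y - x) + (1 + enorm x) * delta)) ->
  measurable_fun setT x -> (forall j t, (t <= T)%N -> measurable_fun setT (xs j t)) ->
  (forall j t, (t < T)%N -> measurable_fun setT (acts j t)) ->
  measurable_fun setT
    (fun w => H (x w) (point_flow (fun j t => xs j t w) (fun j t => acts j t w))).
Proof.
move=> A0 HH mx mxs macts.
(* the booleans distinguish states from actions *)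
pose I : finType := ('I_d + 'I_n.+1 * 'I_T.+1 * 'I_d * bool)%type.
pose f (i : I) (w : S) : R := match i with
  | inl k => x w 0 k
  | inr (j, t, k, c) => if c then xs j t w 0 k
                        else if (t < T)%N then acts j t w 0 k else 0 end.
pose px (y : I -> R) : V := \row_k y (inl k).
pose pxs (y : I -> R) (j : 'I_n.+1) (t : nat) : V := \row_k y (inr (j, inord t, k, true)).
pose pacts (y : I -> R) (j : 'I_n.+1) (t : nat) : V := \row_k y (inr (j, inord t, k, false)).
pose g y := H (px y) (point_flow (pxs y) (pacts y)).
have -> : (fun w => H (x w) (point_flow (fun j t => xs j t w) (fun j t => acts j t w))) =
    (fun w => g (f ^~ w)).
  apply/funext => w; rewrite /g; congr H; first by apply/rowP => k; rewrite mxE.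
  have pxsE j t : (t <= T)%N -> pxs (f ^~ w) j t = xs j t w.
    by move=> tT; apply/rowP => k; rewrite mxE /= inordK.
  rewrite /point_flow; congr (_, _).
    apply/funext => t; congr empirical; apply/funext => j; rewrite pxsE ?(ltnW (ltn_ord t))//.
    congr row_mx; apply/rowP => k; rewrite mxE /= inordK ?ltn_ord//.
    by rewrite ltnS ltnW.
  by congr empirical; apply/funext => j; rewrite pxsE.
apply: measurable_fun_coords.
  move=> [k|[[[j t] k] []]]; rewrite /f.
  - exact: (measurableT_comp (@measurable_mx_coord R 1 d 0 k) mx).
  - exact: (measurableT_comp (@measurable_mx_coord R 1 d 0 k) (mxs j t (ltn_ord t))).
  - case: (ltnP t T) => [tT|_]; last exact: measurable_cst.
    exact: (measurableT_comp (@measurable_mx_coord R 1 d 0 k) (macts j t tT)).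
move=> y e e0.
pose K := A * (d%:R + (1 + enorm (px y)) * ((2 * T%:R + 1) * d%:R)).
have K0 : 0 <= K.
  by rewrite mulr_ge0// addr_ge0// mulr_ge0 ?addr_ge0 ?enorm_ge0// mulr_ge0// addr_ge0// mulr_ge0.
exists (e / (K + 1)) => [|y']; first by rewrite divr_gt0//; lra.
set r := e / (K + 1) => Hr.
have near (p q : V) : (forall k, `|p 0 k - q 0 k| <= r) -> enorm (p - q) <= d%:R * r.
  move=> h; apply: le_trans (enorm_le_sum _) _.
  have -> : d%:R * r = \sum_(k < d) r by rewrite sumr_const card_ord mulr_natl.
  apply: ler_sum => k _.
  by rewrite !mxE.
have nx : enorm (px y' - px y) <= d%:R * r by apply: near => k; rewrite !mxE ltW.
have nxs j t : enorm (pxs y' j t - pxs y j t) <= d%:R * r by apply: near => k; rewrite !mxE ltW.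
have nacts j t : enorm (pacts y' j t - pacts y j t) <= d%:R * r.
  by apply: near => k; rewrite !mxE ltW.
have mean_le (F : 'I_n.+1 -> R) c : (forall j, F j <= c) -> N^-1 * \sum_j F j <= c.
  move=> h; rewrite mulrC ler_pdivrMr ?ltr0n//.
  have -> : c * N = \sum_(j < n.+1) c by rewrite sumr_const card_ord mulr_natr.
  by apply: ler_sum.
have dl : (d1_flow (point_flow (pxs y') (pacts y')) (point_flow (pxs y) (pacts y)) <=
   ((2 * T%:R + 1) * d%:R * r)%:E)%E.
  apply: le_trans (point_flow_near _ _ _ _) _; rewrite lee_fin.
  have -> : (2 * T%:R + 1) * d%:R * r = \sum_(t < T) (2 * (d%:R * r)) + d%:R * r.
    rewrite sumr_const card_ord -[_ *+ T]mulr_natl; ring.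
  apply: lerD; last by apply: mean_le => j.
  apply: ler_sum => t _; apply: mean_le => j; have := nxs j t; have := nacts j t; lra.
apply: le_lt_trans (HH _ _ _ _ _ (point_flow_B2 _ _) (point_flow_B2 _ _) dl) _.
apply: (@le_lt_trans _ _ (K * r)).
  rewrite /K -[leRHS]mulrA; apply: ler_wpM2l => //.
  by rewrite [leRHS]mulrDl -[X in _ <= _ + X]mulrA lerD2r.
have Kr : (K + 1) * r = e by rewrite /r mulrC divfK// gt_eqF//; lra.
have r0 : 0 < r by rewrite divr_gt0//; lra.
by rewrite -Kr ltr_pM2r//; lra.
Qed.

End flows.

(** * Moments and laws of controlled trajectories *)

Section trajectories.
Context {R : realType} {d T : nat} (D : mfg_data R d T) (C : R).
Local Notation V := 'rV[R]_d.
Hypotheses (hwf : well_formed_data D) (C0 : 0 < C) (hass : standing_assumptions D C).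
Variables (u : nat -> V -> R) (alpha : nat -> V -> V) (m : nat -> probability V R).
Variables (mu : nat -> probability 'rV[R]_(d + d) R) (b : flow R d T).
Hypothesis hsol : mfg_solution D u alpha m mu b.
Context {n : nat} {dO : measure_display} {Omega : measurableType dO}.
Context {Pr : probability Omega R}.
Variables (X0 : 'I_n.+1 -> {RV Pr >-> V}) (Y : 'I_n.+1 -> nat -> {RV Pr >-> V}).
Hypothesis hN : game_noise D X0 Y.
Local Notation F := (filt X0 Y).
Local Notation adm := (@admissible R d T n dO Omega Pr X0 Y).
Local Notation fb := (feedback_state X0 Y alpha).
Local Notation Abar := (feedback_control X0 Y alpha).

Let hF t : F t `<=` measurable. Proof. exact: filt_measurable. Qed.

Let hFS t : <<s F t >> `<=` <<s F t.+1 >>. Proof. exact: filtS. Qed.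

Lemma adm_filt A t : adm A -> (t < T)%N -> sub_measurable (F t) (A t).
Proof. by move=> hA tT; case: (hA t tT). Qed.

Lemma adm_meas A t : adm A -> (t < T)%N -> measurable_fun setT (A t).
Proof. by move=> hA tT; exact: (sub_measurableW (@hF t) (adm_filt hA tT)). Qed.

Lemma adm_L2 A t : adm A -> (t < T)%N -> L2 Pr (fun w => enorm (A t w)).
Proof.
move=> hA tT; have mA := adm_meas hA tT; have [_ fA] := hA t tT.
split; first exact: measurable_enorm.
apply: L1_finite; first by apply: measurable_funX; exact: measurable_enorm.
by under eq_integral do rewrite /= ger0_norm ?sqr_ge0//.
Qed.

Lemma state_filt i A t : adm A -> (t <= T)%N -> sub_measurable (F t) (state X0 Y i A t).
Proof.
move=> hA; elim: t => [|t IH] tT; first exact: X0_filt.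
apply: measurable_rVD; last exact: Y_filt.
apply: measurable_rVD; apply: (sub_measurableS (@hFS t)).
  by apply: IH; exact: ltnW.
exact: adm_filt.
Qed.

Lemma state_meas i A t : adm A -> (t <= T)%N -> measurable_fun setT (state X0 Y i A t).
Proof.
by move=> hA tT; exact: (sub_measurableW (@hF t) (state_filt i hA tT)).
Qed.

(** One square integrable random variable that bounds all states and actions. *)
Definition size_path i (A : nat -> Omega -> V) (w : Omega) : R :=
  enorm (X0 i w) + \sum_(t < T) (enorm (A t w) + enorm (Y i t w)).

Lemma size_path_ge0 i A w : 0 <= size_path i A w.
Proof. by rewrite addr_ge0 ?enorm_ge0// sumr_ge0// => t _; rewrite addr_ge0 ?enorm_ge0. Qed.

Lemma state_le_size i A t w : (t <= T)%N -> enorm (state X0 Y i A t w) <= size_path i A w.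
Proof.
move=> tT; apply: (@le_trans _ _ (enorm (X0 i w) + \sum_(s < t) (enorm (A s w) + enorm (Y i s w)))).
  elim: t {tT} => [|t IH] /=; first by rewrite big_ord0 addr0.
  rewrite big_ord_recr/= addrA; apply: le_trans (enormD _ _) _.
  by have := enormD (state X0 Y i A t w) (A t w); lra.
rewrite lerD2l (big_ord_widen _ (fun s : nat => enorm (A s w) + enorm (Y i s w)) tT).
rewrite big_mkcond/=; apply: ler_sum => s _; case: ifP => // _.
by rewrite addr_ge0 ?enorm_ge0.
Qed.

Lemma action_le_size i A t w : (t < T)%N -> enorm (A t w) <= size_path i A w.
Proof.
move=> tT; rewrite /size_path (bigD1 (Ordinal tT))//=.
have : 0 <= \sum_(s < T | s != Ordinal tT) (enorm (A s w) + enorm (Y i s w)).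
  by apply: sumr_ge0 => s _; rewrite addr_ge0 ?enorm_ge0.
have := enorm_ge0 (X0 i w); have := enorm_ge0 (Y i t w); lra.
Qed.

Lemma L2_init : L2 (init D) enorm.
Proof. by apply: L2_enorm; exact: init_moment. Qed.

Lemma moment_Ex k (nu : probability 'rV[R]_k R) c : L2 nu enorm -> moment_le 2 c nu ->
  Ex nu (fun x => enorm x ^+ 2) <= c.
Proof. by move=> [_ h] hc; rewrite -lee_fin -ExE. Qed.

Lemma law_sqr k (nu : probability 'rV[R]_k R) (X : Omega -> 'rV[R]_k) :
  measurable_fun setT X -> eq_law (pushforward Pr X) nu -> L2 nu enorm ->
  L2 Pr (fun w => enorm (X w)) /\
  Ex Pr (fun w => enorm (X w) ^+ 2) = Ex nu (fun x => enorm x ^+ 2).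
Proof.
move=> mX lX hnu; have [_ h] := hnu; split; last by rewrite (Ex_law mX lX h).
split; first exact: measurable_enorm.
by apply/(L1_law mX lX (f := fun x => enorm x ^+ 2)) => //; exact: L1_meas h.
Qed.

Lemma X0_sqr i : L2 Pr (fun w => enorm (X0 i w)) /\ Ex Pr (fun w => enorm (X0 i w) ^+ 2) <= C.
Proof.
have mX : measurable_fun setT (X0 i) by exact: measurable_funPT.
have lX : eq_law (pushforward Pr (X0 i)) (init D) by move=> A mA; exact: (X0_law hN i mA).
have [h1 ->] := law_sqr mX lX L2_init; split=> //.
by apply: moment_Ex; [exact: L2_init|exact: init_bound hass].
Qed.

Lemma Y_sqr i t : (t < T)%N ->
  L2 Pr (fun w => enorm (Y i t w)) /\ Ex Pr (fun w => enorm (Y i t w) ^+ 2) <= C.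
Proof.
move=> tT.
have mX : measurable_fun setT (Y i t) by exact: measurable_funPT.
have lX : eq_law (pushforward Pr (Y i t)) (noise D t) by move=> A mA; exact: (Y_law hN i tT mA).
have hL := L2_noise hwf tT.
have [h1 ->] := law_sqr mX lX hL; split=> //.
by apply: moment_Ex => //; exact: (noise_bound hass tT).
Qed.

Definition energy (A : nat -> Omega -> V) (w : Omega) : R := \sum_(t < T) enorm (A t w) ^+ 2.

Lemma energy_L1 A : adm A -> L1 Pr (energy A).
Proof.
move=> hA; apply: (@L1_ext _ _ _ _ (fun w => \sum_(t < T) enorm (A t w) ^+ 2)) => //.
by apply: L1_sum => t; apply: L2_sqr; apply: (adm_L2 hA).
Qed.

Lemma size_path_sqr i A : adm A ->
  L2 Pr (size_path i A) /\
  Ex Pr (fun w => size_path i A w ^+ 2) <=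
    (2 * T.+1%:R) * (T.+1%:R * C + Ex Pr (energy A)).
Proof.
move=> hA; have [LX EX] := X0_sqr i.
have LA (t : 'I_T) : L2 Pr (fun w => enorm (A t w)) by apply: (adm_L2 hA).
have LY (t : 'I_T) : L2 Pr (fun w => enorm (Y i t w)) by case: (Y_sqr i (ltn_ord t)).
have EY (t : 'I_T) : Ex Pr (fun w => enorm (Y i t w) ^+ 2) <= C by case: (Y_sqr i (ltn_ord t)).
have LS : L2 Pr (size_path i A).
  by apply: L2D => //; apply: L2_sum => t; exact: L2D.
split=> //.
have LE := energy_L1 hA.
pose yy w := \sum_(t < T) enorm (Y i t w) ^+ 2.
have Lyy : L1 Pr yy by apply: L1_sum => t; exact: L2_sqr.
apply: (@le_trans _ _ (Ex Pr (fun w =>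
    (2 * T.+1%:R) * (enorm (X0 i w) ^+ 2 + (yy w + energy A w))))).
  apply: Ex_le; first exact: L2_sqr.
    by apply: L1Z; apply: L1D; [exact: L2_sqr|exact: L1D].
  move=> w.
  pose f (k : 'I_T.+1) :=
    if unlift ord0 k is Some t then enorm (A t w) + enorm (Y i t w) else enorm (X0 i w).
  have := sum_sqr_le f; rewrite card_ord !big_ord_recl {1 3}/f unlift_none.
  have fE (t : 'I_T) : f (lift ord0 t) = enorm (A t w) + enorm (Y i t w) by rewrite /f liftK.
  under eq_bigr do rewrite fE.
  under [X in _ <= _ * (_ + X) -> _]eq_bigr do rewrite fE.
  move=> h; rewrite /size_path; apply: (le_trans h).
  rewrite [2 * _]mulrC -mulrA ler_wpM2l// mulrDr /yy /energy -big_split/= mulr_sumr.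
  apply: lerD; first by have := sqr_ge0 (enorm (X0 i w)); lra.
  apply: ler_sum => t _; have := sqr_ge0 (enorm (A t w) - enorm (Y i t w)); lra.
rewrite ExZ; last by apply: L1D; [exact: L2_sqr|exact: L1D].
rewrite ler_wpM2l ?mulr_ge0// ExD; [|exact: L2_sqr|exact: L1D].
rewrite ExD// addrA lerD2r -natr1 mulrDl mul1r addrC; apply: lerD => //.
rewrite /yy Ex_sum; last by move=> t; exact: L2_sqr.
rewrite -[T in leRHS](card_ord T) mulr_natl -sumr_const.
by apply: ler_sum => t _.
Qed.

Lemma alpha_lip t x y : (t < T)%N -> enorm (alpha t x - alpha t y) <= 1 * enorm (x - y).
Proof. by move=> tT; rewrite mul1r; exact: (sol_alpha_lip hsol tT). Qed.

Lemma state_feedback i t w : state X0 Y i (Abar i) t w = fb i t w.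
Proof. by elim: t => //= t ->. Qed.

(** A feedback control looks only at the state of its player. *)
Lemma fb_own i t : (t <= T)%N -> sub_measurable (own (T := T) X0 Y i) (fb i t).
Proof.
elim: t => [|t IH] tT /=; first exact: X0_own.
have mfb := IH (ltnW tT).
apply: measurable_rVD; last exact: Y_own.
by apply: measurable_rVD => //; apply: (measurable_elip_map mfb) => x y; exact: alpha_lip.
Qed.

Lemma fb_filt i t : (t <= T)%N -> sub_measurable (F t) (fb i t).
Proof.
elim: t => [|t IH] tT /=; first exact: X0_filt.
have mfb : sub_measurable (F t.+1) (fb i t).
  by apply: (sub_measurableS (@hFS t)); apply: IH; exact: ltnW.
apply: measurable_rVD; last exact: Y_filt.
by apply: measurable_rVD => //; apply: (measurable_elip_map mfb) => x y; exact: alpha_lip.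
Qed.

Lemma fb_meas i t : (t <= T)%N -> measurable_fun setT (fb i t).
Proof.
by move=> tT; exact: (sub_measurableW (@hF t) (fb_filt i tT)).
Qed.

(** The state at time t is independent of the next noise, so that its law obeys the
    recursion by convolution that defines m. *)
Lemma fb_law i t : (t <= T)%N -> eq_law (pushforward Pr (fb i t)) (m t).
Proof.
elim: t => [|t IH] tT.
  by move=> A mA; rewrite (sol_m_init hsol)//; exact: (X0_law hN i mA).
have lfb := IH (ltnW tT); have mfb := fb_filt i (ltnW tT).
pose g (x : V) := x + alpha t x.
have mg : measurable_fun setT g.
  apply: measurable_rVD; first exact: measurable_id.
  by apply: (@measurable_elip_map _ _ _ _ _ id (alpha t) 1) => // x y; exact: alpha_lip.
have mgfb : sub_measurable (F t) (fun w => g (fb i t w)) by exact: (measurableT_comp mg mfb).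
have mgfb' := sub_measurableW (@hF t) mgfb.
have mYt : measurable_fun setT (Y i t) by exact: measurable_funPT.
pose pair w := (Y i t w, g (fb i t w)).
have mpair : measurable_fun setT pair by apply/measurable_fun_pairP; split.
pose mg' := push_law (m t) mg.
have key S : measurable S -> (noise D t \x mg')%E S = Pr (pair @^-1` S).
  move=> mS; rewrite (@product_measure_unique _ _ _ _ _ (noise D t) mg' (push_law Pr mpair))//.
  move=> A B mA mB; rewrite /=.
  have -> : push_law Pr mpair (A `*` B) =
      Pr ((fun w => g (fb i t w)) @^-1` B `&` Y i t @^-1` A).
    by rewrite setIC.
  have GB : <<s F t >> ((fun w => g (fb i t w)) @^-1` B).
    by have := mgfb measurableT B mB; rewrite setTI.
  rewrite (Y_indep_filt hN i tT GB mA) muleC; congr (_ * _)%E.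
    exact: (Y_law hN i tT mA).
  change (Pr ((fun w => g (fb i t w)) @^-1` B) = m t (g @^-1` B)).
  have mgB : measurable (g @^-1` B).
    by have mg2 := mg; rewrite -[X in measurable X]setTI; exact: mg2.
  exact: (lfb _ mgB).
move=> A mA; rewrite (sol_m_step hsol)// /convolution /pushforward.
have mS : measurable ((fun z : V * V => z.1 + z.2) @^-1` A).
  rewrite -[X in measurable X]setTI; apply: measurable_rVD => //.
rewrite [RHS](key _ mS); congr (Pr _); apply/seteqP; split=> w /=; by rewrite addrC.
Qed.

Lemma fb_sqr i t : (t <= T)%N -> L2 Pr (fun w => enorm (fb i t w)) /\
  Ex Pr (fun w => enorm (fb i t w) ^+ 2) = Ex (m t) (fun x => enorm x ^+ 2).
Proof.
move=> tT; apply: law_sqr; [exact: fb_meas|exact: fb_law|].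
by apply: L2_enorm; exact: (sol_m_moment hsol tT).
Qed.

Lemma alpha_growth t x : (t < T)%N -> enorm (alpha t x) <= enorm (alpha t 0) + enorm x.
Proof.
move=> tT; have := alpha_lip x 0 tT; rewrite mul1r subr0.
by have := enormD (alpha t x - alpha t 0) (alpha t 0); rewrite subrK; lra.
Qed.

Definition feedback_energy : R :=
  \sum_(t < T) (2 * enorm (alpha t 0) ^+ 2 + 2 * Ex (m t) (fun x => enorm x ^+ 2)).

Lemma feedback_admissible i : adm (Abar i).
Proof.
move=> t tT; have mfb := fb_filt i (ltnW tT).
have mA : sub_measurable (F t) (Abar i t).
  by apply: (measurable_elip_map mfb) => x y; exact: alpha_lip.
split=> //.
have mA' := sub_measurableW (@hF t) mA.
have [Lfb _] := fb_sqr i (ltnW tT).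
have L2A : L2 Pr (fun w => enorm (Abar i t w)).
  apply: (@L2_le _ _ _ _ _ (fun w => enorm (alpha t 0) + enorm (fb i t w))).
  - exact: measurable_enorm.
  - by move=> w; rewrite ger0_norm ?enorm_ge0// alpha_growth.
  - by apply: L2D => //; exact: L2_cst.
by rewrite (ExE (L2_sqr L2A)) ltry.
Qed.

Lemma feedback_energy_le i : Ex Pr (energy (Abar i)) <= feedback_energy.
Proof.
have hA := feedback_admissible i.
rewrite /energy Ex_sum; last by move=> t; apply: L2_sqr; exact: (adm_L2 hA).
apply: ler_sum => t _; have tT := ltn_ord t.
have [Lfb <-] := fb_sqr i (ltnW tT).
rewrite -ExZ; last exact: L2_sqr.
rewrite -[X in X + _](Ex_cst Pr) -ExD; [|exact: L1_cst|by apply: L1Z; exact: L2_sqr].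
apply: Ex_le.
- by apply: L2_sqr; exact: (adm_L2 hA).
- by apply: L1D; [exact: L1_cst|apply: L1Z; exact: L2_sqr].
move=> w; have := alpha_growth (fb i t w) tT; rewrite -/(Abar i t w).
have := enorm_ge0 (Abar i t w); have := enorm_ge0 (alpha t 0); have := enorm_ge0 (fb i t w).
have := sqr_ge0 (enorm (alpha t 0) - enorm (fb i t w)); nra.
Qed.

End trajectories.

(** * Regularity of the costs *)

Section costs.
Context {R : realType} {d T : nat} (D : mfg_data R d T) (C : R).
Local Notation V := 'rV[R]_d.
Hypotheses (hwf : well_formed_data D) (C0 : 0 < C) (hass : standing_assumptions D C).

Lemma cpl_bound t x b : (t <= T)%N -> B2 b -> `|cpl D t x b| <= C * (1 + enorm x).
Proof.
move=> tT hb; have [_ /(_ x)/andP[h1 h2]] := cpl_Q1 hass tT hb.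
rewrite expr1 in h2; rewrite ler_norml h2 andbT; apply: le_trans h1.
by rewrite lerN2 mulrDr mulr1 lerDl mulr_ge0 ?enorm_ge0// ltW.
Qed.

Lemma dotp_price t a b : (t < T)%N -> B2 b -> `|dotp a (price D t b)| <= C * enorm a.
Proof.
move=> tT hb; apply: le_trans (dotp_le _ _) _; rewrite mulrC ler_wpM2r ?enorm_ge0//.
exact: (price_bound hass tT hb).
Qed.

Lemma ell_bound t x a b : (t < T)%N -> B2 b ->
  `|ell D t x a b| <= 2^-1 * enorm a ^+ 2 + C * enorm a + C * (1 + enorm x).
Proof.
move=> tT hb; have := cpl_bound x (ltnW tT) hb; have := dotp_price a tT hb.
have := sqr_ge0 (enorm a); rewrite /ell !ler_norml => h0 /andP[h1 h2] /andP[h3 h4].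
by apply/andP; split; lra.
Qed.

Lemma ell_lower t x a b : (t < T)%N -> B2 b ->
  4^-1 * enorm a ^+ 2 - (C ^+ 2 + C) <= ell D t x a b.
Proof.
move=> tT hb; have := dotp_price a tT hb.
have [_ /(_ x)/andP[h1 _]] := cpl_Q1 hass (ltnW tT) hb.
have := sqr_ge0 (2^-1 * enorm a - C); rewrite /ell sqrrB exprMn => h2.
rewrite ler_norml => /andP[h3 h4]; lra.
Qed.

Lemma ell_dist t x a b c (delta : R) : (t < T)%N -> B2 b -> B2 c ->
  (d1_flow b c <= delta%:E)%E ->
  `|ell D t x a b - ell D t x a c| <= C * delta * (1 + enorm x + enorm a).
Proof.
move=> tT hb hc bc; have h1 := cpl_dist C0 hass x (ltnW tT) hb hc bc.
have h2 := price_dist C0 hass tT hb hc bc.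
have -> : ell D t x a b - ell D t x a c =
    (cpl D t x b - cpl D t x c) + dotp a (price D t b - price D t c).
  have -> : dotp a (price D t b - price D t c) = dotp a (price D t b) - dotp a (price D t c).
    by rewrite /dotp -sumrB; apply: eq_bigr => i _; rewrite !mxE mulrBr.
  by rewrite /ell; ring.
apply: le_trans (ler_normD _ _) _; rewrite [leRHS]mulrDr; apply: lerD => //.
by apply: le_trans (dotp_le _ _) _; rewrite mulrC ler_wpM2r// enorm_ge0.
Qed.

Lemma ell_measurable t b dS (S : measurableType dS) (x a : S -> V) : (t < T)%N -> B2 b ->
  measurable_fun setT x -> measurable_fun setT a ->
  measurable_fun setT (fun w => ell D t (x w) (a w) b).
Proof.
move=> tT hb mx ma; apply: measurable_funD.
  apply: measurable_funD.
    apply: measurable_funM; first exact: measurable_cst.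
    by apply: measurable_funX; exact: measurable_enorm.
  by apply: measurable_dotp => //; exact: measurable_cst.
exact: (measurable_fun_elip mx (cpl_lip C0 hass (ltnW tT) hb)).
Qed.

Lemma cpl_cont t b c x y (delta : R) : (t <= T)%N -> B2 b -> B2 c ->
  (d1_flow c b <= delta%:E)%E ->
  `|cpl D t y c - cpl D t x b| <= C * (enorm (y - x) + (1 + enorm x) * delta).
Proof.
move=> tT hb hc cb; have := cpl_lip C0 hass tT hc y x.
have := cpl_dist C0 hass x tT hc hb cb; rewrite !ler_norml => /andP[h1 h2] /andP[h3 h4].
by apply/andP; split; lra.
Qed.

Section player.
Context {n : nat} {dO : measure_display} {Omega : measurableType dO}.
Context {Pr : probability Omega R}.
Variables (X0 : 'I_n.+1 -> {RV Pr >-> V}) (Y : 'I_n.+1 -> nat -> {RV Pr >-> V}).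
Hypothesis hN : game_noise D X0 Y.
Local Notation adm := (@admissible R d T n dO Omega Pr X0 Y).
Local Notation St := (state X0 Y).

(** For a general random flow the cost could fail to be measurable; these conditions hold for
    constant flows and for empirical flows of admissible controls. *)
Definition admissible_flow i A (f : Omega -> flow R d T) : Prop :=
  [/\ forall w, B2 (f w),
      forall t, (t <= T)%N -> measurable_fun setT (fun w => cpl D t (St i A t w) (f w)) &
      forall t, (t < T)%N -> measurable_fun setT (fun w => price D t (f w))].

Lemma admissible_flow_cst i A b : adm A -> B2 b -> admissible_flow i A (fun=> b).
Proof.
move=> hA hb; split=> // t tT.
exact: (measurable_fun_elip (state_meas i hA tT) (cpl_lip C0 hass tT hb)).
Qed.

Lemma admissible_flow_empirical i A (AA : 'I_n.+1 -> control) : adm A ->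
  (forall j, adm (AA j)) -> admissible_flow i A (empirical_flow X0 Y AA).
Proof.
move=> hA hAA; split=> [w|t tT|t tT].
- exact: (point_flow_B2 (fun j t => St j (AA j) t w) (fun j t => AA j t w)).
- apply: (@measurable_point_flow _ _ _ _ (fun x b => cpl D t x b) C _ _ _
    (fun j t => St j (AA j) t) (fun j t => AA j t)) => //.
  - exact: ltW.
  - by move=> x y b c delta hb hc cb; exact: cpl_cont.
  - exact: (state_meas i hA tT).
  - by move=> j s sT; exact: (state_meas j (hAA j) sT).
  - by move=> j s sT; exact: (adm_meas (hAA j) sT).
apply/measurable_fun_mxP => k l; rewrite ord1.
apply: (@measurable_point_flow _ _ _ _ (fun x b => price D t b 0 l) C _ _ (fun=> 0)
  (fun j t => St j (AA j) t) (fun j t => AA j t)) => //.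
- exact: ltW.
- move=> x y b c delta hb hc cb; have := price_dist C0 hass tT hc hb cb.
  have := coord_le_enorm (price D t c - price D t b) l; rewrite !mxE => h1 h2.
  apply: (le_trans h1); apply: (le_trans h2); apply: ler_wpM2l; first exact: ltW.
  have d0 : 0 <= delta.
    by have := le_trans (enorm_ge0 _) h2; rewrite pmulr_rge0.
  by rewrite mulrDl mul1r addrCA lerDl addr_ge0 ?enorm_ge0// mulr_ge0 ?enorm_ge0.
- by move=> j s sT; exact: (state_meas j (hAA j) sT).
- by move=> j s sT; exact: (adm_meas (hAA j) sT).
Qed.

Lemma L1_cost i A f : adm A -> admissible_flow i A f -> L1 Pr (total_cost D X0 Y i A f).
Proof.
move=> hA [hf mc mp].
have [LS _] := size_path_sqr hwf hass hN i hA.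
pose S := size_path (T := T) X0 Y i A.
have S0 w : 0 <= S w by exact: size_path_ge0.
have LSc c : L1 Pr (fun w => C * (1 + c * S w)).
  by apply: L1Z; apply: L1D; [exact: L1_cst|apply: L1Z; exact: L2_L1].
apply: (@L1_le _ _ _ _ _ (fun w =>
   \sum_(t < T) (2^-1 * enorm (A t w) ^+ 2 + C * (1 + 2 * S w)) + C * (1 + 1 * S w))).
- apply: measurable_funD; last exact: mc.
  apply: measurable_sum => t; have tT := ltn_ord t.
  apply: measurable_funD; last exact: (mc t (ltnW tT)).
  apply: measurable_funD.
    apply: measurable_funM; first exact: measurable_cst.
    by apply: measurable_funX; apply: measurable_enorm; exact: (adm_meas hA).
  by apply: measurable_dotp; [exact: (adm_meas hA)|exact: mp].
- move=> w; apply: le_trans (ler_normD _ _) _; apply: lerD; last first.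
    apply: le_trans (cpl_bound _ (leqnn T) (hf w)) _; rewrite mul1r.
    rewrite ler_wpM2l ?lerD2l ?(ltW C0)//; exact: state_le_size.
  apply: le_trans (ler_norm_sum _ _ _) _; apply: ler_sum => t _.
  apply: le_trans (ell_bound _ _ (ltn_ord t) (hf w)) _.
  have h1 : C * enorm (A t w) <= C * S w.
    by rewrite ler_wpM2l ?(ltW C0)//; exact: action_le_size.
  have h2 : C * (1 + enorm (St i A t w)) <= C * (1 + S w).
    by rewrite ler_wpM2l ?lerD2l ?(ltW C0)//; exact: state_le_size (ltnW (ltn_ord t)).
  by move: h1 h2; lra.
- apply: L1D => //; apply: L1_sum => t; apply: L1D => //.
  by apply: L1Z; apply: L2_sqr; exact: (adm_L2 hA).
Qed.

Definition cost_floor : R := T%:R * (C ^+ 2 + C) + C.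

(** Half of the quadratic running cost absorbs the linear term, whose coefficient is bounded. *)
Lemma cost_lower i A f w : (forall w, B2 (f w)) ->
  4^-1 * energy (T := T) A w - cost_floor <= total_cost D X0 Y i A f w.
Proof.
move=> hf; rewrite /total_cost /cost_floor opprD addrA; apply: lerD; last first.
  by have [_ /(_ (St i A T w))/andP[]] := cpl_Q1 hass (leqnn T) (hf w).
have -> : T%:R * (C ^+ 2 + C) = \sum_(t < T) (C ^+ 2 + C).
  by rewrite sumr_const card_ord mulr_natl.
rewrite mulr_sumr -sumrB; apply: ler_sum => t _; exact: ell_lower.
Qed.

(** The costs are Lipschitz in the flow, with weights growing linearly in states and
    actions
    because the distance between the couplings of two flows grows linearly in the state. *)
Lemma cost_dist i A f g w (delta : R) : B2 (f w) -> B2 (g w) ->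
  (d1_flow (f w) (g w) <= delta%:E)%E -> 0 <= delta ->
  `|total_cost D X0 Y i A f w - total_cost D X0 Y i A g w| <=
  C * delta * ((2 * T%:R + 1) * (1 + size_path (T := T) X0 Y i A w)).
Proof.
move=> hf hg fg d0; set S := size_path _ _ _ _ _.
have S0 : 0 <= S by exact: size_path_ge0.
have Cd : 0 <= C * delta by rewrite mulr_ge0// ltW.
rewrite /total_cost opprD addrACA -sumrB; apply: le_trans (ler_normD _ _) _.
apply: (@le_trans _ _ (\sum_(t < T) (C * delta * (2 * (1 + S))) + C * delta * (1 + S))).
  apply: lerD.
    apply: le_trans (ler_norm_sum _ _ _) _; apply: ler_sum => t _.
    apply: le_trans (ell_dist _ _ (ltn_ord t) hf hg fg) _; rewrite ler_wpM2l//.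
    have := action_le_size X0 Y i A w (ltn_ord t).
    have := state_le_size X0 Y i A w (ltnW (ltn_ord t)).
    by rewrite -/S; lra.
  apply: le_trans (cpl_dist C0 hass _ (leqnn T) hf hg fg) _; rewrite ler_wpM2l// lerD2l.
  exact: state_le_size.
rewrite sumr_const card_ord -[_ *+ T]mulr_natl; lra.
Qed.

End player.
End costs.

(** * Verification theorem for the mean field cost *)

Section verification.
Context {R : realType} {d T : nat} (D : mfg_data R d T) (C : R).
Local Notation V := 'rV[R]_d.
Hypotheses (hwf : well_formed_data D) (C0 : 0 < C) (hass : standing_assumptions D C).
Variables (u : nat -> V -> R) (alpha : nat -> V -> V) (m : nat -> probability V R).
Variables (mu : nat -> probability 'rV[R]_(d + d) R) (b : flow R d T).
Hypothesis hsol : mfg_solution D u alpha m mu b.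
Context {n : nat} {dO : measure_display} {Omega : measurableType dO}.
Context {Pr : probability Omega R}.
Variables (X0 : 'I_n.+1 -> {RV Pr >-> V}) (Y : 'I_n.+1 -> nat -> {RV Pr >-> V}).
Hypothesis hN : game_noise D X0 Y.
Local Notation F := (filt X0 Y).
Local Notation adm := (@admissible R d T n dO Omega Pr X0 Y).
Local Notation St := (state X0 Y).

Let hF t : F t `<=` measurable. Proof. exact: filt_measurable. Qed.
Let hFS r t : (r <= t)%N -> <<s F r >> `<=` <<s F t >>. Proof. exact: filtS. Qed.
Let hb : B2 b. Proof. exact: sol_b_B2 hsol. Qed.

Lemma rational_approx k (z : 'rV[R]_k) e : 0 < e ->
  exists q : 'rV[rat]_k, enorm (z - map_mx ratr q) < e.
Proof.
move=> e0; pose r := e / (k%:R + 1); have r0 : 0 < r by rewrite divr_gt0// ltr_wpDl.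
have H i : exists q : rat, `|z 0 i - ratr q| < r.
  have lt2 : z 0 i - r < z 0 i + r by lra.
  have [q] := rat_in_itvoo lt2.
  by rewrite in_itv/= => /andP[h1 h2]; exists q; rewrite ltr_norml; lra.
have [q hq] := choice H; exists (\row_i q i).
apply: (le_lt_trans (enorm_le_sum _)); apply: (@le_lt_trans _ _ (\sum_(i < k) r)).
  by apply: ler_sum => i _; rewrite !mxE ltW.
rewrite sumr_const card_ord -mulr_natl /r mulrCA -ltr_pdivlMl//.
by rewrite mulVf ?gt_eqF// ltr_pdivrMr ?mul1r ?ltrDl ?ltr01// ltr_wpDl.
Qed.

Section fixed_player.
Variables (i : 'I_n.+1) (A : nat -> Omega -> V).
Hypothesis hA : adm A.

Let running t w := \sum_(s < t) ell D s (St i A s w) (A s w) b.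

(* By dynamic programming, rho makes this process a submartingale for every control and a
   martingale for the optimal one. *)
Let total t w := running t w + u t (St i A t w).

Let uL t : (t <= T)%N -> elip ((T - t).+1%:R * C) (u t).
Proof. exact: (value_lip hwf C0 hass hsol). Qed.

Let lip0 t : 0 <= (T - t).+1%:R * C. Proof. by rewrite mulr_ge0// ltW. Qed.

Let running_filt t s : (s <= t)%N -> (t < T)%N -> sub_measurable (F t) (running s.+1).
Proof.
move=> st tT; apply: (@measurable_sum _ (g_sigma_algebraType (F t)) R setT _ _
  (fun (r : 'I_s.+1) w => ell D r (St i A r w) (A r w) b)) => r.
have rt : (r <= t)%N by rewrite (leq_trans _ st)// -ltnS.
have rT := leq_ltn_trans rt tT.
apply: (ell_measurable C0 hass rT hb).
  exact: (sub_measurableS (@hFS _ _ rt) (state_filt i hA (ltnW rT))).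
exact: (sub_measurableS (@hFS _ _ rt) (adm_filt hA rT)).
Qed.

Let total_L1 t : (t <= T)%N -> L1 Pr (total t).
Proof.
move=> tT.
have LSt s : (s <= T)%N -> L2 Pr (fun w => enorm (St i A s w)).
  move=> sT; have [LS _] := size_path_sqr hwf hass hN i hA; apply: L2_le LS.
    by apply: measurable_enorm; exact: (state_meas i hA sT).
  by move=> w; rewrite ger0_norm ?enorm_ge0//; exact: state_le_size.
apply: L1D.
  apply: L1_sum => s; have sT := leq_trans (ltn_ord s) tT.
  apply: (@L1_le _ _ _ _ _ (fun w => 2^-1 * enorm (A s w) ^+ 2 + C * enorm (A s w) +
     C * (1 + enorm (St i A s w)))).
  - apply: (ell_measurable C0 hass sT hb); first exact: (state_meas i hA (ltnW sT)).
    exact: (adm_meas hA sT).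
  - by move=> w; exact: (ell_bound C0 hass).
  - have LA := adm_L2 hA sT.
    apply: L1D; first by apply: L1D; apply: L1Z; [exact: L2_sqr|exact: L2_L1].
    by apply: L1Z; apply: L1D; [exact: L1_cst|apply: L2_L1; exact: LSt (ltnW sT)].
apply: (@L1_le _ _ _ _ _ (fun w => `|u t 0| + (T - t).+1%:R * C * enorm (St i A t w))).
- exact: (measurable_fun_elip (state_meas i hA tT) (uL tT)).
- by move=> w; exact: (elip_growth (uL tT)).
- by apply: L1D; [exact: L1_cst|apply: L1Z; apply: L2_L1; exact: LSt].
Qed.

(** Freezing the past and integrating out the noise Y_t under the density Z. *)
Let scenario_total t Z : (t < T)%N -> dens D t Z ->
  is_cond_exp Pr (F t) (fun w => total t.+1 w * Z (Y i t w))
    (fun w => running t.+1 w + payoff D t (u t.+1) (St i A t w + A t w) Z).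
Proof.
move=> tT DZ.
have mZ := dens_measurable hwf tT DZ.
have mst := state_filt i hA (ltnW tT); have mAt := adm_filt hA tT.
have L1Z' := L1_density_fun hwf hass tT DZ.
have L1p z := L1_payoff hwf hass tT (uL tT) (lip0 t.+1) z DZ.
apply: (@freezing _ _ _ _ _ Pr _ (@hF t) (Y i t) (noise D t) (noise_measurable Y i t)
  (noise_law hN i tT) _
  (fun z => (running t.+1 z.1 + u t.+1 (St i A t z.1 + A t z.1 + z.2)) * Z z.2)).
- by move=> B S GB mS; exact: (Y_indep_filt hN i tT GB mS).
- apply: measurable_funM; last exact: (measurableT_comp mZ measurable_snd).
  apply: measurable_funD.
    exact: (measurableT_comp (running_filt (leqnn t) tT) measurable_fst).
  apply: (measurable_fun_elip _ (uL tT)).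
  apply: measurable_rVD; last exact: measurable_snd.
  by apply: measurable_rVD; [exact: (measurableT_comp mst measurable_fst)|
                             exact: (measurableT_comp mAt measurable_fst)].
- exact: (L1_dens hwf hass hN i tT DZ (total_L1 tT)).
- move=> w /=; have L1a := L1Z (running t.+1 w) L1Z'.
  have L1b := L1p (St i A t w + A t w).
  have E1 : running t.+1 w = Ex (noise D t) (fun y => running t.+1 w * Z y).
    by rewrite ExZ// (Ex_density_fun hwf tT DZ) mulr1.
  rewrite {1}E1 /payoff -ExD// -ExE; last exact: L1D.
  by apply: eq_integral => y _; rewrite mulrDl.
Qed.

(** The density that is nearly worst depends on the position, whereas rho compares with one
    density at a time, up to null sets. By Lipschitz continuity it is enough to use nearly
    worst densities for the countably many rational positions. *)
Lemma rho_total_ge t : (t < T)%N ->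
  {ae Pr, forall w, total t w <= rho D X0 Y i t (total t.+1) w}.
Proof.
move=> tT.
have hu := uL tT; have l0 := lip0 t.+1; set L := (T - t.+1).+1%:R * C in hu l0.
pose q0 (p : 'rV[rat]_d * nat) : V := map_mx ratr p.1.
have hz (p : 'rV[rat]_d * nat) : exists Z, dens D t Z /\
    worst D t (u t.+1) (q0 p) - p.2.+1%:R^-1 < payoff D t (u t.+1) (q0 p) Z.
  have k0 : 0 < p.2.+1%:R^-1 :> R by rewrite invr_gt0.
  have [Z DZ hZ] := worst_adherent hwf hass tT hu l0 (q0 p) k0.
  by exists Z.
have [Zf hZf] := choice hz.
have DZf p : dens D t (Zf p) by case: (hZf p).
have : {ae Pr, forall w, forall k : nat,
   running t.+1 w + payoff D t (u t.+1) (St i A t w + A t w) (Zf (odflt (0, 0%N) (unpickle k))) <=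
   rho D X0 Y i t (total t.+1) w}.
  apply/ae_foralln => k.
  apply: (rho_ge hwf hass hN tT (total_L1 tT)).
  exact: (ex_intro2 _ _ _ (DZf _) (scenario_total tT (DZf _))).
apply: filterS => w hw.
set z := St i A t w + A t w in hw.
suff : running t.+1 w + worst D t (u t.+1) z <= rho D X0 Y i t (total t.+1) w.
  apply: le_trans; rewrite /total /running big_ord_recr/= -addrA lerD2l.
  exact: (value_le hwf C0 hass hsol).
apply/ler_addgt0Pr => e e0.
pose e' := e / (2 * L + 1); have e'0 : 0 < e' by rewrite divr_gt0//; lra.
have [q hq] := rational_approx z (divr_gt0 e'0 (ltr0Sn R 1)).
have [k] := @ltr_add_invr R 0 (e' / 2) ltac:(lra); rewrite add0r => hk.
have := hw (pickle (q, k)); rewrite pickleK /= => h1.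
have [_] := hZf (q, k); rewrite /= => h2.
have h3 := worst_lip hwf hass tT hu l0 z (q0 (q, k)).
have h4 := payoff_lip hwf hass tT hu l0 (DZf (q, k)) z (q0 (q, k)).
have hLq : L * enorm (z - q0 (q, k)) <= L * (e' / 2) by rewrite ler_wpM2l// ltW.
move: h3 h4; rewrite !ler_norml => /andP[_ h3] /andP[h4 _].
have ee : (2 * L + 1) * e' = e by rewrite mulrC divfK// gt_eqF//; lra.
have Le : 0 <= L * e' by rewrite mulr_ge0// ltW.
move: hk h2; set kk := k.+1%:R^-1 => hk h2.
rewrite -ee; lra.
Qed.

Lemma Ex_rho_comp_total_ge t : (t <= T)%N ->
  Ex Pr (total 0) <= Ex Pr (rho_comp D X0 Y i t (total t)).
Proof.
elim: t => [//|t IH] tT; apply: le_trans (IH (ltnW tT)) _ => /=.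
have Lr := rho_L1 hwf hass hN i tT (total_L1 tT).
have L0 := total_L1 (ltnW tT).
apply: Ex_le_ae; try exact: (rho_comp_L1 hwf hass hN i (ltnW tT)).
by apply: (rho_comp_mono hwf hass hN i (ltnW tT)) => //; exact: rho_total_ge.
Qed.

Let totalT : total T = total_cost D X0 Y i A (fun=> b).
Proof. by apply/funext => w; rewrite /total /total_cost (sol_u_final hsol). Qed.

Let Ex_total0 : Ex Pr (total 0) = Ex (init D) (u 0%N).
Proof.
have mX : measurable_fun setT (X0 i) by exact: measurable_funPT.
have lX : eq_law (pushforward Pr (X0 i)) (init D) by move=> B mB; exact: (X0_law hN i mB).
have L1u : L1 (init D) (u 0%N) by exact: (elip_L1 (L2_init hwf) (lip0 0) (uL (leq0n T))).
rewrite (Ex_law mX lX L1u); apply: Ex_ext => w.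
by rewrite /total /running big_ord0 add0r.
Qed.

(** Verification: the submartingale property gives the lower bound for every control. *)
Lemma mf_cost_ge : Ex (init D) (u 0%N) <=
  Ex Pr (rho_comp D X0 Y i T (total_cost D X0 Y i A (fun=> b))).
Proof. by rewrite -Ex_total0 -totalT; exact: Ex_rho_comp_total_ge. Qed.

Section optimal.
Hypothesis A_opt : forall t w, (t < T)%N -> A t w = alpha t (St i A t w).

Lemma rho_total_le t : (t < T)%N ->
  {ae Pr, forall w, rho D X0 Y i t (total t.+1) w <= total t w}.
Proof.
move=> tT; have hu := uL tT; have l0 := lip0 t.+1.
have mtot : sub_measurable (F t) (total t).
  apply: measurable_funD.
    case: t tT {hu l0} => [|t] tT.
      rewrite (_ : running 0 = fun=> 0); first exact: measurable_cst.
      by apply/funext => w; rewrite /running big_ord0.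
    exact: running_filt.
  exact: (measurable_fun_elip (state_filt i hA (ltnW tT)) (uL (ltnW tT))).
apply: (rho_le hwf hass hN tT (total_L1 tT) mtot) => W [Z DZ HW].
have LZ := L1_dens hwf hass hN i tT DZ (total_L1 tT).
have h1 : {ae Pr, forall w, W w <= running t.+1 w + payoff D t (u t.+1) (St i A t w + A t w) Z}.
  by apply: (cond_exp_le (@hF t) LZ LZ HW (scenario_total tT DZ)); exact: aeW.
apply: filterS h1 => w /le_trans; apply.
rewrite /total (value_eq hwf C0 hass hsol _ tT) /running big_ord_recr/= -addrA lerD2l.
by rewrite -(A_opt w tT) lerD2l; exact: (worst_ge hwf hass tT hu l0).
Qed.

Lemma mf_cost_le :
  Ex Pr (rho_comp D X0 Y i T (total_cost D X0 Y i A (fun=> b))) <= Ex (init D) (u 0%N).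
Proof.
rewrite -Ex_total0 -totalT.
have H t : (t <= T)%N -> Ex Pr (rho_comp D X0 Y i t (total t)) <= Ex Pr (total 0).
  elim: t => [//|t IH] tT; apply: le_trans (IH (ltnW tT)) => /=.
  have Lr := rho_L1 hwf hass hN i tT (total_L1 tT).
  have L0 := total_L1 (ltnW tT).
  apply: Ex_le_ae; try exact: (rho_comp_L1 hwf hass hN i (ltnW tT)).
  by apply: (rho_comp_mono hwf hass hN i (ltnW tT)) => //; exact: rho_total_le.
exact: H.
Qed.

End optimal.
End fixed_player.
End verification.

(** * Distance between the game and the mean field costs *)

Section equilibrium_error.
Context {R : realType} {d T : nat} (D : mfg_data R d T) (C : R).
Local Notation V := 'rV[R]_d.
Hypotheses (hwf : well_formed_data D) (C0 : 0 < C) (hass : standing_assumptions D C).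
Variables (u : nat -> V -> R) (alpha : nat -> V -> V) (m : nat -> probability V R).
Variables (mu : nat -> probability 'rV[R]_(d + d) R) (b : flow R d T).
Hypothesis hsol : mfg_solution D u alpha m mu b.
Context {n : nat} {dO : measure_display} {Omega : measurableType dO}.
Context {Pr : probability Omega R}.
Variables (X0 : 'I_n.+1 -> {RV Pr >-> V}) (Y : 'I_n.+1 -> nat -> {RV Pr >-> V}).
Hypothesis hN : game_noise D X0 Y.
Local Notation adm := (@admissible R d T n dO Omega Pr X0 Y).
Local Notation St := (state X0 Y).
Local Notation fb := (feedback_state X0 Y alpha).
Local Notation Abar := (feedback_control X0 Y alpha).
Local Notation N := (n.+1%:R : R).

(* z stands for N^(-tau/2). *)
Variables (z K : R).
Hypotheses (z0 : 0 < z) (Nz : N^-1 <= z).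
Variable q : 'I_T.+1 -> Omega -> R.
Hypotheses (q_L2 : forall t, L2 Pr (q t)) (q_ge0 : forall t w, 0 <= q t w).
Hypothesis q_sqr : \sum_t Ex Pr (fun w => q t w ^+ 2) <= K * z ^+ 2.
Hypothesis q_lip : forall (t : 'I_T.+1) phi L, 0 <= L -> elip L phi ->
  forall w, `|N^-1 * (\sum_j phi (fb j t w)) - Ex (m t) phi| <= L * q t w.

(** Constants independent of N for deviations of energy at most M. They bound the mean squares
    of [size_path] and, after division by z ^ 2, of [flow_error], and then the error on the
    cost divided by z. *)
Definition size_bound (M : R) : R := (2 * T.+1%:R) * (T.+1%:R * C + M).

Definition error_bound (M : R) : R :=
  8 * (2 * T%:R + 1) ^+ 2 * size_bound M + 8 * T.+1%:R * K.

Definition cost_error_bound (M : R) : R :=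
  C ^+ T * (C * (2 * T%:R + 1) * 2^-1 * (error_bound M + 2 + 2 * size_bound M)).

Section deviation.
Variables (i : 'I_n.+1) (A : nat -> Omega -> V) (M : R).
Hypotheses (hA : adm A) (hM : Ex Pr (energy (T := T) A) <= M).
Hypothesis hMbar : feedback_energy (T := T) alpha m <= M.

Let AA := deviate i A Abar.
Let S := size_path (T := T) X0 Y i A.
Let Sb := size_path (T := T) X0 Y i (Abar i).

Let S_sqr : L2 Pr S /\ Ex Pr (fun w => S w ^+ 2) <= size_bound M.
Proof.
have [h1 h2] := size_path_sqr hwf hass hN i hA; split=> //.
by apply: le_trans h2 _; rewrite ler_wpM2l ?mulr_ge0// lerD2l.
Qed.

Let Sb_sqr : L2 Pr Sb /\ Ex Pr (fun w => Sb w ^+ 2) <= size_bound M.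
Proof.
have hAb := feedback_admissible hsol hN i.
have [h1 h2] := size_path_sqr hwf hass hN i hAb; split=> //.
apply: le_trans h2 _; rewrite ler_wpM2l ?mulr_ge0// lerD2l.
exact: le_trans (feedback_energy_le hsol hN i) hMbar.
Qed.

Let S0 w : 0 <= S w. Proof. exact: size_path_ge0. Qed.
Let Sb0 w : 0 <= Sb w. Proof. exact: size_path_ge0. Qed.

(** Only player i leaves the equilibrium, hence the factor 1/N; q is the error of the
    empirical measures at equilibrium, doubled because a test function of (x, alpha(x)) is
    2-Lipschitz in x. *)
Definition flow_error w : R :=
  (2 * T%:R + 1) * (N^-1 * (S w + Sb w)) + 2 * \sum_t q t w.

Lemma flow_error_ge0 w : 0 <= flow_error w.
Proof.
apply: addr_ge0; last by apply: mulr_ge0 => //; apply: sumr_ge0 => t _; exact: q_ge0.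
apply: mulr_ge0; first by apply: addr_ge0 => //; exact: mulr_ge0.
by apply: mulr_ge0; [rewrite invr_ge0|apply: addr_ge0; [exact: S0|exact: Sb0]].
Qed.

Lemma L2_flow_error : L2 Pr flow_error.
Proof.
have [h1 _] := S_sqr; have [h2 _] := Sb_sqr.
by apply: L2D; apply: L2Z; [apply: L2Z; exact: L2D|exact: L2_sum].
Qed.

Lemma flow_error_sqr : Ex Pr (fun w => flow_error w ^+ 2) <= error_bound M * z ^+ 2.
Proof.
have [h1 e1] := S_sqr; have [h2 e2] := Sb_sqr.
set k : R := 2 * T%:R + 1; have k0 : 0 <= k by rewrite addr_ge0// mulr_ge0.
have L1q : L1 Pr (fun w => \sum_t q t w ^+ 2) by apply: L1_sum => t; exact: L2_sqr.
have L1s : L1 Pr (fun w => S w ^+ 2 + Sb w ^+ 2) by apply: L1D; exact: L2_sqr.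
apply: (@le_trans _ _ (Ex Pr (fun w => (4 * k ^+ 2 * N^-1 ^+ 2) * (S w ^+ 2 + Sb w ^+ 2) +
    (8 * T.+1%:R) * \sum_t q t w ^+ 2))).
  apply: Ex_le; [exact: L2_sqr L2_flow_error|by apply: L1D; exact: L1Z|move=> w].
  have hq := sum_sqr_le (fun t => q t w); rewrite card_ord in hq.
  have h3 : (S w + Sb w) ^+ 2 <= 2 * (S w ^+ 2 + Sb w ^+ 2).
    by have := sqr_ge0 (S w - Sb w); lra.
  rewrite /flow_error -/k; set a := k * _; set c := 2 * _.
  have h4 : (a + c) ^+ 2 <= 2 * a ^+ 2 + 2 * c ^+ 2 by have := sqr_ge0 (a - c); lra.
  have ha : a ^+ 2 = (k ^+ 2 * N^-1 ^+ 2) * (S w + Sb w) ^+ 2.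
    by rewrite /a; set Ni := n.+1%:R^-1; ring.
  have h5 : a ^+ 2 <= (k ^+ 2 * N^-1 ^+ 2) * (2 * (S w ^+ 2 + Sb w ^+ 2)).
    by rewrite ha ler_wpM2l// mulr_ge0 ?sqr_ge0.
  have h6 : c ^+ 2 = 4 * (\sum_t q t w) ^+ 2 by rewrite /c; ring.
  move: h5; set Ni := n.+1%:R^-1 => h5; lra.
rewrite ExD; [|exact: L1Z|exact: L1Z].
rewrite !ExZ// ExD; [|exact: L2_sqr|exact: L2_sqr].
rewrite Ex_sum; last by move=> t; exact: L2_sqr.
rewrite /error_bound [leRHS]mulrDl; apply: lerD; last first.
  by rewrite -[leRHS]mulrA; apply: ler_wpM2l => //; exact: mulr_ge0.
have N2 : N^-1 ^+ 2 <= z ^+ 2 by rewrite ler_sqr ?nnegrE ?invr_ge0// ltW.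
have B0 : 0 <= size_bound M by apply: le_trans e1; apply: Ex_ge0 => w; exact: sqr_ge0.
have -> : 8 * (2 * T%:R + 1) ^+ 2 * size_bound M * z ^+ 2 =
   (4 * k ^+ 2 * z ^+ 2) * (2 * size_bound M) by rewrite /k; ring.
apply: ler_pM.
- by rewrite !mulr_ge0 ?sqr_ge0.
- by rewrite addr_ge0//; apply: Ex_ge0 => w; exact: sqr_ge0.
- by rewrite ler_wpM2l ?mulr_ge0 ?sqr_ge0.
- by lra.
Qed.

Let gap_one (f : 'I_n.+1 -> R) (c : R) : (forall j, j != i -> f j = 0) -> f i <= c ->
  N^-1 * \sum_j f j <= N^-1 * c.
Proof.
move=> f0 fc; rewrite ler_wpM2l ?invr_ge0//.
by rewrite (bigD1 i)//= big1 ?addr0// => j; exact: f0.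
Qed.

Lemma deviate_other j t w : j != i ->
  St j (AA j) t w = fb j t w /\ AA j t w = Abar j t w.
Proof.
by move=> ji; rewrite /AA /deviate (negbTE ji) state_feedback.
Qed.

(** Along the equilibrium actions are Lipschitz functions of states, so that the joint
    empirical measures converge as fast as those of the states; a single deviating player
    contributes 1/N of its size. *)
Lemma flow_error_bound w : (d1_flow (empirical_flow (T := T) X0 Y AA w) b <= (flow_error w)%:E)%E.
Proof.
have hb := sol_b_B2 hsol.
pose delta (t : 'I_T) := 2 * q (widen_ord (leqnSn T) t) w.
have joint (t : 'I_T) (phi : 'rV[R]_(d + d) -> R) : lip1 Num.norm phi ->
   N^-1 * (\sum_j phi (row_mx (fb j t w) (Abar j t w))) - Ex (b.1 t) phi <= delta t.
  move=> lphi; have tT := ltn_ord t.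
  pose psi x := phi (row_mx x (alpha t x)).
  have psiL : elip 2 psi.
    move=> x y; apply: le_trans (lphi _ _) _.
    rewrite opp_row_mx add_row_mx; apply: le_trans (enorm_row_mx _ _) _.
    by have := sol_alpha_lip hsol tT x y; lra.
  have mrow : measurable_fun setT (fun x : V => row_mx x (alpha t x)).
    apply: measurable_row_mx; first exact: measurable_id.
    by apply: (@measurable_elip_map _ _ _ _ _ id (alpha t) 1) => // x y; exact: (alpha_lip hsol).
  have lrow : eq_law (pushforward (m t) (fun x : V => row_mx x (alpha t x))) (b.1 t).
    by move=> B mB; rewrite (sol_b_joint hsol)// (sol_mu hsol tT).
  have L1phi : L1 (b.1 t) phi.
    by apply: (elip_L1 (L2_enorm (hb.1 t)) ler01); exact: lip1_elip.
  rewrite (Ex_law mrow lrow L1phi).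
  have := q_lip (widen_ord (leqnSn T) t) (ler0n _ 2) psiL w.
  by rewrite ler_norml /delta => /andP[_].
have final phi : lip1 Num.norm phi ->
   N^-1 * (\sum_j phi (fb j T w)) - Ex b.2 phi <= q ord_max w.
  move=> lphi.
  have -> : Ex b.2 phi = Ex (m T) phi.
    by congr fine; apply: eq_measure_integral => B mB _; exact: (sol_b_final hsol).
  have := q_lip ord_max ler01 (lip1_elip lphi) w.
  by rewrite ler_norml mul1r => /andP[_].
apply: le_trans (@point_flow_dist _ _ _ _ (fun j t => St j (AA j) t w) (fun j t => fb j t w)
  (fun j t => AA j t w) (fun j t => Abar j t w) b delta (q ord_max w) hb joint final) _.
rewrite lee_fin.
have AAi : AA i = A by rewrite /AA /deviate eqxx.
have dst t : (t <= T)%N -> enorm (St i (AA i) t w - fb i t w) <= S w + Sb w.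
  move=> tT; rewrite AAi; apply: le_trans (enormD _ _) _; rewrite enormN -state_feedback.
  by apply: lerD; exact: state_le_size.
have dac t : (t < T)%N -> enorm (AA i t w - Abar i t w) <= S w + Sb w.
  move=> tT; rewrite AAi; apply: le_trans (enormD _ _) _; rewrite enormN.
  by apply: lerD; exact: action_le_size.
have gt (t : 'I_T) : gap (fun j t => St j (AA j) t w) (fun j t => fb j t w)
    (fun j t => AA j t w) (fun j t => Abar j t w) t <= N^-1 * (2 * (S w + Sb w)).
  apply: gap_one => [j ji|].
    by have [-> ->] := deviate_other t w ji; rewrite !subrr !enorm0 addr0.
  have := dst t (ltnW (ltn_ord t)); have := dac t (ltn_ord t); lra.
have gT : gapT (T := T) (fun j t => St j (AA j) t w) (fun j t => fb j t w) <= N^-1 * (S w + Sb w).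
  apply: gap_one => [j ji|]; last exact: dst.
  by have [-> _] := deviate_other T w ji; rewrite subrr enorm0.
rewrite /flow_error big_ord_recr/=.
have qT := q_ge0 ord_max w.
have : \sum_(t < T) (gap (fun j t => St j (AA j) t w) (fun j t => fb j t w)
    (fun j t => AA j t w) (fun j t => Abar j t w) t + delta t) <=
   T%:R * (N^-1 * (2 * (S w + Sb w))) + 2 * \sum_(t < T) q (widen_ord (leqnSn T) t) w.
  rewrite big_split/= mulr_sumr; apply: lerD => //.
  have -> : T%:R * (N^-1 * (2 * (S w + Sb w))) = \sum_(t < T) N^-1 * (2 * (S w + Sb w)).
    by rewrite sumr_const card_ord mulr_natl.
  by apply: ler_sum => t _.
move: gT; set Ni := n.+1%:R^-1; lra.
Qed.

Lemma deviation_admissible j : adm (AA j).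
Proof.
by rewrite /AA /deviate; case: eqP => // _; exact: (feedback_admissible hsol hN).
Qed.

(** The risk measure is Lipschitz in L^1 and the costs are Lipschitz in the flow. Young's
    inequality with weight z separates the error on the flow, whose mean square is of order
    z ^ 2, from the size of the deviating path. *)
Lemma cost_error :
  `|Ex Pr (rho_comp D X0 Y i T (total_cost D X0 Y i A (empirical_flow X0 Y AA))) -
    Ex Pr (rho_comp D X0 Y i T (total_cost D X0 Y i A (fun=> b)))| <=
  cost_error_bound M * z.
Proof.
have hb := sol_b_B2 hsol.
have af1 := admissible_flow_empirical C0 hass i hA deviation_admissible.
have af2 := admissible_flow_cst C0 hass i hA hb.
have L1c1 := L1_cost hwf C0 hass hN hA af1.
have L1c2 := L1_cost hwf C0 hass hN hA af2.
apply: le_trans (risk_dist hwf C0 hass hN i L1c1 L1c2) _.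
rewrite /cost_error_bound -mulrA ler_wpM2l ?exprn_ge0 ?(ltW C0)//.
have [hS eS] := S_sqr; have hQ := L2_flow_error; have eQ := flow_error_sqr.
set k : R := 2 * T%:R + 1; have k0 : 0 <= k by rewrite addr_ge0// mulr_ge0.
have Ck : 0 <= C * k * 2^-1 by rewrite !mulr_ge0// ltW.
have L1Q := L2_sqr hQ; have L1S := L2_sqr hS; have L1c := L1_cst Pr 2.
have L1S' : L1 Pr (fun w => 2 + 2 * S w ^+ 2) by apply: L1D => //; exact: L1Z.
apply: (@le_trans _ _ (Ex Pr (fun w => (C * k * 2^-1) *
    (z^-1 * flow_error w ^+ 2 + z * (2 + 2 * S w ^+ 2))))).
  apply: Ex_le.
  - by apply: L1_norm; exact: L1B.
  - by apply: L1Z; apply: L1D; exact: L1Z.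
  move=> w; have fe0 := flow_error_ge0 w.
  have [af1B _ _] := af1.
  have hcd := cost_dist C0 hass X0 Y i A (f := empirical_flow X0 Y AA) (g := fun=> b)
    (af1B w) hb (flow_error_bound w) fe0.
  apply: le_trans hcd _.
  rewrite -/k -/(S w).
  have -> : C * flow_error w * (k * (1 + S w)) = (C * k * 2^-1) * (2 * flow_error w * (1 + S w)).
    by field.
  apply: ler_wpM2l => //.
  have zi : z * z^-1 = 1 by rewrite mulfV// gt_eqF.
  have : 0 <= z^-1 * (flow_error w - z * (1 + S w)) ^+ 2.
    by rewrite mulr_ge0 ?sqr_ge0// invr_ge0 ltW.
  have -> : z^-1 * (flow_error w - z * (1 + S w)) ^+ 2 =
    z^-1 * flow_error w ^+ 2 - (z * z^-1) * (2 * flow_error w * (1 + S w)) +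
    (z * z^-1) * (z * (1 + S w) ^+ 2) by ring.
  rewrite zi !mul1r => h1.
  have : 0 <= z * (1 - S w) ^+ 2 by rewrite mulr_ge0 ?sqr_ge0// ltW.
  lra.
rewrite ExZ; last by apply: L1D; exact: L1Z.
rewrite -[leRHS]mulrA; apply: ler_wpM2l => //.
rewrite ExD; [|exact: L1Z|exact: L1Z].
rewrite !ExZ// ExD//; last exact: L1Z.
rewrite Ex_cst ExZ//.
have h1 : z^-1 * Ex Pr (fun w => flow_error w ^+ 2) <= error_bound M * z.
  by rewrite ler_pdivrMl// mulrCA -expr2.
have h2 : z * (2 + 2 * Ex Pr (fun w => S w ^+ 2)) <= z * (2 + 2 * size_bound M).
  by rewrite ler_wpM2l ?(ltW z0)//; lra.
by lra.
Qed.

End deviation.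
End equilibrium_error.

(** * Approximate equilibrium *)

Section nash.
Context {R : realType} {d T : nat} (D : mfg_data R d T) (C : R).
Local Notation V := 'rV[R]_d.
Hypotheses (hwf : well_formed_data D) (C0 : 0 < C) (hass : standing_assumptions D C).
Variables (u : nat -> V -> R) (alpha : nat -> V -> V) (m : nat -> probability V R).
Variables (mu : nat -> probability 'rV[R]_(d + d) R) (b : flow R d T).
Hypothesis hsol : mfg_solution D u alpha m mu b.
Context {n : nat} {dO : measure_display} {Omega : measurableType dO}.
Context {Pr : probability Omega R}.
Variables (X0 : 'I_n.+1 -> {RV Pr >-> V}) (Y : 'I_n.+1 -> nat -> {RV Pr >-> V}).
Hypothesis hN : game_noise D X0 Y.
Local Notation adm := (@admissible R d T n dO Omega Pr X0 Y).
Local Notation fb := (feedback_state X0 Y alpha).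
Local Notation Abar := (feedback_control X0 Y alpha).
Local Notation N := (n.+1%:R : R).

Variables (z K : R).
Hypotheses (z0 : 0 < z) (z1 : z <= 1) (Nz : N^-1 <= z).
Variable q : 'I_T.+1 -> Omega -> R.
Hypotheses (q_L2 : forall t, L2 Pr (q t)) (q_ge0 : forall t w, 0 <= q t w).
Hypothesis q_sqr : \sum_t Ex Pr (fun w => q t w ^+ 2) <= K * z ^+ 2.
Hypothesis q_lip : forall (t : 'I_T.+1) phi L, 0 <= L -> elip L phi ->
  forall w, `|N^-1 * (\sum_j phi (fb j t w)) - Ex (m t) phi| <= L * q t w.

Let hb := sol_b_B2 hsol.

Let mf i A := Ex Pr (rho_comp D X0 Y i T (total_cost D X0 Y i A (fun=> b))).
Let game i A := Ex Pr (rho_comp D X0 Y i T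
  (total_cost D X0 Y i A (empirical_flow X0 Y (deviate i A Abar)))).

Let L1_mf i A : adm A -> L1 Pr (total_cost D X0 Y i A (fun=> b)).
Proof.
by move=> hA; apply: (L1_cost hwf C0 hass hN hA); exact: (admissible_flow_cst C0 hass).
Qed.

Let L1_game i A : adm A ->
  L1 Pr (total_cost D X0 Y i A (empirical_flow X0 Y (deviate i A Abar))).
Proof.
move=> hA; apply: (L1_cost hwf C0 hass hN hA).
apply: (admissible_flow_empirical C0 hass i hA) => j.
exact: (deviation_admissible hsol hN).
Qed.

Lemma J_mfE i A : adm A -> J_mf D X0 Y i A b = (mf i A)%:E.
Proof. by move=> hA; rewrite /J_mf (riskE hwf hass hN)//; exact: L1_mf. Qed.

Lemma J_deviateE i A : adm A -> J_game D X0 Y i (deviate i A Abar) = (game i A)%:E.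
Proof.
move=> hA; rewrite /J_game (_ : deviate i A Abar i = A); last by rewrite /deviate eqxx.
by rewrite (riskE hwf hass hN)//; exact: L1_game.
Qed.

Lemma deviate_id i : deviate i (Abar i) Abar = Abar.
Proof. by apply/funext => j; rewrite /deviate; case: eqP => // ->. Qed.

Lemma J_gameE i : J_game D X0 Y i Abar = (game i (Abar i))%:E.
Proof. by rewrite -[in LHS](deviate_id i) J_deviateE//; exact: (feedback_admissible hsol hN). Qed.

Local Notation err := (cost_error_bound (T := T) C K).
Local Notation Mbar := (feedback_energy (T := T) alpha m).

Lemma equilibrium_cost_error i : `|game i (Abar i) - mf i (Abar i)| <= err Mbar * z.
Proof.
apply: (cost_error hwf C0 hass hsol hN z0 Nz q_L2 q_ge0 q_sqr q_lip i) => //.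
- exact: (feedback_admissible hsol hN).
- exact: (feedback_energy_le hsol hN).
Qed.

Let V0 := Ex (init D) (u 0%N).

Lemma equilibrium_cost_le i : game i (Abar i) <= V0 + err Mbar * z.
Proof.
have hA := feedback_admissible hsol hN i.
have := equilibrium_cost_error i; rewrite ler_norml => /andP[_ h].
have h2 : mf i (Abar i) <= V0.
  have opt t w : (t < T)%N -> Abar i t w = alpha t (state X0 Y i (Abar i) t w).
    by rewrite state_feedback.
  exact: (mf_cost_le hwf C0 hass hsol hN hA opt).
by move: h h2; lra.
Qed.

(** Above this energy a deviation costs more than the equilibrium by coercivity, so that only
    deviations of uniformly bounded energy have to be compared with the mean field cost. *)
Definition energy_cap : R :=
  Mbar + 4 * C ^+ T * `| cost_floor (T := T) C + V0 + `|err Mbar| |.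

Lemma large_deviation_cost i A : adm A -> energy_cap < Ex Pr (energy (T := T) A) ->
  V0 + err Mbar * z <= game i A.
Proof.
move=> hA hE; set k := cost_floor (T := T) C.
have af : forall w, B2 (empirical_flow (T := T) X0 Y (deviate i A Abar) w).
  by move=> w; split=> [t|]; exact: empirical_moment.
have lowU w := cost_lower hass X0 Y i A w af.
have L1U := L1_game i hA; have L1e := energy_L1 hA.
have k_le : {ae Pr, forall w, - k <= total_cost D X0 Y i A
    (empirical_flow X0 Y (deviate i A Abar)) w}.
  apply/aeW => w; apply: le_trans (lowU w).
  by rewrite -/k lerDr mulr_ge0// sumr_ge0// => t _; exact: sqr_ge0.
apply: le_trans (risk_coercive hwf C0 hass hN i (leqnn T) L1U k_le).
have e1 : 4^-1 * Ex Pr (energy (T := T) A) <= Ex Pr (fun w => total_cost D X0 Y i A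
    (empirical_flow X0 Y (deviate i A Abar)) w + k).
  rewrite -ExZ//; apply: Ex_le; [exact: L1Z|by apply: L1D => //; exact: L1_cst|move=> w].
  by have := lowU w; rewrite -/k; lra.
have CT : 0 < C ^+ T by rewrite exprn_gt0.
have Ci : 0 <= C^-1 ^+ T by rewrite exprn_ge0// invr_ge0 ltW.
have ez : err Mbar * z <= `|err Mbar|.
  have h1 : err Mbar * z <= `|err Mbar| * z by rewrite ler_pM2r// ler_norm.
  have h2 : `|err Mbar| * z <= `|err Mbar| by rewrite ler_piMr.
  exact: le_trans h1 h2.
have h3 : k + V0 + `|err Mbar| <= C^-1 ^+ T * (4^-1 * Ex Pr (energy (T := T) A)).
  rewrite exprVn ler_pdivlMl//.
  have := ler_norm (k + V0 + `|err Mbar|).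
  set a := k + V0 + _ => ha.
  have h4 : C ^+ T * a <= C ^+ T * `|a| by rewrite ler_pM2l.
  have M0 : 0 <= Mbar.
    apply: le_trans (feedback_energy_le hsol hN i); apply: Ex_ge0 => w.
    by apply: sumr_ge0 => t _; exact: sqr_ge0.
  by move: hE h4; rewrite /energy_cap -/k -/a; lra.
have h5 := ler_wpM2l Ci e1.
lra.
Qed.

Lemma deviation_cost_ge i A : adm A ->
  game i (Abar i) - (err Mbar * z + `|err energy_cap| * z) <= game i A.
Proof.
move=> hA; have h0 := equilibrium_cost_le i.
have e0 : 0 <= `|err energy_cap| * z by rewrite mulr_ge0// ltW.
have [hE|hE] := leP (Ex Pr (energy (T := T) A)) energy_cap; last first.
  have h1 := large_deviation_cost i hA hE.
  have := le_trans (normr_ge0 _) (equilibrium_cost_error i).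
  lra.
have hM : Mbar <= energy_cap by rewrite /energy_cap lerDl !mulr_ge0// exprn_ge0// ltW.
have := cost_error hwf C0 hass hsol hN z0 Nz q_L2 q_ge0 q_sqr q_lip i hA hE hM.
have h1 : err energy_cap * z <= `|err energy_cap| * z by rewrite ler_pM2r// ler_norm.
have h2 : V0 <= mf i A by exact: (mf_cost_ge hwf C0 hass hsol hN i hA).
rewrite ler_norml -/(mf i A) -/(game i A) => /andP[h3 _].
move: h0 h1 h2 h3; move: (game i A) (game _ _) (mf i A) => a c e; lra.
Qed.

End nash.

Section powers_of_number_of_players.
Context {R : realType} (d n : nat) (xi : R).
Hypotheses (hd : (1 <= d)%N) (hxi : 0 < xi < 2^-1).
Local Notation tau := (tau d xi).

Lemma tau_gt0 : 0 < tau.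
Proof.
rewrite /Defs.tau; case: ifP => _; first by move: hxi => /andP[]; lra.
by rewrite invr_gt0 ltr0n.
Qed.

(** A grid of mesh N^(-tau/2) has about N^(tau d / 2) cells, and the mean square N^(tau d / 2 - 1)
    of the sampling error on their masses has to be below N^(- tau). *)
Lemma tau_rate : tau * (1 + d%:R / 2) < 1.
Proof.
have /andP[x0 x1] := hxi.
rewrite /Defs.tau; case: leqP => d2.
  have : d%:R <= 2 :> R by rewrite (ler_nat _ _ 2).
  have : 0 < 2^-1 - xi by lra.
  move=> t0 dR; apply: (@le_lt_trans _ _ ((2^-1 - xi) * 2)); last lra.
  by rewrite ler_pM2l//; lra.
have d3 : 3 <= d%:R :> R by rewrite (ler_nat _ 3).
by rewrite mulrC ltr_pdivrMr; lra.
Qed.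

Lemma tau_le1 : tau <= 1.
Proof.
have := tau_rate; have t0 := tau_gt0.
have : 0 <= tau * (d%:R / 2) by rewrite mulr_ge0 ?divr_ge0// ltW.
lra.
Qed.

Local Notation z := ((n.+1%:R : R) `^ (- (tau / 2))).

Lemma rate_gt0 : 0 < z. Proof. by rewrite powR_gt0// ltr0n. Qed.

Lemma rate_le1 : z <= 1.
Proof.
rewrite -[leRHS](powRr0 (n.+1%:R)) ler_powR ?ler1n//.
by have := tau_gt0; lra.
Qed.

Lemma rate_ge : (n.+1%:R : R)^-1 <= z.
Proof.
rewrite -powR_inv1// ler_powR ?ler1n//.
by have := tau_le1; have := tau_gt0; lra.
Qed.

Lemma rate_sqr : z ^+ 2 = (n.+1%:R : R) `^ (- tau).
Proof. by rewrite -powR_mulrn ?powR_ge0// -powRrM; congr (_ `^ _); lra. Qed.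

End powers_of_number_of_players.

Theorem theorem5p4 (R : realType) (d T : nat) (hd : (1 <= d)%N) (hT : (1 <= T)%N)
    (D : mfg_data R d T) (hwf : well_formed_data D)
    (hass : exists2 C : R, 0 < C & standing_assumptions D C)
    (u : nat -> 'rV[R]_d -> R) (alpha : nat -> 'rV[R]_d -> 'rV[R]_d)
    (m : nat -> probability 'rV[R]_d R)
    (mu : nat -> probability 'rV[R]_(d + d) R) (b : flow R d T)
    (hsol : mfg_solution D u alpha m mu b)
    (xi : R) (hxi : 0 < xi < 2^-1) :
  exists2 C : R, 0 < C &
    forall (n : nat) (dO : measure_display) (Omega : measurableType dO)
      (Pr : probability Omega R)
      (X0 : 'I_n.+1 -> {RV Pr >-> 'rV[R]_d})
      (Y : 'I_n.+1 -> nat -> {RV Pr >-> 'rV[R]_d}),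
      game_noise D X0 Y ->
      let eps := C * n.+1%:R `^ (- (tau d xi / 2)) in
      let Abar := feedback_control X0 Y alpha in
      eps_nash D X0 Y eps Abar /\
      forall i : 'I_n.+1,
        (`|J_game D X0 Y i Abar - J_mf D X0 Y i (Abar i) b| <= eps%:E)%E.
Proof.
have [C C0 hC] := hass.
have rates (t : 'I_T.+1) := empirical_rate hd (tau_gt0 hd hxi) (tau_rate d hxi)
  (L2_enorm (sol_m_moment hsol (leq_ord t))).
have [K HK] := choice rates; pose Ks := \sum_t K t.
pose e1 := cost_error_bound (T := T) C Ks (feedback_energy (T := T) alpha m).
pose e2 := cost_error_bound (T := T) C Ks (energy_cap D C u alpha m Ks).
(* one error for the equilibrium cost, one for the cost of the deviation *)
exists (`|e1| + `|e2| + 1) => [|n dO Omega Pr X0 Y hN].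
  by rewrite ltr_wpDl// addr_ge0.
have z0 := rate_gt0 d n xi; have z1 := rate_le1 n hd hxi; have Nz := rate_ge n hd hxi.
have zz := rate_sqr d n xi; set z := n.+1%:R `^ (- (tau d xi / 2)) in z0 z1 Nz zz *.
move=> eps Abar.
have qs (t : 'I_T.+1) : exists q, [/\ L2 Pr q, forall w, 0 <= q w,
   Ex Pr (fun w => q w ^+ 2) <= K t * n.+1%:R `^ (- tau d xi) &
   forall phi L, 0 <= L -> elip L phi -> forall w,
    `|n.+1%:R^-1 * (\sum_j phi (feedback_state X0 Y alpha j t w)) - Ex (m t) phi| <= L * q w].
  have tT := leq_ord t; have [_ Hrate] := HK t.
  apply: (Hrate n dO Omega Pr (fun j => feedback_state X0 Y alpha j t)
    (fun j => own (T := T) X0 Y j)).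
  - by move=> i; exact: own_measurable.
  - by move=> i; exact: (fb_own hsol).
  - by move=> i; exact: (fb_law hsol hN i).
  move=> i j B A ij sB mA; apply: (own_indep hN ij) => //.
  by rewrite -[_ @^-1` _]setTI; apply: (fb_own hsol tT).
have [q hq] := choice qs.
have q_L2 t : L2 Pr (q t) by have [] := hq t.
have q_ge0 t w : 0 <= q t w by have [_ ->] := hq t.
have q_lip t := (let: And4 _ _ _ h := hq t in h).
have q_sqr : \sum_t Ex Pr (fun w => q t w ^+ 2) <= Ks * z ^+ 2.
  by rewrite zz mulr_suml; apply: ler_sum => t _; have [] := hq t.
have he1 : e1 * z + `|e2| * z <= eps.
  have : e1 * z <= `|e1| * z by rewrite ler_pM2r// ler_norm.
  by rewrite /eps; lra.
have hA := feedback_admissible hsol hN.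
split=> [|i]; first split=> // i.
  rewrite (J_gameE hwf C0 hC hsol hN) -leeBlDr//; apply: le_ereal_inf_tmp.
  move=> _ [A adA <-]; rewrite (J_deviateE hwf C0 hC hsol hN)// -EFinB lee_fin.
  apply: le_trans (deviation_cost_ge hwf C0 hC hsol hN z0 z1 Nz q_L2 q_ge0 q_sqr q_lip i adA).
  by rewrite lerD2l lerN2.
rewrite (J_gameE hwf C0 hC hsol hN) (J_mfE hwf C0 hC hsol hN)// -EFinB abse_EFin lee_fin.
apply: le_trans (equilibrium_cost_error hwf C0 hC hsol hN z0 Nz q_L2 q_ge0 q_sqr q_lip i) _.
by apply: le_trans he1; rewrite lerDl mulr_ge0// ltW.
Qed.
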